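(* Let $\Bbbk$ be an algebraically closed field and let $S=S(1,3)\subset\mathbb{P}^5$ be the smooth rational normal surface scroll, with hyperplane class $H$ and ruling line class $F$. Let $X$ be an effective divisor of $S$ linearly equivalent to $aH+bF$, where either $a=0$ and $b\ge 4$, or $a\ge 1$ and $b\ge 2$. Write each row $(\beta_{0,j},\dots,\beta_{4,j})$ of the Betti table $\beta(X)$ as a 5-tuple. Then $\beta(X)$ is the sum of the following rows (all rows not listed are zero, and whenever two of the listed row indices coincide the corresponding 5-tuples are added): (1) If $b=3\delta-1$ ($\delta\in\mathbb{Z}$): row $2$ is $(6,8,3,0,0)$; row $a+\delta$ is $(2,4,0,0,0)$; row $a+\delta+1$ is $(1,4,10,6,1)$; and for every $j$ with $0\le j\le \delta-2$, row $a+b-2j$ is $(1,4,6,4,1)$. (2) If $b=3\delta$ ($\delta\in\mathbb{Z}$): row $2$ is $(6,8,3,0,0)$; row $a+\delta$ is $(1,0,0,0,0)$; row $a+\delta+1$ is $(0,6,8,3,0)$; row $a+\delta+2$ is $(1,4,6,4,1)$; and for every $j$ with $0\le j\le\delta-2$, row $a+b-2j$ is $(1,4,6,4,1)$. (3) If $b=3\delta+1$ ($\delta\in\mathbb{Z}$): row $2$ is $(6,8,3,0,0)$; row $a+\delta+1$ is $(4,12,12,4,0)$; and for every $j$ with $0\le j\le\delta-1$, row $a+b-2j$ is $(1,4,6,4,1)$. Moreover $\beta_{i,j}(X)=0$ for $i\ge 5$.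
   Context: For integers $1\le a_1\le a_2$ and $r=a_1+a_2+1$, $S(a_1,a_2)\subset\mathbb{P}^r$ denotes the smooth rational normal surface scroll, i.e. the image of $\mathbb{P}(\mathcal{O}_{\mathbb{P}^1}(a_1)\oplus\mathcal{O}_{\mathbb{P}^1}(a_2))$ under the embedding by the tautological line bundle. Its divisor class group is freely generated by the class $H$ of a hyperplane section and the class $F$ of a ruling line. An effective divisor of $S$ is regarded as a closed subscheme of $\mathbb{P}^r$. Let $R=\Bbbk[x_0,\dots,x_r]$ be the homogeneous coordinate ring of $\mathbb{P}^r$ (here $r=5$). For a closed subscheme $X\subset\mathbb{P}^r$ with homogeneous (saturated) ideal $I(X)\subset R$, the graded Betti numbers are $\beta_{i,j}(X)=\dim_{\Bbbk}\operatorname{Tor}^R_i(I(X),\Bbbk)_{i+j}$, and the Betti table $\beta(X)$ is the table whose entry in column $i$ and row $j$ is $\beta_{i,j}(X)$. *)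

(* Defs.v *)
From HB Require Import structures.
From mathcomp Require Import all_boot all_order all_algebra.
From mathcomp Require Import ring.
From mathcomp.multinomials Require Import mpoly.

Set Implicit Arguments.
Unset Strict Implicit.
Unset Printing Implicit Defensive.

Import Order.TTheory GRing.Theory Num.Theory.
Local Open Scope ring_scope.

Section Ideals.
Variables (k : fieldType) (n : nat).
Local Notation R := {mpoly k[n]}.
Implicit Types (I J D T : R -> Prop) (p q g : R).

Definition is_ideal I : Prop :=
  [/\ I 0, (forall p q, I p -> I q -> I (p + q)) & (forall p q, I q -> I (p * q))].

Definition ideal_gen T : R -> Prop :=
  fun p => forall J, is_ideal J -> (forall q, T q -> J q) -> J p.

Definition ideal_eq I J : Prop := forall p, I p <-> J p.

Definition homogeneous_ideal I : Prop :=
  is_ideal I /\ (forall d p, I p -> I (pihomog mdeg d p)).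

(* I : (x_0, ..., x_{n-1})^oo *)
Definition saturation I : R -> Prop :=
  fun p => exists N : nat, forall m : 'X_{1..n}, mdeg m = N -> I ('X_[m] * p).

(* The saturated homogeneous ideals are exactly the ideals of the closed
   subschemes of P^(n-1). *)
Definition closed_subscheme_ideal I : Prop :=
  homogeneous_ideal I /\ (forall p, saturation I p -> I p).

(* p is homogeneous of degree z; for z < 0 this means p = 0. *)
Definition homogeneous_of_degree (z : int) p : Prop :=
  forall m, m \in msupp p -> (mdeg m)%:Z = z.

End Ideals.

Section Scroll.
Variables (k : fieldType) (a1 a2 : nat).
(* P^r with r = a1 + a2 + 1, i.e. a1 + a2 + 2 homogeneous coordinates *)
Local Notation R := {mpoly k[a1.+1 + a2.+1]}.
Implicit Types (I J D : R -> Prop) (p q g : R).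

(* (s : t) is a point of P^1 and (u, v) are fibre coordinates of
   P(O(a1) + O(a2)).  The global sections of the tautological line bundle are
   spanned by the s^(a1-i) t^i u and the s^(a2-j) t^j v. *)
Definition scroll_point (s t u v : k) : 'I_(a1.+1 + a2.+1) -> k :=
  fun i => match split i with
           | inl i1 => s ^+ (a1 - i1) * t ^+ i1 * u
           | inr i2 => s ^+ (a2 - i2) * t ^+ i2 * v
           end.

(* the ideal of the ruling line over (s : t) *)
Definition ruling_line (s t : k) : R -> Prop :=
  fun p => forall u v, p.@[scroll_point s t u v] = 0.

(* the ideal of S(a1, a2), which is the union of its ruling lines *)
Definition scroll_ideal : R -> Prop :=
  fun p => forall s t, (s, t) != (0, 0) -> ruling_line s t p.

(* Effective divisors of the scroll are represented by the ideals of the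
   corresponding closed subschemes of P^r.  The scroll being smooth, Weil and
   Cartier divisors agree: X is an effective divisor if it lies on S and is cut
   out on S, near each point of S, by one equation g which is not a zero
   divisor.  The factor h, which is invertible at the point, accounts for the
   localization. *)
Definition effective_divisor I : Prop :=
  [/\ closed_subscheme_ideal I,
      (forall p, scroll_ideal p -> I p)
    & forall s t u v, (s, t) != (0, 0) -> (u, v) != (0, 0) ->
        exists g h : R,
          [/\ exists d, g \is d.-homog for mdeg,
              I g /\ ~ scroll_ideal g,
              exists d, h \is d.-homog for mdeg,
              h.@[scroll_point s t u v] != 0
            & forall p, I p -> exists q, scroll_ideal (h * p - q * g)]].

(* the divisor cut out on the scroll by the form g *)
Definition divisor_cut g : R -> Prop :=
  saturation (ideal_gen (fun p => scroll_ideal p \/ p = g)).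

(* The ideal sheaf on S of D + D' is the product of those of D and D'. *)
Definition divisor_add D D' : R -> Prop :=
  saturation (ideal_gen (fun p => scroll_ideal p \/
     exists q q', [/\ D q, D' q' & p = q * q'])).

(* The zero divisor is the empty subscheme, whose ideal is the whole ring. *)
Definition divisor_muln (m : nat) D : R -> Prop :=
  iter m (divisor_add D) (fun _ => True).

(* D - D' is the divisor of the rational function g' / g on S. *)
Definition linearly_equivalent D D' : Prop :=
  exists d (g g' : R),
    [/\ g \is d.-homog for mdeg, g' \is d.-homog for mdeg,
        ~ scroll_ideal g, ~ scroll_ideal g'
      & ideal_eq (divisor_add D (divisor_cut g))
                 (divisor_add D' (divisor_cut g'))].

(* D is linearly equivalent to a H + b F *)
Definition in_divisor_class (a b : nat) D : Prop :=
  exists (l : R) (s t : k),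
    [/\ l != 0, l \is 1.-homog for mdeg, (s, t) != (0, 0)
      & linearly_equivalent D
          (divisor_add (divisor_muln a (divisor_cut l))
                       (divisor_muln b (ruling_line s t)))].

End Scroll.

Section Tor.
Variables (k : fieldType) (n : nat).
Local Notation R := {mpoly k[n]}.

(* For free modules with finite bases E and E', and the matrix phi of a map
   between them; vectors are multiplied by phi on the right. *)
Definition free_map (E E' : finType) (phi : E -> E' -> R)
    (v : {ffun E -> R}) : {ffun E' -> R} :=
  [ffun f => \sum_e v e * phi e f].

(* A graded resolution ... -> P_1 -> P_0 -> k -> 0 of the residue field
   k = R / (x_0, ..., x_{n-1}) by finitely generated graded free modules:
   res_basis i is a basis of P_i and res_deg gives the degrees of its
   elements.  The augmentation P_0 -> k is determined by the images of the
   basis elements, on which a polynomial acts through its constant term. *)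
Record residue_resolution := ResidueResolution {
  res_basis : nat -> finType;
  res_deg : forall i, res_basis i -> int;
  res_diff : forall i, res_basis i.+1 -> res_basis i -> R;
  res_aug : res_basis 0 -> k;
  res_diff_homog : forall i e f,
    homogeneous_of_degree (res_deg e - res_deg f) (@res_diff i e f);
  res_aug_homog : forall e, res_aug e != 0 -> res_deg e = 0;
  res_aug_surj : exists e, res_aug e != 0;
  res_exact0 : forall v : {ffun res_basis 0 -> R},
    \sum_e (v e)@_0%MM * res_aug e = 0 <->
    exists w, v = free_map (@res_diff 0) w;
  res_exact : forall i (v : {ffun res_basis i.+1 -> R}),
    free_map (@res_diff i) v = 0 <->
    exists w, v = free_map (@res_diff i.+1) w
}.

(* the degree z part of the tensor product of I and P_i *)
Definition tensor_part (P : residue_resolution) (I : R -> Prop) (i : nat)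
    (z : int) (v : {ffun res_basis P i -> R}) : Prop :=
  forall e, I (v e) /\ homogeneous_of_degree (z - res_deg e) (v e).

Definition res_cycle (P : residue_resolution) (i : nat) :
    {ffun res_basis P i -> R} -> Prop :=
  match i with
  | 0 => fun _ => True
  | i'.+1 => fun v => free_map (@res_diff P i') v = 0
  end.

Definition tor_cycle (P : residue_resolution) (I : R -> Prop) (i : nat)
    (z : int) (v : {ffun res_basis P i -> R}) : Prop :=
  tensor_part I z v /\ res_cycle v.

Definition tor_boundary (P : residue_resolution) (I : R -> Prop) (i : nat)
    (z : int) (v : {ffun res_basis P i -> R}) : Prop :=
  exists2 w : {ffun res_basis P i.+1 -> R},
    tensor_part I z w & v = free_map (@res_diff P i) w.

(* dim_k Z / B = m, for subspaces B of Z of a vector space V *)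
Definition quotient_dim (V : lmodType k) (Z B : V -> Prop) (m : nat) : Prop :=
  exists u : 'I_m -> V,
    [/\ forall c, Z (u c),
        forall z, Z z -> exists c : 'I_m -> k, B (z - \sum_l c l *: u l)
      & forall c : 'I_m -> k, B (\sum_l c l *: u l) -> forall l, c l = 0].

(* The graded Betti number beta_(i,j), i.e. dim_k Tor_i(I, k)_(i+j), is m.
   Tor_i(I, k) is the i-th homology of the tensor product of I and P, for any
   graded free resolution P of k; koszul_resolution below is one. *)
Definition betti_number (I : R -> Prop) (i : nat) (j : int) (m : nat) : Prop :=
  forall P : residue_resolution,
    quotient_dim (@tor_cycle P I i (i%:Z + j)) (@tor_boundary P I i (i%:Z + j)) m.

End Tor.

(* the entry (i, j) of the table with row l equal to s and all others zero *)
Definition table_row (l : nat) (s : seq nat) (i : nat) (j : int) : nat :=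
  if j == l%:Z then nth 0%N s i else 0%N.

Module Koszul.
Section Koszul.
Variables (k : fieldType) (n : nat).
Local Notation R := {mpoly k[n]}.
Implicit Types (x y : 'I_n) (A B : {set 'I_n}) (p q : R).

Definition basis (i : nat) : finType := {A : {set 'I_n} | #|A| == i}.

Definition sign x A : R := (-1) ^+ #|[set y in A | (y < x)%N]|.

Definition diff i (A : basis i.+1) (B : basis i) : R :=
  \sum_(x in val A | val B == val A :\ x) sign x (val A) * 'X_x.

Definition aug (A : basis 0) : k := 1.

(* The Koszul differential on the whole exterior algebra; a function v stands
   for the sum of the v B e_B. *)
Local Notation W := ({set 'I_n} -> R).
Implicit Types (v w z : W) (s : seq 'I_n) (m : 'X_{1..n}).

Definition bd v : W :=
  fun B => \sum_(x | x \notin B) sign x B * 'X_x * v (x |: B).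

(* division by x, dropping the monomials that x does not divide *)
Definition dvx x p : R :=
  \sum_(m <- msupp p) p@_m *: (if m x == 0%N then 0 else 'X_[m - U_(x)]).

Lemma dvxE x p m : (dvx x p)@_m = p@_(m + U_(x)).
Proof.
rewrite /dvx raddf_sum /= [in RHS](mpolyE p) raddf_sum /=.
apply: eq_bigr => m' _; rewrite !mcoeffZ; congr (_ * _).
case: eqP => [m'0|/eqP m'0]; rewrite ?mcoeff0 !mcoeffX.
  case: eqP => // /mnmP /(_ x); rewrite mnmDE mnm1E eqxx m'0 addn1 => //.
congr (_%:R); congr (nat_of_bool _).
apply/eqP/eqP => [<-|->]; last by rewrite addmK.
by rewrite submK // lep1mP.
Qed.

Lemma dvxD x p q : dvx x (p + q) = dvx x p + dvx x q.
Proof. by apply/mpolyP => m; rewrite mcoeffD !dvxE mcoeffD. Qed.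

Lemma dvxZ x c p : dvx x (c *: p) = c *: dvx x p.
Proof. by apply/mpolyP => m; rewrite mcoeffZ !dvxE mcoeffZ. Qed.

Lemma dvx0 x : dvx x 0 = 0.
Proof. by apply/mpolyP => m; rewrite dvxE !mcoeff0. Qed.

Lemma dvx_sum x (J : finType) (P : pred J) (F : J -> R) :
  dvx x (\sum_(j | P j) F j) = \sum_(j | P j) dvx x (F j).
Proof. exact: (big_morph (dvx x) (dvxD x) (dvx0 x)). Qed.

Lemma dvxS x (e : nat) p : dvx x ((-1) ^+ e * p) = (-1) ^+ e * dvx x p.
Proof.
rewrite -signr_odd; case: (odd e); rewrite ?expr1 ?expr0 ?mul1r // !mulN1r.
by rewrite -!scaleN1r dvxZ.
Qed.

Lemma dvxXx x p : dvx x ('X_x * p) = p.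
Proof. by apply/mpolyP => m; rewrite dvxE mulrC addmC mcoeffMX. Qed.

Lemma dvxXy x y p : y != x -> dvx x ('X_y * p) = 'X_y * dvx x p.
Proof.
move=> yx; elim/mpolyind: p => [|c m p _ _ IH]; first by rewrite mulr0 !dvx0 mulr0.
rewrite mulrDr !dvxD mulrDr IH; congr (_ + _).
rewrite -scalerAr !dvxZ -scalerAr; congr (_ *: _); rewrite -mpolyXD.
apply/mpolyP => m'; rewrite dvxE.
have -> : dvx x 'X_[m] = if m x == 0%N then 0 else 'X_[m - U_(x)].
  by rewrite /dvx msuppX big_seq1 mcoeffX eqxx scale1r.
case: eqP => [m0|/eqP m0].
  rewrite mulr0 mcoeff0 mcoeffX; case: eqP => // /mnmP /(_ x).
  by rewrite !mnmDE !mnm1E m0 (negPf yx) eqxx addn1.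
rewrite -mpolyXD !mcoeffX; congr (_%:R); congr (nat_of_bool _).
have em : (U_(y) + m)%MM = (U_(y) + (m - U_(x)) + U_(x))%MM.
  by rewrite -addmA submK // lep1mP.
rewrite em; apply/eqP/eqP => [|->] //; exact: addIm.
Qed.

Lemma signK x A p : sign x A * (sign x A * p) = p.
Proof. by rewrite mulrA -expr2 sqrr_sign mul1r. Qed.

Lemma signU x y B : y \notin B ->
  sign x (y |: B) = (-1) ^+ (y < x)%N * sign x B.
Proof.
move=> yB; rewrite /sign -exprD; congr (_ ^+ _).
case: (boolP (y < x)%N) => yx.
  have -> : [set z in y |: B | (z < x)%N] = y |: [set z in B | (z < x)%N].
    by apply/setP => z; rewrite !inE; case: eqP => [->|].
  by rewrite cardsU1 !inE (negPf yB).
have -> // : [set z in y |: B | (z < x)%N] = [set z in B | (z < x)%N].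
by apply/setP => z; rewrite !inE; case: eqP => [->|] //; rewrite (negPf yx) !andbF.
Qed.

Lemma sign_anti x y B : x \notin B -> y \notin B -> x != y ->
  sign x B * sign y (x |: B)
  = - (sign y B * sign x (y |: B)).
Proof.
move=> xB yB xy; rewrite !signU //.
have -> : (x < y)%N = ~~ (y < x)%N by rewrite -leqNgt ltn_neqAle xy.
case: (y < x)%N; rewrite /= ?expr1 ?expr0; ring.
Qed.

Lemma bd_bd v : forall B, bd (bd v) B = 0.
Proof.
move=> B; rewrite /bd.
pose T x y : R := if [&& x \notin B, y \notin B & x != y] then
  sign x B * sign y (x |: B) * ('X_x * 'X_y * v (y |: (x |: B))) else 0.
have Tanti x y : T x y = - T y x.
  rewrite /T; case: (boolP (x \notin B)) => xB; case: (boolP (y \notin B)) => yB;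
    rewrite ?andbF ?oppr0 //=.
  rewrite eq_sym; case: (boolP (y != x)) => yx; rewrite ?oppr0 //=.
  rewrite sign_anti // 1?eq_sym // setUCA; ring.
have Txx x : T x x = 0 by rewrite /T eqxx !andbF.
transitivity (\sum_x \sum_y T x y).
  rewrite big_mkcond; apply: eq_bigr => x _; case: ifP => xB; last first.
    by rewrite big1 // => y _; rewrite /T xB.
  rewrite big_distrr /= big_mkcond; apply: eq_bigr => y _.
  rewrite !inE negb_or /T xB eq_sym /= andbC; case: ifP => // _; ring.
have split_lt : \sum_x \sum_y T x y =
    \sum_(x : 'I_n) \sum_(y : 'I_n | (x < y)%N) T x y
    + \sum_(x : 'I_n) \sum_(y : 'I_n | (y < x)%N) T x y.
  rewrite -big_split; apply: eq_bigr => x _ /=.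
  rewrite (bigID (fun y : 'I_n => (x < y)%N)) /=; congr (_ + _).
  rewrite (bigID (fun y : 'I_n => y == x)) /= big1 ?add0r; last first.
    by move=> y /andP[_ /eqP ->]; rewrite Txx.
  by apply: eq_bigl => y; rewrite -leqNgt [in RHS]ltn_neqAle andbC.
rewrite split_lt [X in _ + X](exchange_big_dep predT) //= -big_split big1 //= => x _.
by rewrite -big_split big1 //= => y _; rewrite Tanti addNr.
Qed.

Lemma bdB v w B : bd (fun A => v A - w A) B = bd v B - bd w B.
Proof. by rewrite /bd -sumrB; apply: eq_bigr => x _; rewrite mulrBr. Qed.

Lemma eq_bd v w : v =1 w -> bd v =1 bd w.
Proof. by move=> e B; apply: eq_bigr => x _; rewrite e. Qed.

(* a homotopy from the identity to the projection pj x, which drops the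
   summands of A containing x and the monomials divisible by x *)
Definition ht x v : W :=
  fun B => if x \in B then sign x B * dvx x (v (B :\ x)) else 0.

Definition pj x v : W :=
  fun B => if x \in B then 0 else v B - 'X_x * dvx x (v B).

Lemma homotopy x v B : bd (ht x v) B + ht x (bd v) B = v B - pj x v B.
Proof.
rewrite /pj /ht; case: ifP => xB; last first.
  rewrite addr0 opprB [RHS]addrC subrK /bd (bigD1 x) ?xB //= big1 => [|y /andP[yB yx]].
    rewrite addr0 setU11 setU1K ?xB // -mulrA mulrCA signU ?xB // ltnn expr0 mul1r.
    by rewrite signK.
  by rewrite !inE xB eq_sym (negPf yx) mulr0.
rewrite subr0 {2}/bd dvx_sum.
pose C := B :\ x; have xC : x \notin C by rewrite !inE eqxx.
have BE : B = x |: C by rewrite setD1K.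
rewrite (bigD1 x) //= mulrDr.
have -> : sign x B * dvx x (sign x (B :\ x) * 'X_x * v (x |: B :\ x)) = v B.
  by rewrite -/C -BE -mulrA dvxS dvxXx BE signU // ltnn expr0 mul1r signK.
rewrite addrCA -[RHS]addr0; congr (_ + _).
rewrite big_distrr /= /bd.
have PE y : (y \notin C) && (y != x) = (y \notin B).
  by rewrite BE !inE negb_or andbC.
rewrite (eq_bigl _ _ PE) -big_split big1 //= => y yB.
have yx : y != x by apply: contraNneq yB => ->.
have yC : y \notin C by move: yB; rewrite -PE => /andP[].
have -> : x \in y |: B by rewrite !inE xB orbT.
have -> : (y |: B) :\ x = y |: C.
  by rewrite setDUl -/C; congr (_ :|: _); apply/setDidPl; rewrite disjoints1 inE.
rewrite -/C -[_ * _ * v _]mulrA dvxS dvxXy //.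
rewrite !mulrA [_ * 'X_y * sign _ _]mulrAC.
have -> : sign y B * sign x (y |: B)
        = - (sign x B * sign y C).
  have xyC : x \notin y |: C by rewrite in_setU1 negb_or eq_sym yx.
  rewrite BE setUCA (signU x xyC) (signU x xC) (signU x yC) (signU y xC).
  have -> : (x < y)%N = ~~ (y < x)%N by rewrite -leqNgt ltn_neqAle andb_idl // => _; rewrite eq_sym.
  rewrite ltnn; case: (y < x)%N; rewrite /= ?expr1 ?expr0; ring.
by rewrite !mulNr addNr.
Qed.

Definition pj_seq (s : seq 'I_n) v : W := foldr pj v s.

Lemma pj0 x v B : v B = 0 -> pj x v B = 0.
Proof. by rewrite /pj => ->; case: ifP => // _; rewrite dvx0 mulr0 subrr. Qed.

Lemma pj_seq0 s x v B : x \in s -> x \in B -> pj_seq s v B = 0.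
Proof.
elim: s => // y s IH; rewrite inE => /orP[/eqP <-|xs] xB /=; last exact/pj0/IH.
by rewrite /pj xB.
Qed.

Lemma coefXM0 x p m : m x = 0%N -> ('X_x * p)@_m = 0.
Proof.
move=> m0; rewrite (mpolyE p) big_distrr /= raddf_sum big1 //= => m' _.
rewrite -scalerAr mcoeffZ -mpolyXD mcoeffX; case: eqP => [em|]; rewrite ?mulr0 //.
by move: m0; rewrite -em mnmDE mnm1E eqxx.
Qed.

Lemma pj_coeff x v m : (pj x v set0)@_m = if m x == 0%N then (v set0)@_m else 0.
Proof.
rewrite /pj inE mcoeffB; case: ifP => [/eqP m0|/negbT m0].
  by rewrite coefXM0 ?subr0.
by rewrite -(@submK _ U_(x) m) ?lep1mP // mulrC [in X in _ - X]addmC mcoeffMX dvxE subrr.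
Qed.

Lemma pj_seq_coeff s v x m : x \in s -> m x != 0%N -> (pj_seq s v set0)@_m = 0.
Proof.
move=> xs mx; elim: s xs => // y s IH; rewrite inE pj_coeff.
by case: ifP => // my /orP[/eqP ex|/IH //]; rewrite -ex (negPf mx) in my.
Qed.

Lemma pj_seq_coeff0 s v : (pj_seq s v set0)@_0%MM = (v set0)@_0%MM.
Proof. by elim: s => //= x s <-; rewrite pj_coeff mnm0E. Qed.

Definition supported i v := forall B, #|B| != i -> v B = 0.

Lemma supp_ht x i v : supported i v -> supported i.+1 (ht x v).
Proof.
move=> sv B cB; rewrite /ht; case: ifP => // xB; rewrite sv ?dvx0 ?mulr0 //.
by move: cB; rewrite (cardsD1 x) xB add1n eqSS.
Qed.

Lemma supp_pj x i v : supported i v -> supported i (pj x v).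
Proof. by move=> sv B /sv; apply: pj0. Qed.

Lemma retract i z s : supported i z ->  (forall B, bd z B = 0) ->
  exists2 w, supported i.+1 w & forall B, z B = pj_seq s z B + bd w B.
Proof.
move=> sz cz.
have [w sw [ew _ _]] : exists2 w, supported i.+1 w &
    [/\ forall B, z B = pj_seq s z B + bd w B,
        supported i (pj_seq s z) & forall B, bd (pj_seq s z) B = 0].
  elim: s => [|x s [w sw [ew sp cp]]] /=.
    exists (fun _ => 0) => //; split=> // B.
    by rewrite /bd big1 ?addr0 // => x _; rewrite mulr0.
  have h0 B : ht x (bd (pj_seq s z)) B = 0.
    by rewrite /ht cp dvx0 mulr0 if_same.
  have hh B : bd (ht x (pj_seq s z)) B = pj_seq s z B - pj x (pj_seq s z) B.
    by rewrite -homotopy h0 addr0.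
  exists (fun B => w B - - ht x (pj_seq s z) B).
    by move=> B cB; rewrite sw // (@supp_ht x _ _ sp) // oppr0 subrr.
  split=> [B||B]; last 1 first.
  - have /= := bdB (pj_seq s z) (bd (ht x (pj_seq s z))) B.
    rewrite bd_bd cp subrr => <-.
    by apply: eq_bd => A; rewrite hh opprB addrC subrK.
  - rewrite ew bdB.
    have -> : bd (fun A => - ht x (pj_seq s z) A) B = - bd (ht x (pj_seq s z)) B.
      by rewrite /bd -sumrN; apply: eq_bigr => y _; rewrite mulrN.
    by rewrite opprK hh; ring.
  exact: supp_pj.
by exists w.
Qed.

Definition ext i (v : {ffun basis i -> R}) : W := fun B => oapp v 0 (insub B).

Definition res i w : {ffun basis i -> R} := [ffun A => w (val A)].

Lemma ext_val i (v : {ffun basis i -> R}) (A : basis i) :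
  ext v (val A) = v A.
Proof. by rewrite /ext valK. Qed.

Lemma supp_ext i (v : {ffun basis i -> R}) : supported i (ext v).
Proof. by move=> B cB; rewrite /ext insubF //; apply: negPf. Qed.

Lemma ext_res i w : supported i w -> ext (res i w) =1 w.
Proof.
move=> sw B; rewrite /ext; case: insubP => [A _ <-|] /=; first by rewrite ffunE.
by move=> cB; rewrite sw.
Qed.

Lemma free_mapE i (v : {ffun basis i.+1 -> R}) (B : basis i) :
  free_map (@diff i) v B = bd (ext v) (val B).
Proof.
rewrite ffunE.
under eq_bigr => A _ do rewrite /diff big_distrr /=.
rewrite (exchange_big_dep predT) //= /bd [RHS]big_mkcond; apply: eq_bigr => x _ /=.
case: ifP => xB; last first.
  rewrite big_pred0 // => A; apply/negbTE; apply: contraFN xB => /andP[_ /eqP ->].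
  by rewrite !inE eqxx.
have cxB : #|x |: val B| == i.+1 by rewrite cardsU1 xB (eqP (valP B)).
pose A0 : basis i.+1 := Sub (x |: val B) cxB.
rewrite (big_pred1 A0) => [|A] /=.
  have -> : ext v (x |: val B) = v A0 by rewrite -(ext_val v A0).
  by rewrite signU // ltnn mul1r mulrC.
apply/andP/eqP => [[xA /eqP eB]|->] /=; last by rewrite setU11 setU1K.
by apply: val_inj; rewrite /= eB setD1K.
Qed.

Lemma bd_ext i (v : {ffun basis i.+1 -> R}) B :
  #|B| != i -> bd (ext v) B = 0.
Proof.
move=> cB; rewrite /bd big1 // => x xB; rewrite supp_ext ?mulr0 //.
by rewrite cardsU1 xB add1n eqSS.
Qed.

Lemma free_map_bd i (v : {ffun basis i.+2 -> R}) :
  free_map (@diff i) (free_map (@diff i.+1) v) = 0.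
Proof.
apply/ffunP => B; rewrite free_mapE ffunE -[RHS](bd_bd (ext v) (val B)).
apply: eq_bd => A; rewrite /ext; case: insubP => [A' _ <-|cA] /=.
  by rewrite free_mapE.
by rewrite bd_ext.
Qed.

Lemma diff_homog i (A : basis i.+1) (B : basis i) :
  homogeneous_of_degree (i.+1%:Z - i%:Z) (diff A B).
Proof.
have : diff A B \is 1.-homog for mdeg.
  rewrite /diff; apply: rpred_sum => x _.
  rewrite /sign -signr_odd; case: (odd _); rewrite ?expr1 ?mulN1r ?mul1r;
    by rewrite ?rpredN dhomogX; apply/eqP; exact: mdeg1.
by move=> /dhomogP h m /h ->; rewrite [i.+1%:Z]intS addrK.
Qed.

Lemma aug_surj : exists A : basis 0, aug A != 0.
Proof.
have c0 : #|set0 : {set 'I_n}| == 0%N by rewrite cards0.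
by exists (Sub set0 c0); rewrite oner_neq0.
Qed.

Lemma val0 (A : basis 0) : val A = set0.
Proof. exact/eqP/(etrans (esym (cards_eq0 _)) (valP A)). Qed.

Lemma exact0 (v : {ffun basis 0 -> R}) :
  \sum_A (v A)@_0%MM * aug A = 0 <->
  exists u, v = free_map (@diff 0) u.
Proof.
have -> : \sum_A (v A)@_0%MM * aug A = (ext v set0)@_0%MM.
  have c0 : #|set0 : {set 'I_n}| == 0%N by rewrite cards0.
  rewrite (big_pred1 (Sub set0 c0 : basis 0)) => [|A]; last first.
    by apply/esym/eqP/val_inj; rewrite /= val0.
  by rewrite mulr1 -ext_val SubK.
split=> [v0|[w ->]]; last first.
  have -> : ext (free_map (@diff 0) w) set0 = bd (ext w) set0.
    have c0 : #|set0 : {set 'I_n}| == 0%N by rewrite cards0.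
    have := free_mapE w (Sub set0 c0 : basis 0).
    by rewrite -ext_val SubK.
  rewrite /bd raddf_sum big1 //= => x _; rewrite mulrAC mulrC.
  by rewrite coefXM0 // mnm0E.
have bd0 B : bd (ext v) B = 0.
  by rewrite /bd big1 // => x xB; rewrite supp_ext ?mulr0 // cardsU1 xB.
have [w sw ew] := retract (enum 'I_n) (@supp_ext 0 v) bd0.
exists (res 1 w); apply/ffunP => A; rewrite free_mapE (eq_bd (ext_res sw)).
rewrite -ext_val ew val0; rewrite [X in X + _](_ : _ = 0) ?add0r //.
apply/mpolyP => m; rewrite mcoeff0; case: (eqVneq m 0%MM) => [->|m0].
  by rewrite pj_seq_coeff0.
have [x mx] : exists x, m x != 0%N.
  apply/existsP; apply: contra_neqT m0 => /existsPn h.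
  by apply/mnmP => x; rewrite mnm0E; apply/eqP; rewrite -[_ == _]negbK h.
by rewrite (@pj_seq_coeff _ _ x) // mem_enum.
Qed.

Lemma exact_succ i (v : {ffun basis i.+1 -> R}) :
  free_map (@diff i) v = 0 <->
  exists u, v = free_map (@diff i.+1) u.
Proof.
split=> [v0|[w ->]]; last exact: free_map_bd.
have bd0 B : bd (ext v) B = 0.
  have [cB|] := boolP (#|B| == i); last exact: bd_ext.
  by have := free_mapE v (Sub B cB); rewrite v0 ffunE /= => <-.
have [w sw ew] := retract (enum 'I_n) (@supp_ext _ v) bd0.
exists (res _ w); apply/ffunP => A; rewrite free_mapE (eq_bd (ext_res sw)).
rewrite -ext_val ew; rewrite [X in X + _](_ : _ = 0) ?add0r //.
have /card_gt0P[x xA] : (0 < #|val A|)%N by rewrite (eqP (valP A)).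
by rewrite (@pj_seq0 _ x) // mem_enum.
Qed.

Definition resolution : residue_resolution k n :=
  @ResidueResolution k n basis (fun i _ => i%:Z) diff aug
    diff_homog (fun _ _ => erefl) aug_surj exact0 exact_succ.

End Koszul.
End Koszul.

Definition koszul_resolution (k : fieldType) (n : nat) : residue_resolution k n :=
  Koszul.resolution k n.

(* Main.v *)
(* The Cox ring k[s, t, u, v] of S(1, 3) receives the coordinate ring of P^5 by
   phi : x0, x1, y0, .., y3 |-> s u, t u, s^3 v, s^2 t v, s t^2 v, t^3 v, with
   kernel the ideal of S.  If X ~ aH + bF, then I(X) is the preimage of f k[s, t, u, v]
   for one form f of class aH + bF, so that I(X) / I(S) is E_b(-a), where E_b is
   spanned by the monomials s^p t^q u^i v^j with p + q = i + 3 j - b, and for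
   reasons of degree the Betti tables of I(S) and E_b(-a) add up.

   Multiplication by v gives 0 -> E_(b-3)(-1) -> E_b -> k[x0, x1] u^b -> 0, whose
   Betti tables again add up; the quotient is responsible for the rows (1, 4, 6, 4, 1),
   and b drops to -1, 0 or 1.  The module E_1 has a linear resolution, found by
   killing monomial nonzerodivisors and filtering by monomials.  Multiplication
   by s gives 0 -> E_1 -> E_0 -> k[x1, y3] -> 0 and 0 -> E_0 -> E_(-1) -> k[x1, y3] t -> 0,
   from which the tables of E_0 = R / I(S) and E_(-1) follow once the linear strands
   of E_0 and E_(-1) are known to have length 0 and 1.

   All Tor groups are computed by the Koszul complex of the coordinates, on which
   a coordinate acts as zero up to homotopy: for a nonzerodivisor x on M, this
   splits the long exact sequence of 0 -> M(-1) -> M -> M / x M -> 0 into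
   0 -> Tor_i(M) -> Tor_i(M / x M) -> Tor_(i-1)(M)(-1) -> 0. *)

Require Import Defs.
From HB Require Import structures.
From Stdlib Require Import FunctionalExtensionality IndefiniteDescription.
From mathcomp Require Import all_boot all_order all_algebra.
From mathcomp Require Import ring zify.
From mathcomp.multinomials Require Import mpoly.

Set Implicit Arguments.
Unset Strict Implicit.
Unset Printing Implicit Defensive.

Import Order.TTheory GRing.Theory Num.Theory.
Local Open Scope ring_scope.

(** * Dimensions of subquotients *)

Section QuotientDim.
Variable k : fieldType.

(** [betti_number] quantifies over all graded free resolutions of k, so a comparison theorem has to
    precede any use of the Koszul complex. Quotient modules are never formed as types: E_b and its
    quotients are spans of sets of monomials of the Cox ring with truncated multiplication. Their
    exact sequences carry splittings over k, which makes the connecting maps explicit linear maps.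

    A connecting map raises the row by one; tables add up when it starts or ends in an empty place.
    Hence the conditions on (a, b): I(S) sits in row 2, so row 1 of E_b(-a) must be empty. Each
    division by v lowers b by 3 and shifts rows by one, so the rows (1, 4, 6, 4, 1) of E_b occur at
    b, b - 2, b - 4, and so on.

    The two sequences for multiplication by s do not add up. The vanishing linear strand of E_0
    makes connecting maps injective, so row 1 of E_0 is 4 C(3, i) - C(4, i + 1), that is 0, 6, 8, 3.
    Subtracting C(4, i + 1) once more leaves 4 and 2 in columns 2 and 3 of E_(-1). *)

Definition subspace (V : lmodType k) (S : V -> Prop) : Prop :=
  S 0 /\ forall a u v, S u -> S v -> S (a *: u + v).

Section Subspace.
Variables (V : lmodType k) (S : V -> Prop).
Hypothesis sS : subspace S.

Lemma subspace0 : S 0. Proof. by case: sS. Qed.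

Lemma subspaceD u v : S u -> S v -> S (u + v).
Proof. by move=> Su Sv; rewrite -[u]scale1r; apply: (proj2 sS). Qed.

Lemma subspaceZ a u : S u -> S (a *: u).
Proof. by move=> Su; rewrite -[_ *: _]addr0; apply: (proj2 sS) => //; exact: subspace0. Qed.

Lemma subspaceN u : S u -> S (- u).
Proof. by move=> Su; rewrite -scaleN1r; exact: subspaceZ. Qed.

Lemma subspaceB u v : S u -> S v -> S (u - v).
Proof. by move=> Su Sv; apply: subspaceD => //; exact: subspaceN. Qed.

Lemma subspace_sum (J : finType) (F : J -> V) : (forall j, S (F j)) -> S (\sum_j F j).
Proof.
by move=> SF; elim/big_rec: _ => [|j v _ Sv]; [exact: subspace0|exact: subspaceD].
Qed.

Lemma subspace_cong u v : S (u - v) -> S v -> S u.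
Proof. by move=> Suv Sv; rewrite -(subrK v u); exact: subspaceD. Qed.

Lemma subspace_congC u v : S (u - v) -> S (v - u).
Proof. by move=> /subspaceN; rewrite opprB. Qed.

Lemma subspace_trans v u w : S (u - v) -> S (v - w) -> S (u - w).
Proof. by move=> uv vw; rewrite -(subrK v u) -addrA; exact: subspaceD. Qed.

Lemma subspace_cong_sum (J : finType) (c : J -> k) (F G : J -> V) :
  (forall j, S (F j - G j)) -> S (\sum_j c j *: F j - \sum_j c j *: G j).
Proof.
by move=> FG; rewrite -sumrB; apply: subspace_sum => j; rewrite -scalerBr; exact: subspaceZ.
Qed.

End Subspace.

Lemma quotient_dim0 (V : lmodType k) (Z B : V -> Prop) :
  (forall z, Z z -> B z) -> quotient_dim Z B 0.
Proof.
move=> ZB; exists (fun=> 0); split=> [[]//|z /ZB Bz|c _ []//].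
by exists (fun=> 0); rewrite big_ord0 subr0.
Qed.

Lemma quotient_dim0P (V : lmodType k) (Z B : V -> Prop) z :
  quotient_dim Z B 0 -> Z z -> B z.
Proof. by case=> u [_ sp _] /sp [c]; rewrite big_ord0 subr0. Qed.

Section ShortExact.
Variables (V1 V2 V3 : lmodType k) (Z1 B1 : V1 -> Prop) (Z2 B2 : V2 -> Prop).
Variables (Z3 B3 : V3 -> Prop) (F : {linear V1 -> V2}) (G : {linear V2 -> V3}).

(* The sequence 0 -> Z1 / B1 -> Z2 / B2 -> Z3 / B3 -> 0 induced by F and G is
   well defined and exact. *)
Record short_exact : Prop := ShortExact {
  se_Z1 : subspace Z1;
  se_Z2 : subspace Z2;
  se_B2 : subspace B2;
  se_B3 : subspace B3;
  se_FZ : forall z, Z1 z -> Z2 (F z);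
  se_FB : forall z, B1 z -> B2 (F z);
  se_GZ : forall z, Z2 z -> Z3 (G z);
  se_GB : forall z, B2 z -> B3 (G z);
  se_inj : forall z, Z1 z -> B2 (F z) -> B1 z;
  se_comp : forall z, Z1 z -> B3 (G (F z));
  se_exact : forall z, Z2 z -> B3 (G z) -> exists2 y, Z1 y & B2 (z - F y);
  se_surj : forall z, Z3 z -> exists2 y, Z2 y & B3 (z - G y)
}.

Hypothesis se : short_exact.
Let sZ1 := se_Z1 se.
Let sZ2 := se_Z2 se.
Let sB2 := se_B2 se.
Let sB3 := se_B3 se.
Let FZ := se_FZ se.
Let FB := se_FB se.
Let GZ := se_GZ se.
Let GB := se_GB se.
Let F_inj := se_inj se.
Let GF0 := se_comp se.
Let FG_exact := se_exact se.
Let G_surj := se_surj se.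

Let lin_sum (V W : lmodType k) (H : {linear V -> W}) n (c : 'I_n -> k) (u : 'I_n -> V) :
  H (\sum_l c l *: u l) = \sum_l c l *: H (u l).
Proof. by rewrite linear_sum; apply: eq_bigr => l _; rewrite linearZ. Qed.

Let sum_mul (V : lmodType k) m n (c : 'rV[k]_m) (N : 'M[k]_(m, n)) (u : 'I_n -> V) :
  \sum_l (c *m N) 0 l *: u l = \sum_a c 0 a *: (\sum_l N a l *: u l).
Proof.
under eq_bigr => l _ do rewrite mxE scaler_suml.
rewrite exchange_big /=; apply: eq_bigr => a _; rewrite scaler_sumr.
by apply: eq_bigr => l _; rewrite scalerA.
Qed.

Let sum_row (V : lmodType k) n (c : 'I_n -> k) (u : 'I_n -> V) :
  \sum_l c l *: u l = \sum_l (\row_l c l) 0 l *: u l.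
Proof. by apply: eq_bigr => l _; rewrite mxE. Qed.

Let free_row (V : lmodType k) (B : V -> Prop) n (u : 'I_n -> V) :
  (forall c : 'I_n -> k, B (\sum_l c l *: u l) -> forall l, c l = 0) ->
  forall c d : 'rV[k]_n,
    B (\sum_l c 0 l *: u l - \sum_l d 0 l *: u l) -> c = d.
Proof.
move=> fr c d Bcd; apply/rowP => l; apply/eqP; rewrite -subr_eq0; apply/eqP.
apply: (fr (fun l => c 0 l - d 0 l)); rewrite -sumrB in Bcd.
by under eq_bigr => i _ do rewrite scalerBl.
Qed.

Let sum_delta (V : lmodType k) n (u : 'I_n -> V) b :
  \sum_l (delta_mx 0 b : 'rV[k]_n) 0 l *: u l = u b.
Proof.
rewrite (bigD1 b) //= mxE !eqxx scale1r big1 ?addr0 // => l /negPf lb.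
by rewrite mxE lb scale0r.
Qed.

Let sum_zero (V : lmodType k) n (u : 'I_n -> V) :
  \sum_l (0 : 'rV[k]_n) 0 l *: u l = 0.
Proof. by rewrite big1 // => l _; rewrite mxE scale0r. Qed.

Lemma short_exact_dim_mid m1 m3 :
  quotient_dim Z1 B1 m1 -> quotient_dim Z3 B3 m3 -> quotient_dim Z2 B2 (m1 + m3).
Proof.
case=> u1 [Zu1 sp1 fr1] [u3 [Zu3 sp3 fr3]].
have /fin_all_exists [y yP] : forall l, exists y, Z2 y /\ B3 (u3 l - G y).
  by move=> l; have [y] := G_surj (Zu3 l); exists y.
pose u l := match split l with inl a => F (u1 a) | inr b => y b end.
have uE (c : 'I_(m1 + m3) -> k) : \sum_l c l *: u l =
    F (\sum_l c (lshift _ l) *: u1 l) + \sum_l c (rshift _ l) *: y l.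
  rewrite big_split_ord /= lin_sum; congr (_ + _); apply: eq_bigr => l _.
    by rewrite /u (unsplitK (inl l)).
  by rewrite /u (unsplitK (inr l)).
exists u; split=> [l|z Zz|c].
- by rewrite /u; case: split => a; [exact/FZ|case: (yP a)].
- have [c3 Bc3] := sp3 _ (GZ Zz).
  have /FG_exact [|z1 Zz1 Bz1] : Z2 (z - \sum_l c3 l *: y l).
    by apply: subspaceB => //; apply: subspace_sum => // l; apply: subspaceZ => //; case: (yP l).
  rewrite linearB lin_sum; apply: (subspace_trans sB3 Bc3).
    by apply: subspace_cong_sum => // l; case: (yP l).
  have [c1 Bc1] := sp1 _ Zz1.
  exists (fun l => match split l with inl a => c1 a | inr b => c3 b end).
  rewrite uE opprD addrA addrAC.
  rewrite (eq_bigr (fun l => c3 l *: y l)) => [|l _]; last by rewrite (unsplitK (inr l)).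
  apply: (subspace_trans sB2 Bz1); rewrite -linearB; apply: FB.
  by rewrite (eq_bigr (fun l => c1 l *: u1 l)) // => l _; rewrite (unsplitK (inl l)).
rewrite uE => Bc.
have c3 : forall l, c (rshift m1 l) = 0.
  apply: (fr3 (fun l => c (rshift m1 l))).
  have := GB Bc; rewrite linearD (lin_sum G) => BG.
  have : B3 (\sum_l c (rshift m1 l) *: G (y l)).
    have Z1s : Z1 (\sum_l c (lshift m3 l) *: u1 l).
      by apply: subspace_sum => // l; exact: subspaceZ.
    by have := subspaceB sB3 BG (GF0 Z1s); rewrite addrC addKr.
  apply: subspace_cong => //; apply: subspace_cong_sum => // l; by case: (yP l).
have c1 : forall l, c (lshift m3 l) = 0.
  apply: (fr1 (fun l => c (lshift m3 l))); apply: F_inj.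
    by apply: subspace_sum => // l; exact: subspaceZ.
  by move: Bc; rewrite [X in _ + X]big1 ?addr0 // => l _; rewrite c3 scale0r.
by move=> l; rewrite -(splitK l); case: (split l) => a /=; rewrite ?c1 ?c3.
Qed.

(** In the chosen bases G becomes a matrix N, of rank m3 because G is onto. A row basis of its
    kernel, lifted through F by exactness, gives the basis of the first quotient. *)
Lemma short_exact_dim_left m2 m3 :
  quotient_dim Z2 B2 m2 -> quotient_dim Z3 B3 m3 ->
  exists2 m1, quotient_dim Z1 B1 m1 & (m1 + m3 = m2)%N.
Proof.
case=> u2 [Zu2 sp2 fr2] [u3 [Zu3 sp3 fr3]].
have /fin_all_exists [n nP] : forall a, exists n : 'I_m3 -> k,
  B3 (G (u2 a) - \sum_l n l *: u3 l) by move=> a; apply: sp3; exact: GZ.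
pose N := \matrix_(a, l) n a l.
have NP (c : 'rV_m2) : B3 (G (\sum_a c 0 a *: u2 a) - \sum_l (c *m N) 0 l *: u3 l).
  rewrite lin_sum sum_mul; apply: subspace_cong_sum => // a.
  by rewrite (eq_bigr (fun l => n a l *: u3 l)) // => l _; rewrite mxE.
have rN : \rank N = m3.
  apply/eqP; rewrite -/(row_full N) -sub1mx; apply/row_subP => b; rewrite row1.
  have [y Zy By] := G_surj (Zu3 b); have [c Bc] := sp2 _ Zy.
  suff <- : (\row_l c l) *m N = delta_mx 0 b by exact: submxMl.
  rewrite sum_row in Bc; apply: (free_row fr3); rewrite sum_delta.
  apply: (subspace_trans sB3 (subspace_congC sB3 (NP _))).
  apply: (subspace_trans sB3 (v := G y)); last exact: subspace_congC.
  by rewrite -linearB; apply: GB; exact: subspace_congC.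
set K := row_base (kermx N).
have /fin_all_exists [y yP] : forall a, exists y, Z1 y /\
    B2 (\sum_l K a l *: u2 l - F y).
  move=> a; have [||y ? ?] := FG_exact (z := \sum_l K a l *: u2 l); last by exists y.
    by apply: subspace_sum => // l; exact: subspaceZ.
  have := NP (row a K).
  have /sub_kermxP -> : (row a K <= kermx N)%MS by rewrite (submx_trans (row_sub _ _)) ?eq_row_base.
  rewrite sum_zero subr0 (eq_bigr (fun l => K a l *: u2 l)) // => l _.
  by rewrite mxE.
have yK (d : 'rV_(\rank (kermx N))) :
    B2 (\sum_l (d *m K) 0 l *: u2 l - F (\sum_a d 0 a *: y a)).
  by rewrite lin_sum sum_mul; apply: subspace_cong_sum => // a; case: (yP a).
exists (\rank (kermx N)); last by rewrite mxrank_ker rN subnK // -rN rank_leq_row.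
exists y; split=> [a|z Zz|c Bc]; first by case: (yP a).
  have [c Bc] := sp2 _ (FZ Zz); rewrite sum_row in Bc.
  have : (\row_l c l <= kermx N)%MS.
    apply/sub_kermxP/(free_row fr3); rewrite sum_zero subr0.
    apply: (subspace_cong sB3 (subspace_congC sB3 (NP (\row_l c l)))).
    apply: (subspace_cong sB3 (v := G (F z))); last exact: GF0.
    by rewrite -linearB; apply: GB; exact: subspace_congC.
  rewrite -(eq_row_base (kermx N)) => /submxP[d dE].
  exists (d 0); apply: F_inj.
    by apply: subspaceB => //; apply: subspace_sum => // l; apply: subspaceZ => //; case: (yP l).
  rewrite linearB; apply: (subspace_trans sB2 Bc); rewrite dE; exact: yK.
have : B2 (\sum_l ((\row_l c l) *m K) 0 l *: u2 l).
  apply: (subspace_cong sB2 (yK _)); apply: FB; by rewrite -sum_row.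
move/fr2 => cK l; have /row_freeP [K' KK'] : row_free K by exact: row_base_free.
have : (\row_l c l) *m K *m K' = 0.
  by rewrite (_ : _ *m K = 0) ?mul0mx //; apply/rowP => a; rewrite cK mxE.
by rewrite -mulmxA KK' mulmx1 => /rowP /(_ l); rewrite !mxE.
Qed.

(** In the chosen bases F becomes a matrix N with independent rows. A basis of a complement of its
    row space maps under G to a basis of the third quotient. *)
Lemma short_exact_dim_right m1 m2 :
  quotient_dim Z1 B1 m1 -> quotient_dim Z2 B2 m2 ->
  exists2 m3, quotient_dim Z3 B3 m3 & (m1 + m3 = m2)%N.
Proof.
case=> u1 [Zu1 sp1 fr1] [u2 [Zu2 sp2 fr2]].
have /fin_all_exists [n nP] : forall a, exists n : 'I_m2 -> k,
  B2 (F (u1 a) - \sum_l n l *: u2 l) by move=> a; apply: sp2; exact: FZ.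
pose N := \matrix_(a, l) n a l.
have NP (c : 'rV_m1) : B2 (F (\sum_a c 0 a *: u1 a) - \sum_l (c *m N) 0 l *: u2 l).
  rewrite lin_sum sum_mul; apply: subspace_cong_sum => // a.
  by rewrite (eq_bigr (fun l => n a l *: u2 l)) // => l _; rewrite mxE.
have Zs1 (c : 'I_m1 -> k) : Z1 (\sum_a c a *: u1 a).
  by apply: subspace_sum => // l; exact: subspaceZ.
have Zs2 (c : 'I_m2 -> k) : Z2 (\sum_a c a *: u2 a).
  by apply: subspace_sum => // l; exact: subspaceZ.
have rN : row_free N.
  apply: inj_row_free => c cN; apply: (free_row fr1); rewrite sum_zero subr0.
  apply: F_inj => //; apply: (subspace_cong sB2 (NP c)).
  by rewrite cN sum_zero; exact: subspace0.
set K := row_base (N^C)%MS.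
exists (\rank (N^C)%MS); last first.
  by rewrite mxrank_compl (eqP rN) subnKC // -(eqP rN) rank_leq_col.
exists (fun a => G (\sum_l K a l *: u2 l)); split=> [a|z Zz|c Bc]; first exact/GZ/Zs2.
  have [y Zy By] := G_surj Zz; have [c Bc] := sp2 _ Zy; rewrite sum_row in Bc.
  have : (\row_l c l <= N + N^C)%MS by rewrite submx_full // addsmx_compl_full.
  move=> /sub_addsmxP[[c1 d'] /= dE].
  have : (d' *m N^C <= K)%MS by rewrite eq_row_base submxMl.
  move=> /submxP[d dE']; rewrite dE' in dE.
  exists (d 0); rewrite -lin_sum -sum_mul; apply: (subspace_trans sB3 By).
  rewrite -linearB; rewrite dE in Bc.
  apply: (subspace_cong sB3 (v := G (F (\sum_a c1 0 a *: u1 a)))); last exact: GF0.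
  rewrite -linearB; apply: GB.
  have dcE : \sum_l (c1 *m N + d *m K) 0 l *: u2 l =
      \sum_l (c1 *m N) 0 l *: u2 l + \sum_l (d *m K) 0 l *: u2 l.
    by rewrite -big_split; apply: eq_bigr => l _; rewrite mxE scalerDl.
  rewrite dcE opprD addrA addrAC in Bc; apply: (subspace_trans sB2 Bc).
  by apply: subspace_congC (NP _).
rewrite -lin_sum sum_row -sum_mul in Bc; set d := \row_l c l in Bc.
have [z1 Zz1 Bz1] := FG_exact (Zs2 _) Bc; have [c1 Bc1] := sp1 _ Zz1.
rewrite sum_row in Bc1; set e := \row_l c1 l in Bc1.
have dKE : d *m K = e *m N.
  apply: (free_row fr2); apply: (subspace_trans sB2 Bz1).
  apply: (subspace_trans sB2 (v := F (\sum_l e 0 l *: u1 l))); last exact: NP.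
  by rewrite -linearB; exact: FB.
have : (d *m K <= N :&: N^C)%MS.
  by rewrite sub_capmx {1}dKE submxMl (submx_trans (submxMl _ _)) ?eq_row_base.
rewrite capmx_compl submx0 => /eqP dK0 l.
have /row_freeP [K' KK'] : row_free K by exact: row_base_free.
have : d *m K *m K' = 0 by rewrite dK0 mul0mx.
by rewrite -mulmxA KK' mulmx1 => /rowP /(_ l); rewrite !mxE.
Qed.

End ShortExact.

Lemma quotient_dim_iso (V1 V2 : lmodType k) (Z1 B1 : V1 -> Prop)
    (Z2 B2 : V2 -> Prop) (F : {linear V1 -> V2}) m :
  subspace Z1 -> subspace Z2 -> subspace B2 ->
  (forall z, Z1 z -> Z2 (F z)) -> (forall z, B1 z -> B2 (F z)) ->
  (forall z, Z1 z -> B2 (F z) -> B1 z) ->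
  (forall z, Z2 z -> exists2 y, Z1 y & B2 (z - F y)) ->
  quotient_dim Z1 B1 m -> quotient_dim Z2 B2 m.
Proof.
move=> sZ1 sZ2 sB2 FZ FB Finj Fsurj h; rewrite -[m]addn0.
(* An isomorphism is a short exact sequence with third term zero, here the whole space modulo
   itself. *)
have T0 : quotient_dim (fun _ : V2 => True) (fun _ => True) 0 by exact: quotient_dim0.
apply: (short_exact_dim_mid (F := F) (G := idfun) _ h T0).
split=> // [z Zz _|z _]; first exact: Fsurj.
by exists 0 => //; exact: subspace0.
Qed.
End QuotientDim.

(** * Koszul homology of graded modules *)

Section KoszulHomology.
Variables (k : fieldType) (n : nat).
Implicit Types (x y : 'I_n) (A B : {set 'I_n}).

(* The graded piece of degree r of the module is the subspace [gdeg r] of the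
   ambient space, on which alone the operators are required to commute. *)
Record gmod := Gmod {
  gspace :> lmodType k;
  gact : 'I_n -> {linear gspace -> gspace};
  gdeg : int -> gspace -> Prop;
  gdeg_subspace : forall r, subspace (gdeg r);
  gact_deg : forall x r u, gdeg r u -> gdeg (r + 1) (gact x u);
  gactC : forall x y r u, gdeg r u -> gact x (gact y u) = gact y (gact x u)
}.

Definition ksign x B : k := (-1) ^+ #|[set y in B | (y < x)%N]|.

Lemma ksignK x B : ksign x B * ksign x B = 1.
Proof. by rewrite -expr2 sqrr_sign. Qed.

Lemma ksignU x y B : y \notin B ->
  ksign x (y |: B) = (-1) ^+ (y < x)%N * ksign x B.
Proof.
move=> yB; rewrite /ksign -exprD; congr (_ ^+ _).
case: (boolP (y < x)%N) => yx.
  have -> : [set z in y |: B | (z < x)%N] = y |: [set z in B | (z < x)%N].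
    by apply/setP => z; rewrite !inE; case: eqP => [->|].
  by rewrite cardsU1 !inE (negPf yB).
have -> // : [set z in y |: B | (z < x)%N] = [set z in B | (z < x)%N].
by apply/setP => z; rewrite !inE; case: eqP => [->|] //; rewrite (negPf yx) !andbF.
Qed.

Lemma ksign_anti x y B : x \notin B -> y \notin B -> x != y ->
  ksign x B * ksign y (x |: B) = - (ksign y B * ksign x (y |: B)).
Proof.
move=> xB yB xy; rewrite !ksignU //.
have -> : (x < y)%N = ~~ (y < x)%N by rewrite -leqNgt ltn_neqAle xy.
case: (y < x)%N; rewrite /= ?expr1 ?expr0; ring.
Qed.

Section Pointwise.
Variables (V W : lmodType k) (f : {linear V -> W}).

Definition pointwise (v : {ffun {set 'I_n} -> V}) : {ffun {set 'I_n} -> W} :=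
  [ffun B => f (v B)].

Lemma pointwise_is_linear : linear pointwise.
Proof. by move=> a u v; apply/ffunP => B; rewrite !ffunE linearP. Qed.

HB.instance Definition _ :=
  GRing.isLinear.Build k {ffun {set 'I_n} -> V} {ffun {set 'I_n} -> W} _
    pointwise pointwise_is_linear.

End Pointwise.

Section Homology.
Variable M : gmod.
Local Notation W := {ffun {set 'I_n} -> M}.
Implicit Types (v w : W) (i r : int).

Definition bd v : W :=
  [ffun B : {set 'I_n} => \sum_(x | x \notin B) ksign x B *: gact M x (v (x |: B))].

Lemma bd_is_linear : linear bd.
Proof.
move=> a u v; apply/ffunP => B; rewrite !ffunE scaler_sumr -big_split.
apply: eq_bigr => x _; rewrite !ffunE linearP scalerDr !scalerA.
by rewrite [a * _]mulrC.
Qed.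

HB.instance Definition _ := GRing.isLinear.Build k W W _ bd bd_is_linear.

(** The index r is the row of the Betti table: coefficients have degree r and the total degree is i
    + r, which [bd] preserves. The homological degree i is an integer so that the exact sequences
    may run into i = -1. *)
Definition chain i r v : Prop :=
  forall B, gdeg r (v B) /\ (#|B|%:Z != i -> v B = 0).

Definition cyc i r v : Prop := chain i r v /\ bd v = 0.

Definition bnd i r v : Prop := exists2 w, chain (i + 1) (r - 1) w & v = bd w.

Definition hdim i r m : Prop := quotient_dim (cyc i r) (bnd i r) m.

Lemma chain_subspace i r : subspace (chain i r).
Proof.
split=> [B|a u v Ku Kv B]; rewrite !ffunE; first by split=> //; exact: subspace0 (gdeg_subspace _ _).
have [Du u0] := Ku B; have [Dv v0] := Kv B; split.
  exact: (proj2 (gdeg_subspace _ _)).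
by move=> ci; rewrite u0 // v0 // scaler0 addr0.
Qed.

Lemma cyc_subspace i r : subspace (cyc i r).
Proof.
split; first by split; [exact: subspace0 (chain_subspace _ _)|exact: linear0].
move=> a u v [Ku u0] [Kv v0]; split; first exact: (proj2 (chain_subspace _ _)).
by rewrite linearP /= u0 v0 scaler0 addr0.
Qed.

Lemma bnd_subspace i r : subspace (bnd i r).
Proof.
split; first by exists 0; [exact: subspace0 (chain_subspace _ _)|rewrite linear0].
move=> a _ _ [u Ku ->] [v Kv ->]; exists (a *: u + v); last by rewrite linearP.
exact: (proj2 (chain_subspace _ _)).
Qed.

Lemma chain_bd i r v : chain i r v -> chain (i - 1) (r + 1) (bd v).
Proof.
move=> Kv B; rewrite ffunE; split.
  rewrite big_mkcond; apply: (subspace_sum (gdeg_subspace _ _)) => x.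
  case: ifP => _; last exact: subspace0 (gdeg_subspace _ _).
  by apply: (subspaceZ (gdeg_subspace _ _)); apply: gact_deg; case: (Kv (x |: B)).
move=> cB; rewrite big1 // => x xB; case: (Kv (x |: B)) => _ ->.
  by rewrite linear0 scaler0.
by rewrite cardsU1 xB; lia.
Qed.

Lemma bd_bd i r v : chain i r v -> bd (bd v) = 0.
Proof.
move=> Kv; apply/ffunP => B; rewrite !ffunE.
pose T x y : M := if [&& x \notin B, y \notin B & x != y] then
  (ksign x B * ksign y (x |: B)) *: gact M x (gact M y (v (y |: (x |: B)))) else 0.
have Tanti x y : T x y = - T y x.
  rewrite /T; case: (boolP (x \notin B)) => xB; case: (boolP (y \notin B)) => yB;
    rewrite ?andbF ?oppr0 //=.
  rewrite eq_sym; case: (boolP (y != x)) => yx; rewrite ?oppr0 //=.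
  rewrite ksign_anti // 1?eq_sym // setUCA scaleNr (@gactC M x y r _) //.
  by case: (Kv (x |: (y |: B))).
have Txx x : T x x = 0 by rewrite /T eqxx !andbF.
transitivity (\sum_x \sum_y T x y).
  rewrite big_mkcond; apply: eq_bigr => x _; case: ifP => xB; last first.
    by rewrite big1 // => y _; rewrite /T xB.
  rewrite ffunE linear_sum scaler_sumr big_mkcond; apply: eq_bigr => y _.
  rewrite !inE negb_or /T xB eq_sym /= andbC; case: ifP => // _.
  by rewrite linearZ /= scalerA.
have split_lt : \sum_x \sum_y T x y =
    \sum_(x : 'I_n) \sum_(y : 'I_n | (x < y)%N) T x y
    + \sum_(x : 'I_n) \sum_(y : 'I_n | (y < x)%N) T x y.
  rewrite -big_split; apply: eq_bigr => x _ /=.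
  rewrite (bigID (fun y : 'I_n => (x < y)%N)) /=; congr (_ + _).
  rewrite (bigID (fun y : 'I_n => y == x)) /= big1 ?add0r; last first.
    by move=> y /andP[_ /eqP ->]; rewrite Txx.
  by apply: eq_bigl => y; rewrite -leqNgt [in RHS]ltn_neqAle andbC.
rewrite split_lt [X in _ + X](exchange_big_dep predT) //= -big_split big1 //= => x _.
by rewrite -big_split big1 //= => y _; rewrite Tanti addNr.
Qed.

Definition contraction x v : W :=
  [ffun B : {set 'I_n} => if x \in B then ksign x B *: v (B :\ x) else 0].

Lemma chain_contraction x i r v : chain i r v -> chain (i + 1) r (contraction x v).
Proof.
move=> Kv B; rewrite ffunE; case: ifP => xB; last first.
  by split=> //; exact: subspace0 (gdeg_subspace _ _).
have [Dv v0] := Kv (B :\ x); split; first exact: (subspaceZ (gdeg_subspace _ _)).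
by rewrite (cardsD1 x B) xB add1n => cB; rewrite v0 ?scaler0 //; apply: contraNneq cB => <-; rewrite -addn1 PoszD.
Qed.

(* The exterior multiplication by e_x is a homotopy from the multiplication by
   x to zero. *)
Lemma contraction_homotopy x v :
  bd (contraction x v) + contraction x (bd v) = pointwise (gact M x) v.
Proof.
apply/ffunP => B; rewrite !ffunE; case: ifP => xB; last first.
  rewrite addr0 (bigD1 x) ?xB //= big1 => [|y /andP[yB yx]].
    rewrite addr0 !ffunE setU11 setU1K ?xB // linearZ /= scalerA.
    by rewrite ksignU ?xB // ltnn expr0 mul1r ksignK scale1r.
  by rewrite !ffunE !inE xB eq_sym (negPf yx) linear0 scaler0.
pose C := B :\ x; have xC : x \notin C by rewrite !inE eqxx.
have BE : B = x |: C by rewrite setD1K.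
rewrite [X in _ *: X](bigD1 x) //= scalerDr scalerA -/C -BE.
have -> : ksign x B = ksign x C by rewrite BE ksignU // ltnn expr0 mul1r.
rewrite ksignK scale1r addrCA -[RHS]addr0; congr (_ + _).
have PE y : (y \notin C) && (y != x) = (y \notin B).
  by rewrite BE !inE negb_or andbC.
rewrite (eq_bigl _ _ PE) scaler_sumr -big_split big1 //= => y yB.
have yx : y != x by apply: contraNneq yB => ->.
have yC : y \notin C by move: yB; rewrite -PE => /andP[].
rewrite ffunE !inE xB orbT.
have -> : (y |: B) :\ x = y |: C.
  by rewrite setDUl -/C; congr (_ :|: _); apply/setDidPl; rewrite disjoints1 inE.
rewrite linearZ /= !scalerA -scalerDl.
have xyC : x \notin y |: C by rewrite in_setU1 negb_or eq_sym yx.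
rewrite BE setUCA (ksignU x xyC) (ksignU x yC) (ksignU y xC) ltnn.
have -> : (x < y)%N = ~~ (y < x)%N by rewrite -leqNgt ltn_neqAle andb_idl // => _; rewrite eq_sym.
rewrite [X in X *: _](_ : _ = 0) ?scale0r //.
by case: (y < x)%N; rewrite /= ?expr1 ?expr0; ring.
Qed.

Lemma gact_null x i r v : cyc i r v -> bnd i (r + 1) (pointwise (gact M x) v).
Proof.
move=> [Kv v0]; exists (contraction x v).
  by rewrite addrK; exact: chain_contraction.
rewrite -contraction_homotopy v0 [X in _ + X](_ : _ = 0) ?addr0 //.
by apply/ffunP => B; rewrite !ffunE scaler0 if_same.
Qed.

Lemma hdim_neg i r : (i < 0)%R -> hdim i r 0.
Proof.
move=> i0; apply: quotient_dim0 => v [Kv _].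
have -> : v = 0.
  apply/ffunP => B; case: (Kv B) => _; rewrite ffunE => -> //; lia.
exact: subspace0 (bnd_subspace _ _).
Qed.

Lemma hdim_deg0 i r : (forall u, gdeg r u -> u = 0 :> M) -> hdim i r 0.
Proof.
move=> D0; apply: quotient_dim0 => v [Kv _].
have -> : v = 0 by apply/ffunP => B; rewrite ffunE; apply: D0; case: (Kv B).
exact: subspace0 (bnd_subspace _ _).
Qed.

End Homology.

(** This is M(-c): generators move c rows down the Betti table. *)
Definition gshift (c : int) (M : gmod) : gmod :=
  @Gmod M (@gact M) (fun r => @gdeg M (r - c))
    (fun r => gdeg_subspace M (r - c))
    (fun x r u Du => eq_rect _ (fun z => gdeg z (gact M x u)) (gact_deg x Du) _
       (addrAC r (- c) 1))
    (fun x y r u Du => gactC x y Du).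

Lemma hdim_gshift c M i r m : hdim M i (r - c) m -> hdim (gshift c M) i r m.
Proof. by rewrite /hdim /bnd /cyc /chain /= (addrAC r (-1)). Qed.

End KoszulHomology.

(** * The long exact sequence of Koszul homology *)

Section LongExact.
Variables (k : fieldType) (n : nat) (A B C : gmod k n).
Variables (io : {linear A -> B}) (pi : {linear B -> C}).
Variables (sg : {linear C -> B}) (rh : {linear B -> A}).

(* A short exact sequence 0 -> A -> B -> C -> 0 of graded modules, with a
   splitting of the underlying sequence of graded vector spaces. *)
Record split_exact : Prop := SplitExact {
  sx_io : forall r u, gdeg r u -> gdeg r (io u);
  sx_pi : forall r u, gdeg r u -> gdeg r (pi u);
  sx_sg : forall r u, gdeg r u -> gdeg r (sg u);
  sx_rh : forall r u, gdeg r u -> gdeg r (rh u);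
  sx_ioX : forall x r u, gdeg r u -> io (gact A x u) = gact B x (io u);
  sx_piX : forall x r u, gdeg r u -> pi (gact B x u) = gact C x (pi u);
  sx_inj : forall r u, gdeg r u -> io u = 0 -> u = 0;
  sx_pi_io : forall r u, gdeg r u -> pi (io u) = 0;
  sx_pi_sg : forall r u, gdeg r u -> pi (sg u) = u;
  sx_io_rh : forall r u, gdeg r u -> io (rh u) = u - sg (pi u)
}.

Hypothesis sx : split_exact.
Implicit Types i r : int.

Local Notation I := (pointwise (n := n) io).
Local Notation P := (pointwise (n := n) pi).
Local Notation S := (pointwise (n := n) sg).
Local Notation Rh := (pointwise (n := n) rh).

Let chainI i r v : chain i r v -> chain i r (I v).
Proof.
move=> Kv X; rewrite ffunE; have [Dv v0] := Kv X; split; first exact: (sx_io sx).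
by move/v0 ->; rewrite linear0.
Qed.

Let chainP i r v : chain i r v -> chain i r (P v).
Proof.
move=> Kv X; rewrite ffunE; have [Dv v0] := Kv X; split; first exact: (sx_pi sx).
by move/v0 ->; rewrite linear0.
Qed.

Let chainS i r v : chain i r v -> chain i r (S v).
Proof.
move=> Kv X; rewrite ffunE; have [Dv v0] := Kv X; split; first exact: (sx_sg sx).
by move/v0 ->; rewrite linear0.
Qed.

Let chainR i r v : chain i r v -> chain i r (Rh v).
Proof.
move=> Kv X; rewrite ffunE; have [Dv v0] := Kv X; split; first exact: (sx_rh sx).
by move/v0 ->; rewrite linear0.
Qed.

Let bdI i r v : chain i r v -> bd (I v) = I (bd v).
Proof.
move=> Kv; apply/ffunP => X; rewrite !ffunE linear_sum; apply: eq_bigr => x _.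
by rewrite ffunE linearZ /= (@sx_ioX sx x r _) //; case: (Kv (x |: X)).
Qed.

Let bdP i r v : chain i r v -> bd (P v) = P (bd v).
Proof.
move=> Kv; apply/ffunP => X; rewrite !ffunE linear_sum; apply: eq_bigr => x _.
by rewrite ffunE linearZ /= (@sx_piX sx x r _) //; case: (Kv (x |: X)).
Qed.

Let I_inj i r u v : chain i r u -> chain i r v -> I u = I v -> u = v.
Proof.
move=> Ku Kv /ffunP Iuv; apply/ffunP => X; apply/eqP; rewrite -subr_eq0; apply/eqP.
apply: (@sx_inj sx r).
  apply: subspaceB; [exact: gdeg_subspace|by case: (Ku X)|by case: (Kv X)].
by move: (Iuv X); rewrite !ffunE linearB => ->; rewrite subrr.
Qed.

Let PI i r v : chain i r v -> P (I v) = 0.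
Proof. by move=> Kv; apply/ffunP => X; rewrite !ffunE (@sx_pi_io sx r _) //; case: (Kv X). Qed.

Let PS i r v : chain i r v -> P (S v) = v.
Proof. by move=> Kv; apply/ffunP => X; rewrite !ffunE (@sx_pi_sg sx r _) //; case: (Kv X). Qed.

Let IR i r v : chain i r v -> I (Rh v) = v - S (P v).
Proof. by move=> Kv; apply/ffunP => X; rewrite !ffunE (@sx_io_rh sx r _) //; case: (Kv X). Qed.

(** The snake construction without choices: lift along [sg], apply the differential, and return
    along [io] by means of [rh]. *)
Definition connecting (v : {ffun {set 'I_n} -> C}) : {ffun {set 'I_n} -> A} :=
  Rh (bd (S v)).

Lemma connecting_is_linear : linear connecting.
Proof.
by move=> a u v; rewrite /connecting linearP /= (linearP (bd (M := B))) linearP.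
Qed.

HB.instance Definition _ := GRing.isLinear.Build k {ffun {set 'I_n} -> C}
  {ffun {set 'I_n} -> A} _ connecting connecting_is_linear.

Let I_connecting i r v : cyc i r v -> I (connecting v) = bd (S v).
Proof.
move=> [Kv v0]; rewrite (IR (chain_bd (chainS Kv))) -(bdP (chainS Kv)) (PS Kv) v0.
by rewrite linear0 subr0.
Qed.

Let chain_connecting i r v : chain i r v -> chain (i - 1) (r + 1) (connecting v).
Proof. by move=> Kv; apply/chainR/chain_bd/chainS. Qed.

Let cyc_connecting i r v : cyc i r v -> cyc (i - 1) (r + 1) (connecting v).
Proof.
move=> Zv; have [Kv v0] := Zv; have Kc := chain_connecting Kv; split=> //.
apply: (I_inj (chain_bd Kc) (subspace0 (chain_subspace _ _ _))).
by rewrite -(bdI Kc) (I_connecting Zv) (bd_bd (chainS Kv)) linear0.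
Qed.

Let bnd_connecting i r v : bnd i r v -> bnd (i - 1) (r + 1) (connecting v).
Proof.
case=> w Kw ->; have KSw := chainS Kw.
have Kb : chain i r (bd w).
  by have := chain_bd Kw; rewrite addrK subrK.
have KbS : chain i r (bd (S w)).
  by have := chain_bd KSw; rewrite addrK subrK.
have KD := subspaceB (chain_subspace _ _ _) (chainS Kb) KbS.
exists (Rh (S (bd w) - bd (S w))); first by rewrite subrK addrK; exact: chainR.
apply: (I_inj (chain_connecting Kb)).
  exact/chain_bd/chainR.
have Zb : cyc i r (bd w) by split=> //; exact: bd_bd Kw.
have PD : P (S (bd w) - bd (S w)) = 0.
  by rewrite linearB /= (PS Kb) -(bdP KSw) (PS Kw) subrr.
rewrite (I_connecting Zb) -(bdI (chainR KD)) (IR KD) PD linear0 subr0.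
by rewrite linearB /= (bd_bd KSw) subr0.
Qed.

Let cycI i r v : cyc i r v -> cyc i r (I v).
Proof. by move=> [Kv v0]; split; [exact: chainI|rewrite (bdI Kv) v0 linear0]. Qed.

Let cycP i r v : cyc i r v -> cyc i r (P v).
Proof. by move=> [Kv v0]; split; [exact: chainP|rewrite (bdP Kv) v0 linear0]. Qed.

Let bndI i r v : bnd i r v -> bnd i r (I v).
Proof. by case=> w Kw ->; exists (I w); [exact: chainI|rewrite (bdI Kw)]. Qed.

Let bndP i r v : bnd i r v -> bnd i r (P v).
Proof. by case=> w Kw ->; exists (P w); [exact: chainP|rewrite (bdP Kw)]. Qed.

Let exact_B i r v : cyc i r v -> bnd i r (P v) ->
  exists2 u, cyc i r u & bnd i r (v - I u).
Proof.
move=> [Kv v0] [w Kw Pv]; have KSw := chainS Kw.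
have Kb : chain i r (bd (S w)) by have := chain_bd KSw; rewrite addrK subrK.
have KD := subspaceB (chain_subspace _ _ _) Kv Kb.
have IE : I (Rh (v - bd (S w))) = v - bd (S w).
  by rewrite (IR KD) linearB /= Pv -(bdP KSw) (PS Kw) subrr linear0 subr0.
exists (Rh (v - bd (S w))).
  split; first exact: chainR.
  have KRD := chainR KD.
  apply: (I_inj (chain_bd KRD) (subspace0 (chain_subspace _ _ _))).
  by rewrite -(bdI KRD) IE linearB /= v0 (bd_bd KSw) subrr linear0.
by rewrite IE opprB addrC subrK; exists (S w).
Qed.

Let exact_C i r v : cyc i r v -> bnd (i - 1) (r + 1) (connecting v) ->
  exists2 u, cyc i r u & v = P u.
Proof.
move=> Zv [w Kw cv]; have [Kv v0] := Zv; rewrite subrK addrK in Kw.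
exists (S v - I w); last by rewrite linearB /= (PS Kv) (PI Kw) subr0.
split; first by apply: (subspaceB (chain_subspace _ _ _)); [exact: chainS|exact: chainI].
by rewrite linearB /= -(I_connecting Zv) cv (bdI Kw) subrr.
Qed.

Let exact_A i r v : cyc i r v -> bnd i r (I v) ->
  exists2 u, cyc (i + 1) (r - 1) u & bnd i r (v - connecting u).
Proof.
move=> [Kv v0] [w Kw Iv]; have KP := chainP Kw.
have ZP : cyc (i + 1) (r - 1) (P w).
  by split=> //; rewrite (bdP Kw) -Iv (PI Kv).
exists (P w) => //; exists (Rh w); first exact: chainR.
have KR := chainR Kw; have Kc := chain_connecting KP; rewrite addrK subrK in Kc.
have KbR := chain_bd KR; rewrite addrK subrK in KbR.
apply: (I_inj (subspaceB (chain_subspace _ _ _) Kv Kc)) => //.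
by rewrite linearB /= (I_connecting ZP) -(bdI KR) (IR Kw) linearB /= Iv.
Qed.

Let connecting_P i r v : cyc i r v -> bnd (i - 1) (r + 1) (connecting (P v)).
Proof.
move=> Zv; have [Kv v0] := Zv; have KR := chainR Kv; exists (- Rh v).
  by rewrite subrK addrK; exact: (subspaceN (chain_subspace _ _ _)).
apply: (I_inj (chain_connecting (chainP Kv))).
  by apply/chain_bd; exact: (subspaceN (chain_subspace _ _ _)).
rewrite (I_connecting (cycP Zv)) linearN /= linearN /= -(bdI KR) (IR Kv).
by rewrite linearB /= v0 sub0r opprK.
Qed.

Let I_connecting_bnd i r v : cyc (i + 1) (r - 1) v -> bnd i r (I (connecting v)).
Proof. by move=> Zv; exists (S v); [apply: chainS; case: Zv|exact: I_connecting Zv]. Qed.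

(** The long exact sequence is used only through the short pieces that it leaves around B, C or A
    when the two neighbouring maps vanish on homology; this and the next two lemmas are the three
    cases. *)
Lemma short_exact_B i r :
  (forall v, cyc (i + 1) (r - 1) v -> bnd i r (connecting v)) ->
  (forall v, cyc i r v -> bnd (i - 1) (r + 1) (connecting v)) ->
  short_exact (@cyc _ _ A i r) (@bnd _ _ A i r) (@cyc _ _ B i r) (@bnd _ _ B i r)
    (@cyc _ _ C i r) (@bnd _ _ C i r) I P.
Proof.
move=> d1 d0; split; try by [exact: cyc_subspace|exact: bnd_subspace].
- exact: cycI.
- exact: bndI.
- exact: cycP.
- exact: bndP.
- move=> v Zv /(exact_A Zv)[u Zu]; move/(subspace_cong (bnd_subspace _ _ _)); apply; exact: d1.
- by move=> v [Kv _] /=; rewrite (PI Kv); exact: subspace0 (bnd_subspace _ _ _).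
- exact: exact_B.
- move=> v Zv; have [u Zu ->] := exact_C Zv (d0 v Zv); exists u => //.
  by rewrite subrr; exact: subspace0 (bnd_subspace _ _ _).
Qed.

Lemma short_exact_C i r :
  (forall v, cyc i r v -> bnd i r (I v)) ->
  (forall v, cyc (i - 1) (r + 1) v -> bnd (i - 1) (r + 1) (I v)) ->
  short_exact (@cyc _ _ B i r) (@bnd _ _ B i r) (@cyc _ _ C i r) (@bnd _ _ C i r)
    (@cyc _ _ A (i - 1) (r + 1)) (@bnd _ _ A (i - 1) (r + 1)) P connecting.
Proof.
move=> I1 I0; split; try by [exact: cyc_subspace|exact: bnd_subspace].
- exact: cycP.
- exact: bndP.
- exact: cyc_connecting.
- exact: bnd_connecting.
- move=> v Zv /(exact_B Zv)[u Zu]; move/(subspace_cong (bnd_subspace _ _ _)); apply; exact: I1.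
- exact: connecting_P.
- move=> v Zv /(exact_C Zv)[u Zu ->]; exists u => //.
  by rewrite subrr; exact: subspace0 (bnd_subspace _ _ _).
- move=> v Zv; have [u Zu uv] := exact_A Zv (I0 v Zv); exists u => //.
  by move: Zu; rewrite subrK addrK.
Qed.

Lemma short_exact_A i r :
  (forall v, cyc (i + 1) (r - 1) v -> bnd (i + 1) (r - 1) (P v)) ->
  (forall v, cyc i r v -> bnd i r (P v)) ->
  short_exact (@cyc _ _ C (i + 1) (r - 1)) (@bnd _ _ C (i + 1) (r - 1))
    (@cyc _ _ A i r) (@bnd _ _ A i r) (@cyc _ _ B i r) (@bnd _ _ B i r) connecting I.
Proof.
move=> P1 P0; have iE : i = i + 1 - 1 by rewrite addrK.
have rE : r = r - 1 + 1 by rewrite subrK.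
split; try by [exact: cyc_subspace|exact: bnd_subspace].
- by move=> v /cyc_connecting; rewrite -iE -rE.
- by move=> v /bnd_connecting; rewrite -iE -rE.
- exact: cycI.
- exact: bndI.
- move=> v Zv; rewrite {1}iE {1}rE => /(exact_C Zv)[u Zu ->]; exact: P1.
- by move=> v /I_connecting_bnd.
- exact: exact_A.
- move=> v Zv; exact: exact_B Zv (P0 v Zv).
Qed.

(** The disjunctions leave each of the two adjacent connecting maps with a zero source or a zero
    target. *)
Lemma hdim_additive i r a c :
  hdim A i r a -> hdim C i r c ->
  (hdim C (i + 1) (r - 1) 0 \/ hdim A i r 0) ->
  (hdim C i r 0 \/ hdim A (i - 1) (r + 1) 0) ->
  hdim B i r (a + c).
Proof.
move=> hA hC d1 d0; apply: short_exact_dim_mid hA hC; apply: short_exact_B => v Zv.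
  case: d1 => h; last first.
    by apply: (quotient_dim0P h); have := cyc_connecting Zv; rewrite addrK subrK.
  by have := bnd_connecting (quotient_dim0P h Zv); rewrite addrK subrK.
case: d0 => h; first exact: bnd_connecting (quotient_dim0P h Zv).
exact: quotient_dim0P h (cyc_connecting Zv).
Qed.

(** For sequences whose tables do not add up: here the connecting map is injective, and the homology
    of B is what remains of that of A. *)
Lemma hdim_quotient i r b a :
  hdim A i r a -> hdim C (i + 1) (r - 1) b ->
  hdim B (i + 1) (r - 1) 0 -> (hdim B i r 0 \/ hdim C i r 0) ->
  exists2 c, hdim B i r c & (b + c = a)%N.
Proof.
move=> hA hC hB d0; apply: short_exact_dim_right hC hA; apply: short_exact_A => v Zv.
  exact: bndP (quotient_dim0P hB Zv).
case: d0 => h; first exact: bndP (quotient_dim0P h Zv).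
exact: quotient_dim0P h (cycP Zv).
Qed.

(** Dimension shifting. It is applied with B the polynomial ring, whose homology is concentrated in
    one place. *)
Lemma hdim_syzygy i r c :
  hdim C (i + 1) (r - 1) c ->
  hdim B (i + 1) (r - 1) 0 -> hdim B i r 0 -> hdim A i r c.
Proof.
move=> hC hB1 hB0; rewrite -[c]addn0; apply: (short_exact_dim_mid _ hC hB0).
apply: short_exact_A => v Zv; first exact: bndP (quotient_dim0P hB1 Zv).
exact: bndP (quotient_dim0P hB0 Zv).
Qed.

Lemma hdim_kernel i r b c : (forall i r v, cyc i r v -> bnd i r (I v)) ->
  hdim C i r c -> hdim A (i - 1) (r + 1) b ->
  exists2 m, hdim B i r m & (m + b = c)%N.
Proof.
move=> I0 hC hA; apply: short_exact_dim_left hC hA.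
by apply: short_exact_C => v; exact: I0.
Qed.

End LongExact.

Lemma hdim_transport (k : fieldType) (n : nat) (A B : gmod k n) (F : {linear A -> B}) i r m :
  (forall r u, gdeg r u -> gdeg r (F u)) ->
  (forall x r u, gdeg r u -> F (gact A x u) = gact B x (F u)) ->
  (forall u, F u = 0 -> u = 0) ->
  (forall r w, gdeg r w -> exists2 u, gdeg r u & w = F u) ->
  hdim A i r m -> hdim B i r m.
Proof.
move=> FD FX Finj Fsurj.
pose G := pointwise (n := n) F.
have chainG i' r' v : chain i' r' v -> chain i' r' (G v).
  move=> Kv X; rewrite ffunE; have [Dv v0] := Kv X; split; first exact: FD.
  by move/v0 ->; rewrite linear0.
have bdG i' r' v : chain i' r' v -> bd (G v) = G (bd v).
  move=> Kv; apply/ffunP => X; rewrite !ffunE linear_sum; apply: eq_bigr => x _.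
  by rewrite ffunE linearZ /= (FX x r') //; case: (Kv (x |: X)).
have Ginj u v : G u = G v -> u = v.
  move=> /ffunP e; apply/ffunP => X; apply/eqP; rewrite -subr_eq0; apply/eqP/Finj.
  by have := e X; rewrite !ffunE linearB => ->; rewrite subrr.
have chain_lift i' r' w : chain i' r' w -> exists2 u, chain i' r' u & w = G u.
  move=> Kw; have /fin_all_exists [u uP] : forall X, exists u, gdeg r' u /\ w X = F u.
    by move=> X; have [Dw _] := Kw X; have [u Du ->] := Fsurj _ _ Dw; exists u.
  exists (finfun u) => [X|]; last by apply/ffunP => X; rewrite !ffunE; case: (uP X).
  rewrite ffunE; have [Du wE] := uP X; split=> // cX; apply: Finj; rewrite -wE.
  by case: (Kw X) => _ ->.
have lift0 i' r' u : chain i' r' u -> bd (G u) = 0 -> bd u = 0.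
  by move=> Ku u0; apply: Ginj; rewrite -(bdG _ _ _ Ku) u0 /G linear0.
apply: (quotient_dim_iso (F := G)).
- exact: cyc_subspace.
- exact: cyc_subspace.
- exact: bnd_subspace.
- by move=> v [Kv v0]; split; [exact: chainG|rewrite (bdG _ _ _ Kv) v0 /G linear0].
- by move=> _ [w Kw ->]; exists (G w); [exact: chainG|rewrite (bdG _ _ _ Kw)].
- move=> v [Kv _] [w Kw e]; have [u Ku wE] := chain_lift _ _ _ Kw.
  by exists u => //; apply: Ginj; rewrite [LHS]e wE (bdG _ _ _ Ku).
move=> w [Kw w0]; have [u Ku wE] := chain_lift _ _ _ Kw.
exists u; last by rewrite wE subrr; exact: subspace0 (bnd_subspace _ _ _).
by split=> //; apply: lift0 Ku _; rewrite -wE.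
Qed.

(** * Modules spanned by monomials *)

Section MonomialMaps.
Variables (k : fieldType) (N : nat).
Implicit Types (p q : {mpoly k[N]}) (m e : 'X_{1..N}) (B : pred 'X_{1..N}).

Definition restr B p : {mpoly k[N]} := \sum_(m <- msupp p | B m) p@_m *: 'X_[m].

Definition mulX e p : {mpoly k[N]} := p * 'X_[e].

Definition divX e p : {mpoly k[N]} :=
  \sum_(m <- msupp p | (e <= m)%MM) p@_m *: 'X_[m - e].

Lemma mcoeff_restr B p m : (restr B p)@_m = if B m then p@_m else 0.
Proof.
rewrite /restr raddf_sum /= (eq_bigr (fun m' => p@_m' * (m' == m)%:R)); last first.
  by move=> m' _; rewrite mcoeffZ mcoeffX.
have [pm|pm] := boolP (m \in msupp p); last first.
  rewrite (memN_msupp_eq0 pm) if_same big_seq_cond big1 // => m' /andP[pm' _].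
  by rewrite (_ : _ == _ = false) ?mulr0 //; apply: contraNF pm => /eqP <-.
rewrite big_mkcond (bigD1_seq m) ?msupp_uniq //= eqxx mulr1 big1 ?addr0 //.
by move=> m' /negPf ->; rewrite mulr0 if_same.
Qed.

Lemma mcoeff_divX e p m : (divX e p)@_m = p@_(m + e).
Proof.
rewrite /divX raddf_sum /=.
rewrite (eq_bigr (fun m' => p@_m' * (m' == m + e)%MM%:R)); last first.
  move=> m' em'; rewrite mcoeffZ mcoeffX; congr (_ * (nat_of_bool _)%:R).
  by apply/eqP/eqP => [<-|->]; rewrite ?submK ?addmK.
have [pm|pm] := boolP ((m + e)%MM \in msupp p); last first.
  rewrite (memN_msupp_eq0 pm) big_seq_cond big1 // => m' /andP[pm' _].
  by rewrite (_ : _ == _ = false) ?mulr0 //; apply: contraNF pm => /eqP <-.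
rewrite big_mkcond (bigD1_seq (m + e)%MM) ?msupp_uniq //= eqxx mulr1 lem_addl big1 ?addr0 //.
by move=> m' /negPf ->; rewrite mulr0 if_same.
Qed.

Lemma mcoeff_mulX e p m :
  (mulX e p)@_m = if (e <= m)%MM then p@_(m - e) else 0.
Proof.
rewrite /mulX; case: ifP => em; first by rewrite -{1}(submK em) [(_ + e)%MM]addmC mcoeffMX.
apply: memN_msupp_eq0; rewrite (perm_mem (msuppMX _ _)); apply/negP => /mapP[m' _ em'].
by rewrite em' lem_addr in em.
Qed.

Lemma mcoeff_mulXD e p m : (mulX e p)@_(m + e) = p@_m.
Proof. by rewrite mcoeff_mulX lem_addl addmK. Qed.

Lemma restr_is_linear B : linear (restr B).
Proof.
move=> a p q; apply/mpolyP => m; rewrite mcoeffD mcoeffZ !mcoeff_restr.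
by case: ifP; rewrite ?mcoeffD ?mcoeffZ ?mulr0 ?addr0.
Qed.

Lemma mulX_is_linear e : linear (mulX e).
Proof. by move=> a p q; rewrite /mulX mulrDl scalerAl. Qed.

Lemma divX_is_linear e : linear (divX e).
Proof.
by move=> a p q; apply/mpolyP => m; rewrite mcoeffD mcoeffZ !mcoeff_divX mcoeffD mcoeffZ.
Qed.

HB.instance Definition _ B :=
  GRing.isLinear.Build k {mpoly k[N]} {mpoly k[N]} _ (restr B) (restr_is_linear B).
HB.instance Definition _ e :=
  GRing.isLinear.Build k {mpoly k[N]} {mpoly k[N]} _ (mulX e) (mulX_is_linear e).
HB.instance Definition _ e :=
  GRing.isLinear.Build k {mpoly k[N]} {mpoly k[N]} _ (divX e) (divX_is_linear e).

Lemma restr_id B p : (forall m, p@_m != 0 -> B m) -> restr B p = p.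
Proof.
move=> Bp; apply/mpolyP => m; rewrite mcoeff_restr; case: ifP => // Bm.
by apply/esym/eqP/negPn/negP => /Bp; rewrite Bm.
Qed.

End MonomialMaps.

Section MonomialModules.
Variables (k : fieldType) (n N : nat) (w : 'I_n -> 'X_{1..N}).
Variable dg : 'X_{1..N} -> nat.
Hypothesis dgD : forall m m', dg (m + m')%MM = (dg m + dg m')%N.
Hypothesis dgw : forall x, dg (w x) = 1%N.
Local Notation P := {mpoly k[N]}.
Implicit Types (A B C : pred 'X_{1..N}) (m e : 'X_{1..N}).

(** Truncated multiplications by x and y commute under this condition: if both m and its product
    with x y survive, then neither order of multiplication passes through a monomial that is
    dropped. *)
Definition convex B : Prop := forall x y m,
  B m -> B (m + w x + w y)%MM -> B (m + w x)%MM.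

Definition supported_in B (r : int) (p : P) : Prop :=
  forall m, p@_m != 0 -> B m /\ (dg m)%:Z = r.

Definition trunc_mul B (x : 'I_n) : {linear P -> P} := restr B \o mulX (w x).

Lemma supported_in_subspace B r : subspace (supported_in B r).
Proof.
split=> [m|a u v su sv m]; first by rewrite mcoeff0 eqxx.
rewrite mcoeffD mcoeffZ; have [um|um] := eqVneq u@_m 0; last by move: (su m um).
by rewrite um mulr0 add0r; exact: sv.
Qed.

Lemma trunc_mul_deg B x r u :
  supported_in B r u -> supported_in B (r + 1) (trunc_mul B x u).
Proof.
move=> su m; rewrite /= mcoeff_restr; case: ifP => Bm; rewrite ?eqxx // mcoeff_mulX.
case: ifP => wm; rewrite ?eqxx // => /su[_ <-]; split=> //.
by rewrite -{1}(submK wm) dgD dgw PoszD.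
Qed.

Lemma trunc_mulC B (cB : convex B) x y r u : supported_in B r u ->
  trunc_mul B x (trunc_mul B y u) = trunc_mul B y (trunc_mul B x u).
Proof.
have half x' y' m : supported_in B r u ->
    (trunc_mul B x' (trunc_mul B y' u))@_m =
    if B m && (w x' + w y' <= m)%MM then u@_(m - (w x' + w y')) else 0.
  move=> su; rewrite /= mcoeff_restr; case: ifP => //= Bm; rewrite mcoeff_mulX.
  have [xm|xm] := boolP (w x' <= m)%MM; last first.
    rewrite ifN //; apply: contra xm; exact/lepm_trans/lem_addr.
  rewrite mcoeff_restr mcoeff_mulX.
  have -> : (w x' + w y' <= m)%MM = (w y' <= m - w x')%MM.
    apply/mnm_lepP/mnm_lepP => h i; have := h i; move/mnm_lepP/(_ i): xm;
      rewrite ?mnmDE ?mnmBE; lia.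
  case: ifP => Bmx.
    by case: ifP => // ym; rewrite submDA.
  case: ifP => // ym; apply/esym/eqP/negPn/negP => /su[Bm' _].
  move/negP: Bmx; apply.
  have em : (m - w x' = m - (w x' + w y') + w y')%MM by rewrite -submDA submK.
  rewrite em; apply: (cB y' x') => //.
  by rewrite -em submK.
by move=> su; apply/mpolyP => m; rewrite !half // [(w x + _)%MM]addmC.
Qed.

Definition monomial_module B (cB : convex B) : gmod k n :=
  Gmod (supported_in_subspace B) (@trunc_mul_deg B) (trunc_mulC cB).

Section Colon.
Variables (A B C : pred 'X_{1..N}) (e : 'X_{1..N}).
Variables (cA : convex A) (cB : convex B) (cC : convex C).
Hypothesis AE : forall m, A m = B (m + e)%MM.
Hypothesis CE : forall m, C m = B m && ~~ (e <= m)%MM.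

(** The sequence of multiplication by the monomial e, with A the colon of B by e. Here e may be any
    monomial of the Cox ring, such as s or v, so A and B may belong to different twists. *)
Lemma colon_split_exact :
  split_exact (A := gshift (dg e) (monomial_module cA)) (B := monomial_module cB)
    (C := monomial_module cC) (mulX e) (restr C) idfun (divX e).
Proof.
split=> [r u su m|r u su m|r u su m|r u su m|x r u su|x r u su|r u su eu|r u su|r u su|r u su] /=.
- rewrite mcoeff_mulX; case: ifP => em; rewrite ?eqxx // => /su[].
  rewrite AE submK // => -> dm; split=> //.
  by rewrite -{1}(submK em) dgD PoszD dm subrK.
- by rewrite mcoeff_restr; case: ifP => Cm; rewrite ?eqxx // => /su[_].
- by move=> /su[]; rewrite CE => /andP[].
- by rewrite mcoeff_divX => /su[Bm <-]; rewrite AE dgD PoszD addrK.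
- apply/mpolyP => m; rewrite mcoeff_restr !mcoeff_mulX mcoeff_restr !mcoeff_mulX AE.
  have [em|em] := boolP (e <= m)%MM.
    rewrite submK // ; case: ifP => // _.
    have -> : (w x <= m - e)%MM = (w x <= m)%MM && (e <= m - w x)%MM.
      apply/mnm_lepP/andP => [h|[/mnm_lepP h1 /mnm_lepP h2] i].
        by split; apply/mnm_lepP => i; have := h i; move/mnm_lepP/(_ i): em;
          rewrite ?mnmBE; lia.
      by have := h1 i; have := h2 i; move/mnm_lepP/(_ i): em; rewrite ?mnmBE; lia.
    by case: (w x <= m)%MM => //=; case: ifP => // _; rewrite !submDA addmC.
  rewrite [(e <= m - _)%MM](_ : _ = false) ?if_same //; apply: contraNF em => h.
  exact: lepm_trans h (lem_subr _ _).
- apply/mpolyP => m; rewrite !mcoeff_restr; case: ifP => // Cm.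
  move: (Cm); rewrite CE => /andP[-> em]; rewrite !mcoeff_mulX; case: ifP => // xm.
  rewrite mcoeff_restr; case: ifP => // Cmx; apply/eqP/negPn/negP => /su[Bmx _].
  move/negP: Cmx; apply; rewrite CE Bmx /=; apply: contra em => h.
  exact: lepm_trans h (lem_subr _ _).
- by apply/mpolyP => m; rewrite -(mcoeff_mulXD e) eu !mcoeff0.
- apply/mpolyP => m; rewrite mcoeff_restr CE mcoeff_mulX mcoeff0.
  by case: ifP => // /andP[_ /negPf ->].
- by apply: restr_id => m /su[].
- apply/mpolyP => m; rewrite mcoeffB mcoeff_restr mcoeff_mulX mcoeff_divX CE.
  case: ifP => em; rewrite ?andbF ?andbT ?submK ?subr0 //.
  have [um|um] := eqVneq u@_m 0; first by rewrite um if_same subrr.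
  by have [-> _] := su m um; rewrite subrr.
Qed.

End Colon.

Lemma hdim_regular B C x (cB : convex B) (cC : convex C) (i : nat) r b c :
  (forall m, B (m + w x)%MM = B m) -> (forall m, C m = B m && ~~ (w x <= m)%MM) ->
  hdim (monomial_module cC) i r c -> hdim (monomial_module cB) (i%:Z - 1) r b ->
  exists2 m, hdim (monomial_module cB) i r m & (m + b = c)%N.
Proof.
move=> BE CE hC hB.
have sx := colon_split_exact cB cB cC (fun m => esym (BE m)) CE.
apply: (hdim_kernel sx) hC _; last first.
  by apply: hdim_gshift; rewrite dgw addrK.
(* Since x preserves B, multiplication by its weight is the action of x, which is null on homology;
   this kills the first map of the long exact sequence. *)
move=> i' r' v [Kv v0].
have Zv : cyc (M := monomial_module cB) i' (r' - 1) v.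
  by split=> // X; have := Kv X; rewrite /= dgw.
have := gact_null x Zv; rewrite subrK.
rewrite (_ : pointwise _ v = pointwise (mulX (w x)) v) //.
apply/ffunP => X; rewrite !ffunE /=; apply: restr_id => m.
rewrite mcoeff_mulX; case: ifP => wm; rewrite ?eqxx //.
by case: (Kv X) => su _ /su[]; rewrite -BE submK.
Qed.

(** These are the Betti numbers of a copies, generated in degree r, of the polynomial ring modulo d
    independent linear forms. *)
Definition linear_row B (cB : convex B) (r : int) (a d : nat) : Prop :=
  forall (i : nat) (j : int),
    hdim (monomial_module cB) i j (if j == r then a * 'C(d, i) else 0)%N.

(** Passing to the quotient by a nonzerodivisor replaces d by d + 1; Pascal's rule recovers the
    table before the passage. *)
Lemma linear_row_regular B C x (cB : convex B) (cC : convex C) r a d :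
  (forall m, B (m + w x)%MM = B m) -> (forall m, C m = B m && ~~ (w x <= m)%MM) ->
  linear_row cC r a d.+1 -> linear_row cB r a d.
Proof.
move=> BE CE lC; elim=> [|i IH] j.
  have [//|m hm] := hdim_regular BE CE (lC 0%N j) (hdim_neg (monomial_module cB) j _).
  by rewrite addn0 !bin0 => <-.
have h : hdim (monomial_module cB) (i.+1%:Z - 1) j (if j == r then a * 'C(d, i) else 0)%N.
  by rewrite -addn1 PoszD addrK; exact: IH.
have [m hm mE] := hdim_regular BE CE (lC i.+1 j) h.
suff -> : (if j == r then a * 'C(d, i.+1) else 0)%N = m by [].
by move: mE; case: ifP => _; rewrite ?addn0 // binS mulnDr => /addIn ->.
Qed.

(** Both outer tables sit in the same row r, whereas connecting maps change the row. *)
Lemma linear_row_extension A B C e (cA : convex A) (cB : convex B) (cC : convex C) r a c d :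
  (forall m, A m = B (m + e)%MM) -> (forall m, C m = B m && ~~ (e <= m)%MM) ->
  linear_row cA (r - (dg e)%:Z) a d -> linear_row cC r c d -> linear_row cB r (a + c) d.
Proof.
move=> AE CE lA lC i j.
have sx := colon_split_exact cA cB cC AE CE.
have hA (i' : nat) j' : hdim (gshift (dg e) (monomial_module cA)) i' j'
    (if j' == r then a * 'C(d, i') else 0)%N.
  by apply: hdim_gshift; have := lA i' (j' - (dg e)%:Z); rewrite (inj_eq (addIr _)).
have hAi := hA i j; have hCi := lC i j.
suff : hdim (monomial_module cB) i j ((if j == r then a * 'C(d, i) else 0)
    + (if j == r then c * 'C(d, i) else 0))%N by case: ifP => //; rewrite mulnDl.
apply: (hdim_additive sx) => //.
  have [jr|jr] := boolP (j == r).
    left; have := lC i.+1 (j - 1); rewrite -addn1 PoszD ifN // (eqP jr).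
    by apply/eqP; lia.
  by right; move: hAi; rewrite (negPf jr).
have [jr|jr] := boolP (j == r); last by left; move: hCi; rewrite (negPf jr).
right; case: (i) => [|i'].
  by apply: hdim_neg.
have := hA i' (j + 1); rewrite -[i'.+1]addn1 PoszD addrK ifN // (eqP jr).
by apply/eqP; lia.
Qed.

(** The module is a shift of k, on which all coordinates act as zero. Every chain is a cycle and no
    nonzero chain is a boundary, so the classes are indexed by the sets of i coordinates. *)
Lemma linear_row_single B (cB : convex B) m0 : (forall m, B m = (m == m0)) ->
  linear_row cB (dg m0) 1 n.
Proof.
move=> BE i j; set M := monomial_module cB.
have act0 x (v : P) r : supported_in B r v -> trunc_mul B x v = 0.
  move=> sv; apply/mpolyP => m; rewrite /= mcoeff_restr BE mcoeff_mulX mcoeff0.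
  case: eqP => // ->; case: ifP => // wm; apply/eqP/negPn/negP => /sv[].
  rewrite BE => /eqP mE _; have := dgD (m0 - w x)%MM (w x).
  by rewrite submK // mE dgw; lia.
have bd0 i' j' (v : {ffun {set 'I_n} -> M}) : chain i' j' v -> bd v = 0.
  move=> Kv; apply/ffunP => X; rewrite !ffunE big1 // => x _.
  by rewrite (act0 x _ j') ?scaler0 //; case: (Kv (x |: X)).
have bnd0 i' j' (v : {ffun {set 'I_n} -> M}) : bnd i' j' v -> v = 0.
  by case=> u Ku ->; exact: bd0 Ku.
have Xm0 : 'X_[m0]@_m0 = 1 :> k by rewrite mcoeffX eqxx.
case: ifP => jr; last first.
  apply: quotient_dim0 => v [Kv _].
  suff -> : v = 0 by exact: subspace0 (bnd_subspace _ _ _).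
  apply/ffunP => X; rewrite ffunE; apply/mpolyP => m; rewrite mcoeff0.
  apply/eqP/negPn/negP; case: (Kv X) => sv _ /sv[]; rewrite BE => /eqP -> /esym.
  by apply/eqP; rewrite jr.
rewrite mul1n -[n in 'C(n, _)]card_ord -card_draws.
set D := [set X : {set 'I_n} | _].
pose u (l : 'I_#|D|) : {ffun {set 'I_n} -> M} :=
  [ffun X => if X == enum_val l then 'X_[m0] else 0].
have uE (c : 'I_#|D| -> k) X :
    ((\sum_l c l *: u l) X)@_m0 = \sum_l c l * (X == enum_val l)%:R.
  rewrite sum_ffunE raddf_sum /=; apply: eq_bigr => l _.
  by rewrite !ffunE mcoeffZ; case: eqP; rewrite ?Xm0 ?mcoeff0.
have uK (c : 'I_#|D| -> k) l : \sum_l' c l' * (enum_val l == enum_val l')%:R = c l.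
  rewrite (bigD1 l) //= eqxx mulr1 big1 ?addr0 // => l' l'l.
  by rewrite (inj_eq enum_val_inj) eq_sym (negPf l'l) mulr0.
exists u; split=> [l|v [Kv _]|c Bc l].
- have Ku : chain (M := M) i j (u l).
    move=> X; rewrite ffunE; case: eqP => [->|_]; last first.
      by split=> // m; rewrite mcoeff0 eqxx.
    have := enum_valP l; rewrite inE => /eqP ->; split; last by rewrite eqxx.
    move=> m; rewrite mcoeffX; case: (eqVneq m0 m) => [<- _|]; last by rewrite eqxx.
    by rewrite BE eqxx (eqP jr).
  by split=> //; exact: bd0 Ku.
- exists (fun l => (v (enum_val l))@_m0).
  suff <- : v = \sum_l (v (enum_val l))@_m0 *: u l.
    by rewrite subrr; exact: subspace0 (bnd_subspace _ _ _).
  have vE X m : m != m0 -> (v X)@_m = 0.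
    move=> mm0; apply/eqP/negPn/negP; case: (Kv X) => sv _ /sv[].
    by rewrite BE (negPf mm0).
  apply/ffunP => X; apply/mpolyP => m; have [->|mm0] := eqVneq m m0; last first.
    rewrite vE // sum_ffunE raddf_sum big1 //= => l _.
    rewrite !ffunE mcoeffZ; case: ifP => _; rewrite ?mcoeff0 ?mulr0 //.
    by rewrite mcoeffX eq_sym (negPf mm0) mulr0.
  rewrite uE; have [XD|XD] := boolP (X \in D).
    by rewrite -(enum_rankK_in XD XD) uK.
  rewrite big1 => [|l _]; last first.
    by rewrite (_ : _ == _ = false) ?mulr0 //; apply: contraNF XD => /eqP ->; exact: enum_valP.
  case: (Kv X) => _ -> //; rewrite ?mcoeff0 //.
  by move: XD; rewrite inE.
by have := bnd0 _ _ _ Bc => /ffunP /(_ (enum_val l)) /mpolyP /(_ m0); rewrite uE uK ffunE mcoeff0.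
Qed.

End MonomialModules.

Arguments linear_row_regular {k n N w dg dgD dgw B C} x {cB} cC {r a d}.
Arguments linear_row_extension {k n N w dg dgD dgw A B C} e {cA cB cC r} a c {d}.
Arguments colon_split_exact {k n N w dg dgD dgw A B C} e {cA cB cC}.

(** * Building blocks over the scroll *)

Definition mono (p q i j : nat) : 'X_{1..4} := [multinom [tuple p; q; i; j]].

Definition vs : 'I_4 := @Ordinal 4 0 isT.
Definition vt : 'I_4 := @Ordinal 4 1 isT.
Definition vu : 'I_4 := @Ordinal 4 2 isT.
Definition vv : 'I_4 := @Ordinal 4 3 isT.

Lemma mono_s p q i j : mono p q i j vs = p. Proof. by []. Qed.
Lemma mono_t p q i j : mono p q i j vt = q. Proof. by []. Qed.
Lemma mono_u p q i j : mono p q i j vu = i. Proof. by []. Qed.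
Lemma mono_v p q i j : mono p q i j vv = j. Proof. by []. Qed.
Definition monoE := (mono_s, mono_t, mono_u, mono_v).

Lemma ord4P (P : 'I_4 -> Prop) : P vs -> P vt -> P vu -> P vv -> forall i, P i.
Proof.
move=> Ps Pt Pu Pv [[|[|[|[|i]]]] lt_i] //.
- by rewrite (_ : Ordinal _ = vs) //; apply: val_inj.
- by rewrite (_ : Ordinal _ = vt) //; apply: val_inj.
- by rewrite (_ : Ordinal _ = vu) //; apply: val_inj.
- by rewrite (_ : Ordinal _ = vv) //; apply: val_inj.
Qed.

Lemma mono_le p q i j (m : 'X_{1..4}) :
  (mono p q i j <= m)%MM = [&& p <= m vs, q <= m vt, i <= m vu & j <= m vv]%N.
Proof.
apply/mnm_lepP/and4P => [h|[hs ht hu hv]]; last by apply: ord4P.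
by split; [have := h vs|have := h vt|have := h vu|have := h vv].
Qed.

Lemma mono_ge p q i j (m : 'X_{1..4}) :
  (m <= mono p q i j)%MM = [&& m vs <= p, m vt <= q, m vu <= i & m vv <= j]%N.
Proof.
apply/mnm_lepP/and4P => [h|[hs ht hu hv]]; last by apply: ord4P.
by split; [have := h vs|have := h vt|have := h vu|have := h vv].
Qed.

Lemma mono_eq p q i j (m : 'X_{1..4}) :
  (m == mono p q i j) = [&& m vs == p, m vt == q, m vu == i & m vv == j].
Proof.
apply/eqP/and4P => [->|[/eqP hs /eqP ht /eqP hu /eqP hv]]; first by rewrite !monoE.
by apply/mnmP; apply: ord4P; rewrite !monoE.
Qed.

(* the images s u, t u, s^3 v, s^2 t v, s t^2 v, t^3 v of the coordinates of P^5 *)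
Definition wt (x : 'I_(2 + 4)) : 'X_{1..4} :=
  match split x with
  | inl y => mono (1 - y) y 1 0
  | inr y => mono (3 - y) y 0 1
  end.

Definition fibre_deg (m : 'X_{1..4}) : nat := (m vu + m vv)%N.

Lemma fibre_degD m m' : fibre_deg (m + m')%MM = (fibre_deg m + fibre_deg m')%N.
Proof. by rewrite /fibre_deg !mnmDE; lia. Qed.

Lemma fibre_deg_wt x : fibre_deg (wt x) = 1%N.
Proof. by rewrite /fibre_deg /wt; case: split => y; rewrite !monoE. Qed.

Lemma wt_degree x : (wt x vs + wt x vt = wt x vu + 3 * wt x vv)%N.
Proof. by rewrite /wt; case: split => y; rewrite !monoE; have := ltn_ord y; lia. Qed.

(* the monomials s^p t^q u^i v^j of degree d H - b F for some d *)
Definition twist (b : int) (m : 'X_{1..4}) : bool :=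
  (m vs + m vt)%:Z == (m vu + 3 * m vv)%:Z - b.

Lemma twist_wt b m x : twist b (m + wt x)%MM = twist b m.
Proof. by have := wt_degree x; rewrite /twist !mnmDE; lia. Qed.

Definition x0 : 'I_(2 + 4) := lshift 4 (@Ordinal 2 0 isT).
Definition x1 : 'I_(2 + 4) := lshift 4 (@Ordinal 2 1 isT).
Definition y0 : 'I_(2 + 4) := rshift 2 (@Ordinal 4 0 isT).
Definition y3 : 'I_(2 + 4) := rshift 2 (@Ordinal 4 3 isT).

Lemma wt_x0 : wt x0 = mono 1 0 1 0.
Proof. by rewrite /wt /x0 (unsplitK (inl _)). Qed.
Lemma wt_x1 : wt x1 = mono 0 1 1 0.
Proof. by rewrite /wt /x1 (unsplitK (inl _)). Qed.
Lemma wt_y0 : wt y0 = mono 3 0 0 1.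
Proof. by rewrite /wt /y0 (unsplitK (inr _)). Qed.
Lemma wt_y3 : wt y3 = mono 0 3 0 1.
Proof. by rewrite /wt /y3 (unsplitK (inr _)). Qed.

Section ScrollModules.
Variable k : fieldType.
Implicit Types (b : int) (D : pred 'X_{1..4}).

(** Such a set is the complement of a monomial ideal, so [strip b D] below spans a quotient of
    E_b. *)
Definition down_closed D : Prop := forall m m', D (m + m')%MM -> D m.

Definition strip b D : pred 'X_{1..4} := fun m => twist b m && D m.

Lemma convex_strip b D : down_closed D -> convex wt (strip b D).
Proof.
by move=> dD x y m /andP[tm _] /andP[_ /dD Dm]; rewrite /strip twist_wt tm.
Qed.

Lemma convex_twist b : convex wt (twist b).
Proof. by move=> x y m tm _; rewrite twist_wt. Qed.

Local Notation module c := (monomial_module k fibre_degD fibre_deg_wt c).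
Local Notation row c := (linear_row k fibre_degD fibre_deg_wt c).

(** In these names p, i and j stand for the exponents of s, u and v that are made zero or bounded;
    [Dsu] kills the multiples of x0 = s u. *)
Definition Dempty : pred 'X_{1..4} := pred0.
Definition Dsu : pred 'X_{1..4} := fun m => ~~ ((0 < m vs) && (0 < m vu))%N.
Definition Dp : pred 'X_{1..4} := fun m => m vs == 0%N.
Definition Di : pred 'X_{1..4} := fun m => m vu == 0%N.
Definition Dj : pred 'X_{1..4} := fun m => m vv == 0%N.
Definition Dip (d : nat) : pred 'X_{1..4} := fun m => (m vu == 0%N) && (m vs <= d)%N.
Definition Djp : pred 'X_{1..4} := fun m => (m vv == 0%N) && (m vs == 0%N).
Definition D1 (m0 : 'X_{1..4}) : pred 'X_{1..4} := fun m => (m <= m0)%MM.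

Ltac down := by move=> m m'; rewrite /Dsu /Dp /Di /Dj /Dip /Djp ?mnmDE; lia.

Lemma down_su : down_closed Dsu. Proof. down. Qed.
Lemma down_p : down_closed Dp. Proof. down. Qed.
Lemma down_i : down_closed Di. Proof. down. Qed.
Lemma down_j : down_closed Dj. Proof. down. Qed.
Lemma down_ip d : down_closed (Dip d). Proof. down. Qed.
Lemma down_jp : down_closed Djp. Proof. down. Qed.
Lemma down_empty : down_closed Dempty. Proof. by []. Qed.
Lemma down_1 m0 : down_closed (D1 m0).
Proof. move=> m m'; apply: lepm_trans; exact: lem_addr. Qed.

Ltac sets := by move=> m; rewrite /strip /twist /Dempty /Dsu /Dp /Di /Dj /Dip /Djp /D1 ?mono_le ?mono_ge ?mono_eq
  ?(wt_x0, wt_x1, wt_y0, wt_y3) ?mnmDE ?mono_le ?mono_ge ?mono_eq ?monoE /=; lia.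

Lemma row_empty b r d : row (convex_strip (b := b) down_empty) r 0 d.
Proof.
move=> i j; rewrite mul0n if_same; apply: hdim_deg0 => u su; apply/mpolyP => m.
by rewrite mcoeff0; apply/eqP/negPn/negP => /su[]; rewrite /strip andbF.
Qed.

(** The monomials are t^q v^j with q = 3 j - c. They form a free k[y3]-module on one generator: 1
    for c = 0, and t^(3 - c) v for c = 1, 2, 3. Modulo y3 only the generator is left. The type of c
    allows a case split by [ord4P]. *)
Lemma row_ip (c : 'I_4) :
  row (convex_strip (b := c) (@down_ip 0)) (c != 0%N :> nat)%:Z 1 5.
Proof.
have Dc : down_closed (D1 (mono 0 ((3 - c) %% 3) 0 (c != 0%N :> nat))) by exact: down_1.
apply: (linear_row_regular y3 (convex_strip (b := c) Dc)).
- sets.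
- by move: c {Dc}; apply: ord4P; sets.
have -> : ((c != 0%N :> nat)%:Z = fibre_deg (mono 0 ((3 - c) %% 3) 0 (c != 0%N :> nat))).
  by rewrite /fibre_deg !monoE.
apply: linear_row_single; move: c {Dc}; apply: ord4P; sets.
Qed.

(* In the next proof vt, vu and vv stand for the numbers c = 1, 2 and 3. *)
Lemma row_V : row (convex_strip (b := 1) down_i) 1 3 4.
Proof.
apply: (linear_row_regular y0 (convex_strip (b := 1) (@down_ip 2))); try sets.
apply: (linear_row_extension (mono 1 0 0 0) 2 1
  (cA := convex_strip (b := 2) (@down_ip 1)) (cC := convex_strip (b := 1) (@down_ip 0)));
  try sets; last exact: (row_ip vt).
apply: (linear_row_extension (mono 1 0 0 0) 1 1
  (cA := convex_strip (b := 3) (@down_ip 0)) (cC := convex_strip (b := 2) (@down_ip 0)));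
  try sets; [exact: (row_ip vv)|exact: (row_ip vu)].
Qed.

Lemma row_p : row (convex_strip (b := 0) down_p) 0 1 4.
Proof.
apply: (linear_row_regular x1 (convex_strip (b := 0) (@down_ip 0))); try sets.
exact: (row_ip vs).
Qed.

(** Multiplication by t identifies k[x1, y3] with this module; the isomorphism is presented as an
    extension by the zero module. *)
Lemma row_p1 : row (convex_strip (b := -1) down_p) 0 1 4.
Proof.
apply: (linear_row_extension (mono 0 1 0 0) 1 0
  (cA := convex_strip (b := 0) down_p) (cC := convex_strip (b := -1) down_empty)); try sets.
  exact: row_p.
exact: row_empty.
Qed.

(** Modulo x0 = s u, the monomials divisible by u form u k[x1, y3], and the others form the module
    of [row_V]. There, reduction modulo y0 leaves the exponents 0, 1, 2 of s, each contributing one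
    free k[y3]-module. The four generators are u and s^2 v, s t v, t^2 v. *)
Lemma row_twist1 : row (convex_twist (b := 1)) 1 4 3.
Proof.
apply: (linear_row_regular x0 (convex_strip (b := 1) down_su)); try sets.
apply: (linear_row_extension (mono 0 0 1 0) 1 3
  (cA := convex_strip (b := 0) down_p) (cC := convex_strip (b := 1) down_i)); try sets.
  exact: row_p.
exact: row_V.
Qed.

(** The module is u^b k[x0, x1], and x0, x1 are killed in turn until only the monomial 1 is left.
    This is the source of the rows (1, 4, 6, 4, 1). *)
Lemma row_j (b : nat) : row (convex_strip (b := b) down_j) b 1 4.
Proof.
apply: (linear_row_extension (mono 0 0 b 0) 1 0
  (cA := convex_strip (b := 0) down_j) (cC := convex_strip (b := b) down_empty)); try sets.
  rewrite /fibre_deg !monoE addn0 subrr.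
  apply: (linear_row_regular x0 (convex_strip (b := 0) down_jp)); try sets.
  have D0 : down_closed (D1 (mono 0 0 0 0)) by exact: down_1.
  apply: (linear_row_regular x1 (convex_strip (b := 0) D0)); try sets.
  have h : row (convex_strip (b := 0) D0) (fibre_deg (mono 0 0 0 0)) 1 6.
    by apply: linear_row_single; sets.
  exact: h.
exact: row_empty.
Qed.

End ScrollModules.

Definition y1 : 'I_(2 + 4) := rshift 2 (@Ordinal 4 1 isT).
Definition y2 : 'I_(2 + 4) := rshift 2 (@Ordinal 4 2 isT).

Lemma wt_y1 : wt y1 = mono 2 1 0 1.
Proof. by rewrite /wt /y1 (unsplitK (inr _)). Qed.
Lemma wt_y2 : wt y2 = mono 1 2 0 1.
Proof. by rewrite /wt /y2 (unsplitK (inr _)). Qed.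
Definition wtE := (wt_x0, wt_x1, wt_y0, wt_y1, wt_y2, wt_y3).

Lemma ord6P (P : 'I_(2 + 4) -> Prop) :
  P x0 -> P x1 -> P y0 -> P y1 -> P y2 -> P y3 -> forall x, P x.
Proof.
move=> h0 h1 g0 g1 g2 g3 x; rewrite -(splitK x); case: (split x) => [[[|[|i]] lt_i]|] //=.
- by rewrite (_ : Ordinal _ = @Ordinal 2 0 isT) //; apply: val_inj.
- by rewrite (_ : Ordinal _ = @Ordinal 2 1 isT) //; apply: val_inj.
by apply: ord4P.
Qed.

Lemma sum6E (V : nmodType) (F : 'I_(2 + 4) -> V) :
  \sum_x F x = F x0 + (F x1 + (F y0 + (F y1 + (F y2 + F y3)))).
Proof.
rewrite (bigD1 x0) //= (bigD1 x1) //= (bigD1 y0) //= (bigD1 y1) //= (bigD1 y2) //=.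
rewrite (bigD1 y3) //= big1 ?addr0 // => x; rewrite -!andbA.
by move: x; apply: ord6P; rewrite ?eqxx ?andbF.
Qed.

Lemma monoB p q i j p' q' i' j' :
  (mono p q i j - mono p' q' i' j')%MM = mono (p - p') (q - q') (i - i') (j - j').
Proof. by apply/mnmP; apply: ord4P; rewrite mnmBE !monoE. Qed.

Lemma wt_inj : injective wt.
Proof.
suff h x y : wt x = wt y -> [&& wt x vs == wt y vs, wt x vt == wt y vt,
    wt x vu == wt y vu & wt x vv == wt y vv].
  move=> x y /h; move: x y; apply: ord6P; apply: ord6P; by rewrite ?wtE ?monoE.
by move=> ->; rewrite !eqxx.
Qed.

(** * The linear strands of E_0 and E_(-1) *)

Section LinearStrands.
Variable k : fieldType.
Local Notation module c := (monomial_module k fibre_degD fibre_deg_wt c).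
Local Notation E b := (module (convex_twist (b := b))).

Lemma mcoeff_bd b (v : {ffun {set 'I_(2 + 4)} -> E b}) B m : twist b m ->
  (bd v B)@_m = \sum_(x | x \notin B)
     ksign k x B * (if (wt x <= m)%MM then (v (x |: B))@_(m - wt x) else 0).
Proof.
move=> bm; rewrite ffunE raddf_sum /=; apply: eq_bigr => x _.
by rewrite mcoeffZ mcoeff_restr bm mcoeff_mulX.
Qed.

Lemma ksign_neq0 n (x : 'I_n) B : ksign k x B != 0.
Proof. by rewrite /ksign signr_eq0. Qed.

(** Coefficients of degree zero are constants. As the coordinates have distinct weights, the
    coefficient of the weight of x in [bd v] at X without x is the constant v X up to sign. *)
Lemma strand_twist0 (i : nat) : hdim (E 0) i.+1 0 0.
Proof.
apply: quotient_dim0 => v [Kv v0].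
suff -> : v = 0 by exact: subspace0 (bnd_subspace _ _ _).
have vm X m : m != 0%MM -> (v X)@_m = 0.
  move=> m0; apply/eqP/negPn/negP; case: (Kv X) => sv _ /sv[].
  move/eqP: m0; rewrite /twist /fibre_deg => m0 tm dm; apply: m0.
  by apply/mnmP; apply: ord4P; rewrite mnm0E; lia.
apply/ffunP => X; rewrite ffunE; apply/mpolyP => m; rewrite mcoeff0.
have [->{m}|] := eqVneq m 0%MM; last exact: vm.
have [/eqP cX|cX] := boolP (#|X|%:Z == i.+1); last first.
  by case: (Kv X) => _ ->; rewrite ?mcoeff0.
have /card_gt0P[x xX] : (0 < #|X|)%N by lia.
have tx : twist 0 (wt x) by rewrite /twist wt_degree; lia.
have := mcoeff_bd v (X :\ x) tx; rewrite v0 ffunE mcoeff0.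
rewrite (bigD1 x) ?inE ?eqxx //= big1 => [|y /andP[yB yx]]; last first.
  case: ifP => yx'; rewrite ?mulr0 // vm ?mulr0 //; apply: contra yx => /eqP yx0.
  by apply/eqP/wt_inj; rewrite -(submK yx') yx0 add0m.
rewrite lepm_refl addr0 setD1K // => /esym/eqP; rewrite mulf_eq0 (negPf (ksign_neq0 _ _)) /=.
have -> : (wt x - wt x)%MM = 0%MM by apply/mnmP => z; rewrite mnmBE mnm0E subnn.
by move/eqP.
Qed.

(* The equations say that the columns of A s + B t are linear syzygies of the
   coordinates over k[s, t]; such a matrix is zero if it is alternating. *)
Lemma alternating_syzygies (A B : 'I_(2 + 4) -> 'I_(2 + 4) -> k) :
  (forall x, A x x = 0) -> (forall x, B x x = 0) ->
  (forall x y, A x y = - A y x) -> (forall x y, B x y = - B y x) ->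
  (forall y, [/\ A x0 y = 0, B x0 y + A x1 y = 0 & B x1 y = 0]) ->
  (forall y, [/\ A y0 y = 0, B y0 y + A y1 y = 0, B y1 y + A y2 y = 0,
                 B y2 y + A y3 y = 0 & B y3 y = 0]) ->
  forall x y, A x y = 0 /\ B x y = 0.
Proof.
move=> Axx Bxx Aa Ba hx hy.
have Ax0 y : A x0 y = 0 by case: (hx y).
have Bx1 y : B x1 y = 0 by case: (hx y).
have Ay0 y : A y0 y = 0 by case: (hy y).
have By3 y : B y3 y = 0 by case: (hy y).
have Ax1 y : A x1 y = - B x0 y by case: (hx y) => _ /eqP; rewrite addrC addr_eq0 => /eqP.
have Ay1 y : A y1 y = - B y0 y by case: (hy y) => _ /eqP; rewrite addrC addr_eq0 => /eqP.
have Ay2 y : A y2 y = - B y1 y by case: (hy y) => _ _ /eqP; rewrite addrC addr_eq0 => /eqP.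
have Ay3 y : A y3 y = - B y2 y by case: (hy y) => _ _ _ /eqP; rewrite addrC addr_eq0 => /eqP.
have Bx1' x : B x x1 = 0 by rewrite Ba Bx1 oppr0.
have By3' x : B x y3 = 0 by rewrite Ba By3 oppr0.
have Bx0 y : B x0 y = 0.
  rewrite -[LHS]opprK -Ax1; move: y; apply: ord6P; rewrite Aa ?Ax0 ?Ay0 ?Ay1 ?Ay2 ?Ay3 ?Bx1' ?oppr0 //.
  by rewrite opprK Axx.
have Bx0' x : B x x0 = 0 by rewrite Ba Bx0 oppr0.
have By01 : B y0 y1 = 0 by rewrite -[LHS]opprK -Ay1 Axx oppr0.
have By12 : B y1 y2 = 0 by rewrite -[LHS]opprK -Ay2 Axx oppr0.
have By02 : B y0 y2 = 0 by rewrite -[LHS]opprK -Ay1 Aa Ay2 Bxx !oppr0.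
have B0 x y : B x y = 0.
  move: x y; apply: ord6P => //; apply: ord6P => //.
  - by rewrite Ba By01 oppr0.
  - by rewrite Ba By02 oppr0.
  - by rewrite Ba By12 oppr0.
move=> x y; split=> //; move: x y.
by apply: ord6P => y; rewrite ?Ax1 ?Ay1 ?Ay2 ?Ay3 ?B0 ?oppr0.
Qed.

(** The degree zero part of E_(-1) is spanned by s and t. Fix all but two elements of the index set;
    as the two vary, the signed coefficients of a cycle form an alternating matrix A s + B t, and
    the cycle condition says that its columns are syzygies of the coordinates. *)
Lemma strand_twist_m1 (i : nat) : hdim (E (-1)) i.+2 0 0.
Proof.
apply: quotient_dim0 => v [Kv v0].
suff -> : v = 0 by exact: subspace0 (bnd_subspace _ _ _).
pose s := mono 1 0 0 0; pose t := mono 0 1 0 0.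
have vm X m : m != s -> m != t -> (v X)@_m = 0.
  move=> ms mt; apply/eqP/negPn/negP; case: (Kv X) => sv _ /sv[].
  by move: ms mt; rewrite /s /t !mono_eq /twist /fibre_deg; lia.
suff vst X : (v X)@_s = 0 /\ (v X)@_t = 0.
  apply/ffunP => X; rewrite ffunE; apply/mpolyP => m; rewrite mcoeff0.
  have [->|ms] := eqVneq m s; first by case: (vst X).
  have [->|mt] := eqVneq m t; first by case: (vst X).
  exact: vm.
have [/eqP cX|cX] := boolP (#|X|%:Z == i.+2); last first.
  by case: (Kv X) => _ ->; rewrite ?mcoeff0.
have /card_gt1P[x [y [xX yX xy]]] : (1 < #|X|)%N by lia.
pose C := X :\ y :\ x.
have yC : y \notin C by rewrite !inE eqxx andbF.
have xC : x \notin C by rewrite !inE eqxx.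
pose c m x y := if [&& x \notin C, y \notin C & x != y] then
  ksign k y C * ksign k x (y |: C) * (v (x |: (y |: C)))@_m else 0.
have cxx m z : c m z z = 0 by rewrite /c eqxx !andbF.
have c_anti m z z' : c m z z' = - c m z' z.
  rewrite /c eq_sym andbCA; case: ifP => [/and3P[zC zC' zz]|]; last by rewrite oppr0.
  by rewrite ksign_anti // 1?eq_sym // setUCA mulNr.
have ceq m z : twist (-1) m ->
    \sum_z' (if (wt z' <= m)%MM then c (m - wt z')%MM z' z else 0) = 0.
  move=> tm; have [zC|zC] := boolP (z \in C).
    by rewrite big1 // => z' _; rewrite /c zC andbF if_same.
  have := mcoeff_bd v (z |: C) tm; rewrite v0 ffunE mcoeff0 => /esym/(congr1 ( *%R (ksign k z C))).
  rewrite mulr0 mulr_sumr big_mkcond /= => e; rewrite -[RHS]e; apply: eq_bigr => z' _.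
  rewrite /c in_setU1 zC negb_or.
  case: (z' \in C) => /=; rewrite ?andbF ?andbT ?if_same //.
  by case: (z' != z) => /=; case: ifP => _; rewrite ?mulr0 ?mulrA.
suff cE z z' : c s z z' = 0 /\ c t z z' = 0.
  have XE : x |: (y |: C) = X by rewrite setUCA setD1K ?setD1K // !inE xy.
  have := cE x y; rewrite /c xC yC xy XE /=.
  by case=> /eqP + /eqP; rewrite !mulf_eq0 !(negPf (ksign_neq0 _ _)) => /eqP ? /eqP.
have eqn p q i' j : twist (-1) (mono p q i' j) -> forall z,
    \sum_z' (if (wt z' <= mono p q i' j)%MM then c (mono p q i' j - wt z')%MM z' z else 0) = 0.
  by move=> tm z0; exact: ceq.
(* The matrices are [c s] and [c t]. The equations come from the coefficients of s^2 u, s t u, t^2 u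
   for x0, x1, and of s^4 v, ..., t^4 v for y0, ..., y3. *)
move: z z'; apply: alternating_syzygies => // [z1|z1].
  split.
  - have := eqn 2%N 0%N 1%N 0%N isT z1.
    by rewrite sum6E !wtE !mono_le !monoE !monoB /= !addr0.
  - have := eqn 1%N 1%N 1%N 0%N isT z1.
    by rewrite sum6E !wtE !mono_le !monoE !monoB /= !addr0.
  - have := eqn 0%N 2%N 1%N 0%N isT z1.
    by rewrite sum6E !wtE !mono_le !monoE !monoB /= !addr0 add0r.
split.
- have := eqn 4%N 0%N 0%N 1%N isT z1.
  by rewrite sum6E !wtE !mono_le !monoE !monoB /= !addr0 ?add0r.
- have := eqn 3%N 1%N 0%N 1%N isT z1.
  by rewrite sum6E !wtE !mono_le !monoE !monoB /= !addr0 ?add0r.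
- have := eqn 2%N 2%N 0%N 1%N isT z1.
  by rewrite sum6E !wtE !mono_le !monoE !monoB /= !addr0 ?add0r.
- have := eqn 1%N 3%N 0%N 1%N isT z1.
  by rewrite sum6E !wtE !mono_le !monoE !monoB /= ?addr0 ?add0r.
- have := eqn 0%N 4%N 0%N 1%N isT z1.
  by rewrite sum6E !wtE !mono_le !monoE !monoB /= ?addr0 ?add0r.
Qed.

End LinearStrands.

(** * Betti tables of the twists *)

Section TwistTables.
Variable k : fieldType.
Local Notation module c := (monomial_module k fibre_degD fibre_deg_wt c).
Local Notation E b := (module (convex_twist (b := b))).

Lemma table_row_default l s i j : (size s <= i)%N -> table_row l s i j = 0%N.
Proof. by move=> si; rewrite /table_row nth_default // if_same. Qed.

Lemma table_row_neq l s i (j : int) : j != l%:Z -> table_row l s i j = 0%N.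
Proof. by rewrite /table_row => /negPf ->. Qed.

Lemma table_row_shift l s i (j : int) (c : nat) :
  table_row l s i (j - c%:Z) = table_row (l + c) s i j.
Proof. by rewrite /table_row subr_eq PoszD. Qed.

Lemma linear_row_table B (cB : convex wt B) (r : nat) a d s :
  linear_row k fibre_degD fibre_deg_wt cB r a d ->
  (forall i, (a * 'C(d, i))%N = nth 0%N s i) ->
  forall (i : nat) j, hdim (module cB) i j (table_row r s i j).
Proof. by move=> l as_ i j; rewrite /table_row -as_; exact: l. Qed.

Definition row_Q : seq nat := [:: 1; 4; 6; 4; 1]%N.

Lemma row_Q_bin i : (1 * 'C(4, i))%N = nth 0%N row_Q i.
Proof. by case: i => [|[|[|[|[|i]]]]] //; rewrite bin_small // nth_default. Qed.

(* the Betti table of the module of sections of the dH - (c - 1)F *)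
Definition base_table (c : nat) (i : nat) (j : int) : nat :=
  match c with
  | 0 => table_row 0 [:: 2; 4; 0; 0; 0] i j + table_row 1 [:: 0; 0; 4; 2; 0] i j
  | 1%N => table_row 0 [:: 1; 0; 0; 0; 0] i j + table_row 1 [:: 0; 6; 8; 3; 0] i j
  | _ => table_row 1 [:: 4; 12; 12; 4; 0] i j
  end%N.

Lemma hdim_twist1 (i : nat) j : hdim (E 1) i j (base_table 2 i j).
Proof.
apply: linear_row_table (@row_twist1 k) _ i j.
by case=> [|[|[|[|[|i]]]]] //; rewrite bin_small // nth_default.
Qed.

Lemma colon_s b : split_exact
  (A := gshift 0 (E (b + 1))) (B := E b) (C := module (convex_strip (b := b) down_p))
  (mulX (mono 1 0 0 0)) (restr (strip b Dp)) idfun (divX (mono 1 0 0 0)).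
Proof.
apply: (colon_split_exact (mono 1 0 0 0)) => m.
  by rewrite /twist !mnmDE !monoE; lia.
by rewrite /strip /Dp mono_le; lia.
Qed.

(** In row 0 only the generator 1 survives, by [strand_twist0]. The same vanishing embeds row 0 of
    k[x1, y3] into row 1 of E_1 with i lowered by one, and row 1 of E_0 is the cokernel. *)
Lemma hdim_twist0 (i : nat) j : hdim (E 0) i j (base_table 1 i j).
Proof.
have sx := colon_s 0.
have hA i' j' : hdim (gshift 0 (E 1)) i'%:Z j' (base_table 2 i' j').
  by apply: hdim_gshift; rewrite subr0; exact: hdim_twist1.
have hC (i' : nat) j' := linear_row_table (row_p k) row_Q_bin i' j'.
have hAi := hA i j; have hCi := hC i j.
have [j0|j0] := eqVneq j 0.
  subst j; case: i hAi hCi => [|i] hAi hCi; last first.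
    have -> : base_table 1 i.+1 0 = 0%N by case: i {hAi hCi} => [|[|[|[|i]]]] //; rewrite /= !table_row_default.
    exact: strand_twist0.
  apply: (hdim_additive sx hAi hCi); first by left; exact: (hC 1%N).
  by right; exact: hdim_neg.
have [j1|j1] := eqVneq j 1.
  subst j; have hC1 := hC i.+1 0; have := strand_twist0 k i.
  rewrite -[i.+1]addn1 PoszD in hC1 *; move=> hB.
  have [c hc cE] := hdim_quotient sx hAi hC1 hB (or_intror hCi).
  suff -> : base_table 1 i 1 = c by [].
  move: cE; rewrite addn1.
  by case: (i) => [|[|[|[|[|i0]]]]] /=; rewrite /table_row /= ?nth_nil; lia.
have e0 : base_table 1 i j = 0%N by rewrite /= !table_row_neq.
rewrite e0.
have {}hAi : hdim (gshift 0 (E 1)) i j 0 by move: hAi; rewrite /= table_row_neq.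
have {}hCi : hdim (module (convex_strip (b := 0) down_p)) i j 0.
  by move: hCi; rewrite table_row_neq.
by apply: (hdim_additive sx hAi hCi); [right|left].
Qed.


Lemma hdim_p1 (i : nat) j :
  hdim (module (convex_strip (b := -1) down_p)) i j (table_row 0 row_Q i j).
Proof. exact: linear_row_table (row_p1 k) row_Q_bin i j. Qed.

(** The linear strand now has length one: in columns 0 and 1 of row 0 the tables still add up, to 2
    and 4, because row 1 of E_0 is empty in column 0. From column 1 on, row 1 is a cokernel as for
    E_0. *)
Lemma hdim_twist_m1 (i : nat) j : hdim (E (-1)) i j (base_table 0 i j).
Proof.
have sx := colon_s (-1).
have hA i' j' : hdim (gshift 0 (E 0)) i'%:Z j' (base_table 1 i' j').
  by apply: hdim_gshift; rewrite subr0; exact: hdim_twist0.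
have hAi := hA i j; have hCi := hdim_p1 i j.
have [j0|j0] := eqVneq j 0.
  subst j; case: i hAi hCi => [|[|i]] hAi hCi; last first.
  - have -> : base_table 0 i.+2 0 = 0%N.
      by case: i {hAi hCi} => [|[|[|i]]] //; rewrite /= !table_row_default.
    exact: strand_twist_m1.
  - apply: (hdim_additive sx hAi hCi); first by left; exact: (hdim_p1 2%N).
    by right; exact: (hA 0%N 1).
  apply: (hdim_additive sx hAi hCi); first by left; exact: (hdim_p1 1%N).
  by right; exact: hdim_neg.
have [j1|j1] := eqVneq j 1.
  subst j; case: i hAi hCi => [|i] hAi hCi.
    by apply: (hdim_additive sx hAi hCi); [right|left].
  have hC1 := hdim_p1 i.+2 0; have := strand_twist_m1 k i.
  rewrite -[i.+2]addn1 PoszD in hC1 *; move=> hB.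
  have hC0 : hdim (module (convex_strip (b := -1) down_p)) i.+1 1 0.
    by move: hCi; rewrite table_row_neq.
  have [c hc cE] := hdim_quotient sx hAi hC1 hB (or_intror hC0).
  suff -> : base_table 0 i.+1 1 = c by [].
  move: cE; rewrite addn1.
  by case: (i) => [|[|[|[|i0]]]] /=; rewrite /table_row /= ?nth_nil; lia.
have e0 : base_table 0 i j = 0%N by rewrite /= !table_row_neq.
rewrite e0.
have {}hAi : hdim (gshift 0 (E 0)) i j 0 by move: hAi; rewrite /= !table_row_neq.
have {}hCi : hdim (module (convex_strip (b := -1) down_p)) i j 0.
  by move: hCi; rewrite table_row_neq.
by apply: (hdim_additive sx hAi hCi); [right|left].
Qed.

Lemma hdim_base (c : nat) (i : nat) j : (c <= 2)%N ->
  hdim (E (c%:Z - 1)) i j (base_table c i j).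
Proof.
by case: c => [|[|[|c]]] // _;
  [exact: hdim_twist_m1|exact: hdim_twist0|exact: hdim_twist1].
Qed.

Lemma colon_v b : split_exact
  (A := gshift 1 (E (b - 3))) (B := E b) (C := module (convex_strip (b := b) down_j))
  (mulX (mono 0 0 0 1)) (restr (strip b Dj)) idfun (divX (mono 0 0 0 1)).
Proof.
apply: (colon_split_exact (mono 0 0 0 1)) => m.
  by rewrite /twist !mnmDE !monoE; lia.
by rewrite /strip /Dj mono_le; lia.
Qed.

(** The quotient u^b k[x0, x1] occupies row b only. Its connecting maps therefore end in row b + 1
    of E_(b-3)(-1), which is row b of E_(b-3) and empty by assumption. *)
Lemma hdim_twist_step (b : nat) (T : nat -> int -> nat) :
  (forall (i : nat) j, hdim (E (b%:Z - 3)) i j (T i j)) -> (forall i, T i b = 0%N) ->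
  forall (i : nat) j, hdim (E b) i j (T i (j - 1)%R + table_row b row_Q i j)%N.
Proof.
move=> hT Tb i j; have sx := colon_v b.
have hA i' j' : hdim (gshift 1 (E (b%:Z - 3))) i'%:Z j' (T i' (j' - 1)).
  exact: hdim_gshift.
have hC i' j' := linear_row_table (row_j k b) row_Q_bin i' j'.
apply: (hdim_additive sx (hA i j) (hC i j)).
  have [jb|jb] := eqVneq (j - 1) b; first by right; have := hA i j; rewrite jb Tb.
  by left; have := hC i.+1 (j - 1); rewrite table_row_neq // -[i.+1]addn1 PoszD.
have [jb|jb] := eqVneq j b; last by left; have := hC i j; rewrite table_row_neq.
right; case: (i) => [|i']; first exact: hdim_neg.
by have := hA i' (j + 1); rewrite addrK jb Tb -[i'.+1]addn1 PoszD addrK.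
Qed.

(* the Betti table of the module of sections of the dH - (c + 3m - 1)F *)
Definition twist_table (c m : nat) (i : nat) (j : int) : nat :=
  (base_table c i (j - m%:Z)%R
   + \sum_(0 <= l < m) table_row (c + m + 1 + 2 * l) row_Q i j)%N.

Lemma base_table_high c i j : j != 0 -> j != 1 -> base_table c i j = 0%N.
Proof. by move=> j0 j1; case: c => [|[|c]]; rewrite /= !table_row_neq. Qed.

Lemma hdim_twist (c m : nat) (i : nat) j : (c <= 2)%N ->
  hdim (E ((c + 3 * m)%:Z - 1)) i j (twist_table c m i j).
Proof.
move=> c2; elim: m i j => [|m IH] i j.
  by rewrite /twist_table muln0 addn0 big_geq // addn0 subr0; exact: hdim_base.
have -> : (c + 3 * m.+1)%:Z - 1 = (c + 3 * m + 2)%N by lia.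
have -> : twist_table c m.+1 i j
    = (twist_table c m i (j - 1)%R + table_row (c + 3 * m + 2) row_Q i j)%N.
  rewrite /twist_table big_nat_recr //= addnA; congr (_ + _ + _)%N.
  - by congr base_table; lia.
  - apply: eq_bigr => l _; rewrite -[1]/(1%:Z) table_row_shift; congr table_row; lia.
  - by congr table_row; lia.
apply: hdim_twist_step => [i' j'|i'].
  by rewrite (_ : _ - 3 = (c + 3 * m)%:Z - 1); [exact: IH|lia].
(* The new row c + 3 m + 2 lies beyond every row of the previous table. *)
rewrite /twist_table base_table_high; try lia.
rewrite add0n big_nat_cond big1 // => l /andP[lm _]; apply: table_row_neq.
by apply/eqP; lia.
Qed.

End TwistTables.

(** * Homogeneous polynomials for a weight *)

Section WeightHomogeneous.
Variables (k : fieldType) (N : nat) (wgt : 'X_{1..N} -> int).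
Hypothesis wgtD : forall m m', wgt (m + m')%MM = wgt m + wgt m'.
Local Notation R := {mpoly k[N]}.
Implicit Types (z : int) (p q : R).

Definition whomog z p : Prop := forall m, p@_m != 0 -> wgt m = z.

Lemma whomog0 z : whomog z 0.
Proof. by move=> m; rewrite mcoeff0 eqxx. Qed.

Lemma whomogX m : whomog (wgt m) 'X_[m].
Proof. by move=> m'; rewrite mcoeffX; case: (eqVneq m m') => [->|]; rewrite ?eqxx. Qed.

Lemma mcoeffM_neq0 p q m : (p * q)@_m != 0 ->
  exists m1 m2, [/\ m = (m1 + m2)%MM, p@_m1 != 0 & q@_m2 != 0].
Proof.
rewrite -mcoeff_msupp => /msuppM_le /allpairsP[[m1 m2] /= [pm1 qm2 ->]].
by exists m1, m2; rewrite -!mcoeff_msupp.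
Qed.

Lemma whomogM z1 z2 p q : whomog z1 p -> whomog z2 q -> whomog (z1 + z2) (p * q).
Proof. by move=> hp hq m /mcoeffM_neq0[m1 [m2 [-> /hp <- /hq <-]]]. Qed.

Lemma whomogX_exp z p d : whomog z p -> whomog (z *+ d) (p ^+ d).
Proof.
move=> hp; elim: d => [|d IH]; last by rewrite exprS mulrS; exact: whomogM.
have := @whomogX 0%MM; rewrite mpolyX0; suff -> : wgt 0%MM = 0 by [].
by apply: (@addIr _ (wgt 0%MM)); rewrite -wgtD addm0 add0r.
Qed.

Lemma whomogZ z a p : whomog z p -> whomog z (a *: p).
Proof.
by move=> hp m; rewrite mcoeffZ mulf_eq0 negb_or => /andP[_]; exact: hp.
Qed.

Lemma whomogD z p q : whomog z p -> whomog z q -> whomog z (p + q).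
Proof.
move=> hp hq m; rewrite mcoeffD; have [pm|/hp //] := eqVneq p@_m 0.
by rewrite pm add0r => /hq.
Qed.

Lemma whomogB z p q : whomog z p -> whomog z q -> whomog z (p - q).
Proof. by move=> hp hq; apply: whomogD => //; rewrite -scaleN1r; exact: whomogZ. Qed.

Definition wpart z p : R := restr (fun m => wgt m == z) p.

Lemma wpart_whomog z p : whomog z (wpart z p).
Proof. by move=> m; rewrite mcoeff_restr; case: ifP => [/eqP //|]; rewrite eqxx. Qed.

Lemma wpart_id z p : whomog z p -> wpart z p = p.
Proof. by move=> hp; apply: restr_id => m /hp ->. Qed.

Lemma wpart_eq0 z p : (forall m, p@_m != 0 -> wgt m != z) -> wpart z p = 0.
Proof.
move=> hp; apply/mpolyP => m; rewrite mcoeff_restr mcoeff0; case: ifP => // /eqP wm.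
by apply/eqP/negPn/negP => /hp; rewrite wm eqxx.
Qed.

Lemma wpartM z z' p q : whomog z' q -> wpart z (p * q) = wpart (z - z') p * q.
Proof.
move=> hq; rewrite -{1}(subrK (wpart (z - z') p) p) mulrDl /wpart linearD -!/(wpart _ _).
rewrite [X in _ + X]wpart_id; last first.
  by have := whomogM (@wpart_whomog (z - z') p) hq; rewrite subrK.
rewrite [X in X + _]wpart_eq0 ?add0r // => m /mcoeffM_neq0[m1 [m2 [-> pm1 qm2]]].
move: pm1; rewrite mcoeffB mcoeff_restr; case: ifP => [_|/eqP wm1 _]; first by rewrite subrr eqxx.
by apply/eqP => e; case: wm1; rewrite -e wgtD (hq m2 qm2) addrK.
Qed.

(** Taking the part of weight z of p q amounts to taking the part of weight z - z' of p; cancelling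
    q shows that p equals that part. *)
Lemma whomog_cancel z z' p q : q != 0 -> whomog z' q -> whomog z (p * q) ->
  whomog (z - z') p.
Proof.
move=> q0 hq /wpart_id; rewrite (wpartM _ _ hq) => /(mulIf q0) <-.
exact: wpart_whomog.
Qed.

End WeightHomogeneous.
Arguments whomogX_exp {k N wgt} wgtD {z p} d _ _ _.

(** * Independence of Tor from the resolution *)

Section HomogeneousDegree.
Variables (k : fieldType) (n : nat).
Local Notation R := {mpoly k[n]}.
Implicit Types (z : int) (p q : R).

Lemma hodE z p : homogeneous_of_degree z p <-> forall m, p@_m != 0 -> (mdeg m)%:Z = z.
Proof. by split=> h m; have := h m; rewrite mcoeff_msupp. Qed.

Lemma hod_subspace z : subspace (homogeneous_of_degree z : R -> Prop).
Proof.
split=> [|a u v /hodE hu /hodE hv]; first by move=> m; rewrite msupp0.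
apply/hodE => m; rewrite mcoeffD mcoeffZ.
by have [um|/hu //] := eqVneq u@_m 0; rewrite um mulr0 add0r => /hv.
Qed.

Let mdegZ (m : 'X_{1..n}) : int := (mdeg m)%:Z.

Let mdegZD m m' : mdegZ (m + m')%MM = mdegZ m + mdegZ m'.
Proof. by rewrite /mdegZ mdegD PoszD. Qed.

Lemma hodM z1 z2 p q : homogeneous_of_degree z1 p -> homogeneous_of_degree z2 q ->
  homogeneous_of_degree (z1 + z2) (p * q).
Proof. by move=> /hodE hp /hodE hq; apply/hodE; exact: (whomogM mdegZD hp hq). Qed.

Definition hpart z : {linear R -> R} := restr (fun m => mdegZ m == z).

Lemma hpart_hod z p : homogeneous_of_degree z (hpart z p).
Proof. by apply/hodE; exact: (@wpart_whomog _ _ mdegZ). Qed.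

Lemma hpart_id z p : homogeneous_of_degree z p -> hpart z p = p.
Proof. by move=> /hodE; exact: (@wpart_id _ _ mdegZ). Qed.

Lemma hpartM z z' p q : homogeneous_of_degree z' q ->
  hpart z (p * q) = hpart (z - z') p * q.
Proof. by move=> /hodE; exact: (wpartM mdegZD). Qed.

End HomogeneousDegree.

Section FreeMaps.
Variables (k : fieldType) (n : nat).
Local Notation R := {mpoly k[n]}.

Definition mat (E F : finType) := E -> F -> R.

Definition mcomp (E F G : finType) (a : mat E F) (b : mat F G) : mat E G :=
  fun e g => \sum_f a e f * b f g.

Definition msub (E F : finType) (a b : mat E F) : mat E F := fun e f => a e f - b e f.

Definition mid (E : finType) : mat E E := fun e f => (e == f)%:R.

Definition mzero (E F : finType) : mat E F := fun _ _ => 0.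

Lemma matP (E F : finType) (a b : mat E F) : a =2 b -> a = b.
Proof.
by move=> ab; do 2![apply: functional_extensionality => ?]; exact: ab.
Qed.

Lemma mcompA (E F G H : finType) (a : mat E F) (b : mat F G) (c : mat G H) :
  mcomp a (mcomp b c) = mcomp (mcomp a b) c.
Proof.
apply: matP => e h; rewrite /mcomp.
under eq_bigr => f _ do rewrite big_distrr /=.
rewrite exchange_big /=; apply: eq_bigr => g _; rewrite big_distrl /=.
by apply: eq_bigr => f _; rewrite mulrA.
Qed.

Lemma mcompBl (E F G : finType) (a b : mat E F) (c : mat F G) :
  mcomp (msub a b) c = msub (mcomp a c) (mcomp b c).
Proof.
apply: matP => e g; rewrite /mcomp /msub -sumrB.
by apply: eq_bigr => f _; rewrite mulrBl.
Qed.

Lemma mcompBr (E F G : finType) (a : mat E F) (b c : mat F G) :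
  mcomp a (msub b c) = msub (mcomp a b) (mcomp a c).
Proof.
apply: matP => e g; rewrite /mcomp /msub -sumrB.
by apply: eq_bigr => f _; rewrite mulrBr.
Qed.

Lemma mcomp1 (E F : finType) (a : mat E F) : mcomp a (@mid F) = a.
Proof.
apply: matP => e f; rewrite /mcomp (bigD1 f) //= /mid eqxx mulr1 big1 ?addr0 //.
by move=> f' /negPf ->; rewrite mulr0.
Qed.

Lemma mcomp1l (E F : finType) (a : mat E F) : mcomp (@mid E) a = a.
Proof.
apply: matP => e f; rewrite /mcomp (bigD1 e) //= /mid eqxx mul1r big1 ?addr0 //.
by move=> f' f'e; rewrite eq_sym (negPf f'e) mul0r.
Qed.

Lemma mcomp0 (E F G : finType) (a : mat E F) : mcomp a (@mzero F G) = @mzero E G.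
Proof. by apply: matP => e g; rewrite /mcomp big1 // => f _; rewrite mulr0. Qed.

Lemma mcomp0l (E F G : finType) (a : mat F G) : mcomp (@mzero E F) a = @mzero E G.
Proof. by apply: matP => e g; rewrite /mcomp big1 // => f _; rewrite mul0r. Qed.

Lemma msubb (E F : finType) (a : mat E F) : msub a a = @mzero E F.
Proof. by apply: matP => e f; rewrite /msub subrr. Qed.

Lemma msub0 (E F : finType) (a : mat E F) : msub a (@mzero E F) = a.
Proof. by apply: matP => e f; rewrite /msub subr0. Qed.

Lemma free_map_comp (E F G : finType) (a : mat E F) (b : mat F G) v :
  free_map (mcomp a b) v = free_map b (free_map a v).
Proof.
apply/ffunP => g; rewrite !ffunE.
under [RHS]eq_bigr => f _ do rewrite ffunE big_distrl /=.
rewrite exchange_big /=; apply: eq_bigr => e _; rewrite big_distrr /=.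
by apply: eq_bigr => f _; rewrite mulrA.
Qed.

Lemma free_map_sub (E F : finType) (a b : mat E F) v :
  free_map (msub a b) v = free_map a v - free_map b v.
Proof.
apply/ffunP => f; rewrite !ffunE -sumrB.
by apply: eq_bigr => e _; rewrite mulrBr.
Qed.

Lemma free_map_id (E : finType) v : free_map (@mid E) v = v.
Proof.
apply/ffunP => f; rewrite ffunE (bigD1 f) //= /mid eqxx mulr1 big1 ?addr0 //.
by move=> e /negPf ->; rewrite mulr0.
Qed.

Lemma free_map_is_linear (E F : finType) (a : mat E F) :
  linear (free_map a : {ffun E -> R} -> {ffun F -> R}).
Proof.
move=> c u v; apply/ffunP => f; rewrite !ffunE scaler_sumr -big_split.
by apply: eq_bigr => e _; rewrite !ffunE mulrDl scalerAl.
Qed.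

HB.instance Definition _ (E F : finType) (a : mat E F) :=
  GRing.isLinear.Build k {ffun E -> R} {ffun F -> R} _ (free_map a) (free_map_is_linear a).

Definition mhomog (E F : finType) (dE : E -> int) (dF : F -> int) (a : mat E F) : Prop :=
  forall e f, homogeneous_of_degree (dE e - dF f) (a e f).

Lemma mhomog_comp (E F G : finType) dE dF dG (a : mat E F) (b : mat F G) :
  mhomog dE dF a -> mhomog dF dG b -> mhomog dE dG (mcomp a b).
Proof.
move=> ha hb e g; apply: (subspace_sum (hod_subspace _ _ _)) => f.
by have := hodM (ha e f) (hb f g); rewrite addrA subrK.
Qed.

Lemma mhomog_sub (E F : finType) dE dF (a b : mat E F) :
  mhomog dE dF a -> mhomog dE dF b -> mhomog dE dF (msub a b).
Proof. by move=> ha hb e f; apply: (subspaceB (hod_subspace _ _ _)). Qed.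

Lemma mhomog_id (E : finType) dE : mhomog dE dE (@mid E).
Proof.
move=> e f; apply/hodE => m; rewrite /mid; case: (eqVneq e f) => [->|_]; last by rewrite mcoeff0 eqxx.
rewrite mcoeff1 subrr; case: (eqVneq m 0%MM) => [->|_]; last by rewrite eqxx.
by rewrite mdeg0.
Qed.

(** Lift each row arbitrarily, then keep the part of the required degree of each entry: since d is
    homogeneous, the result is still a lift. *)
Lemma mat_lift (A E F : finType) (dA : A -> int) (dE : E -> int) (dF : F -> int)
    (d : mat E F) (V : mat A F) :
  mhomog dE dF d -> mhomog dA dF V ->
  (forall a, exists w, [ffun f => V a f] = free_map d w) ->
  exists2 W : mat A E, mhomog dA dE W & V = mcomp W d.
Proof.
move=> hd hV imV.
have /fin_all_exists [w wP] : forall a, exists w : {ffun E -> R},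
    (forall e, homogeneous_of_degree (dA a - dE e) (w e)) /\
    forall f, V a f = \sum_e w e * d e f.
  move=> a; have [w /ffunP wE] := imV a.
  exists [ffun e => hpart _ _ (dA a - dE e) (w e)]; split=> [e|f].
    by rewrite ffunE; exact: hpart_hod.
  have := wE f; rewrite !ffunE => VE.
  rewrite -[LHS](hpart_id (hV a f)) VE linear_sum /=.
  apply: eq_bigr => e _; rewrite ffunE (hpartM _ _ (hd e f)); congr (hpart _ _ _ _ * _).
  by rewrite opprB addrA subrK.
exists (fun a e => w a e); first by move=> a e; case: (wP a).
by apply: matP => a f; case: (wP a).
Qed.

End FreeMaps.

(** Chain maps and homotopies are infinite families in which each term is merely known to exist once
    the previous one is given. *)
Lemma dependent_choice (T : nat -> Type) (good : forall i, T i -> Prop)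
    (step : forall i, T i -> T i.+1 -> Prop) :
  (exists x, good 0%N x) ->
  (forall i x, good i x -> exists y, good i.+1 y /\ step i x y) ->
  exists F : forall i, T i, (forall i, good i (F i)) /\ forall i, step i (F i) (F i.+1).
Proof.
move=> ex0 exS.
pose next i (x : {x : T i | good i x}) :=
  constructive_indefinite_description _ (exS i (sval x) (svalP x)).
pose fix F i : {x : T i | good i x} := match i with
  | 0 => constructive_indefinite_description _ ex0
  | i'.+1 => exist _ (sval (next i' (F i'))) (proj1 (svalP (next i' (F i'))))
  end.
exists (fun i => sval (F i)); split=> i; first exact: svalP.
exact: proj2 (svalP (next i (F i))).
Qed.

(** * The comparison theorem for graded free resolutions of k *)

Section Comparison.
Variables (k : fieldType) (n : nat).
Local Notation R := {mpoly k[n]}.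
Local Notation d P i := (@res_diff k n P i : mat k n (res_basis P i.+1) (res_basis P i)).
Local Notation deg P i := (@res_deg k n P i).
Implicit Types P Q : residue_resolution k n.

Lemma res_diff_diff P i : mcomp (d P i.+1) (d P i) = @mzero k n _ _.
Proof.
apply: matP => e f.
have : free_map (d P i) [ffun x => d P i.+1 e x] = 0.
  apply/res_exact; exists [ffun x => (x == e)%:R]; apply/ffunP => x; rewrite !ffunE.
  by rewrite (bigD1 e) //= ffunE eqxx mul1r big1 ?addr0 // => y /negPf ye; rewrite ffunE ye mul0r.
rewrite /mcomp /mzero => /ffunP/(_ f); rewrite !ffunE => h0; rewrite -[RHS]h0.
by apply: eq_bigr => x _; rewrite ffunE.
Qed.

Definition augment P (E : finType) (a : mat k n E (res_basis P 0)) : E -> k :=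
  fun e => \sum_f (a e f)@_0%MM * res_aug f.

Lemma augment_comp P (E F : finType) (a : mat k n E F) (b : mat k n F (res_basis P 0)) e :
  augment (mcomp a b) e = \sum_f (a e f)@_0%MM * augment b f.
Proof.
rewrite /augment /mcomp.
under eq_bigr => x _ do rewrite raddf_sum /= big_distrl /=.
rewrite exchange_big /=; apply: eq_bigr => f _; rewrite big_distrr /=.
by apply: eq_bigr => x _; rewrite rmorphM /= mulrA.
Qed.

Lemma augment_diff P (E : finType) (a : mat k n E _) e : augment (mcomp a (d P 0)) e = 0.
Proof.
rewrite augment_comp big1 // => f _; rewrite (_ : augment _ f = 0) ?mulr0 //.
have /res_exact0 : exists w, [ffun x => d P 0 f x] = free_map (d P 0) w.
  exists [ffun x => (x == f)%:R]; apply/ffunP => x; rewrite !ffunE.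
  by rewrite (bigD1 f) //= ffunE eqxx mul1r big1 ?addr0 // => y /negPf ye; rewrite ffunE ye mul0r.
by move=> h0; rewrite -[RHS]h0; apply: eq_bigr => x _; rewrite ffunE.
Qed.

Lemma image_row0 P (E : finType) (V : mat k n E (res_basis P 0)) e :
  augment V e = 0 -> exists w, [ffun x => V e x] = free_map (d P 0) w.
Proof.
by move=> V0; apply/res_exact0; rewrite -[RHS]V0; apply: eq_bigr => x _; rewrite ffunE.
Qed.

Lemma image_rowS P (E : finType) i (V : mat k n E (res_basis P i.+1)) e :
  mcomp V (d P i) = @mzero k n _ _ -> exists w, [ffun x => V e x] = free_map (d P i.+1) w.
Proof.
move=> V0; apply/res_exact; apply/ffunP => f; rewrite !ffunE.
have h0 : mcomp V (d P i) e f = 0 by rewrite V0.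
rewrite -[RHS]h0.
by apply: eq_bigr => x _; rewrite ffunE.
Qed.

(** The predicate [good] carries what the next lift needs: compatibility with the augmentations in
    degree 0, and in higher degrees that the composite with the differentials on both sides is
    zero. *)
Lemma chain_map_exists P Q :
  exists f : forall i, mat k n (res_basis P i) (res_basis Q i),
    [/\ forall i, mhomog (deg P i) (deg Q i) (f i),
        forall e, augment (f 0%N) e = res_aug e
      & forall i, mcomp (d P i) (f i) = mcomp (f i.+1) (d Q i)].
Proof.
pose T i := mat k n (res_basis P i) (res_basis Q i).
pose good i (f : T i) := mhomog (deg P i) (deg Q i) f /\
  match i return T i -> Prop with
  | 0 => fun f => forall e, augment f e = res_aug e
  | i'.+1 => fun f => mcomp (mcomp (d P i'.+1) f) (d Q i') = @mzero k n _ _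
  end f.
pose step i (f : T i) (g : T i.+1) := mcomp (d P i) f = mcomp g (d Q i).
have [||f [gf sf]] := @dependent_choice T good step.
- have [e0 ae0] := res_aug_surj Q.
  (* Everything is sent to multiples of one basis element e0 with nonzero augmentation. Nonzero
     augmentations occur in degree 0 only, so constant entries are homogeneous of the right
     degree. *)
  exists (fun e x => if x == e0 then (res_aug e / res_aug e0)%:MP else 0); split=> [e x|e].
    case: ifP => [/eqP ->|_]; last exact: subspace0 (hod_subspace _ _ _).
    rewrite (res_aug_homog ae0) subr0; have [ae|ae] := eqVneq (res_aug e) 0.
      by rewrite ae mul0r mpolyC0; exact: subspace0 (hod_subspace _ _ _).
    rewrite (res_aug_homog ae); apply/hodE => m; rewrite mcoeffC.
    by case: (eqVneq m 0%MM) => [->|_]; rewrite ?mulr0 ?eqxx // mdeg0.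
  rewrite /augment (bigD1 e0) //= eqxx mcoeffC eqxx mulr1 mulfVK // big1 ?addr0 //.
  by move=> x /negPf ->; rewrite mcoeff0 mul0r.
- move=> i f [hf cf].
  have hdf : mhomog (deg P i.+1) (deg Q i) (mcomp (d P i) f).
    by apply: mhomog_comp hf; exact: res_diff_homog.
  have [|g hg eg] := mat_lift (@res_diff_homog _ _ Q i) hdf.
    case: i f hf cf {hdf} => [|i] f hf cf e; last exact: image_rowS.
    apply: image_row0; rewrite augment_comp.
    under eq_bigr => x _ do rewrite cf.
    have := augment_diff (@mid k n _) e; rewrite mcomp1l => h0.
    by rewrite -[RHS]h0; apply: eq_bigr.
  exists g; split=> //; split=> //=.
  rewrite -mcompA -eg mcompA res_diff_diff mcomp0l //.
exists f; split=> [i|e|i]; [by case: (gf i)|by case: (gf 0%N)|exact: sf].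
Qed.

Lemma null_homotopy P (phi : forall i, mat k n (res_basis P i) (res_basis P i)) :
  (forall i, mhomog (deg P i) (deg P i) (phi i)) ->
  (forall e, augment (phi 0%N) e = 0) ->
  (forall i, mcomp (d P i) (phi i) = mcomp (phi i.+1) (d P i)) ->
  exists h : forall i, mat k n (res_basis P i) (res_basis P i.+1),
    [/\ forall i, mhomog (deg P i) (deg P i.+1) (h i),
        phi 0%N = mcomp (h 0%N) (d P 0)
      & forall i, msub (phi i.+1) (mcomp (d P i) (h i)) = mcomp (h i.+1) (d P i.+1)].
Proof.
move=> hphi aphi cphi.
pose T i := mat k n (res_basis P i) (res_basis P i.+1).
pose good i (h : T i) := [/\ mhomog (deg P i) (deg P i.+1) h,
  mcomp (d P i) (msub (phi i) (mcomp h (d P i))) = @mzero k n _ _ &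
  match i return T i -> Prop with
  | 0 => fun h => phi 0%N = mcomp h (d P 0)
  | _ => fun _ => True
  end h].
pose step i (h : T i) (h' : T i.+1) := msub (phi i.+1) (mcomp (d P i) h) = mcomp h' (d P i.+1).
have [||h [gh sh]] := @dependent_choice T good step.
- have [|h hh eh] := mat_lift (@res_diff_homog _ _ P 0) (hphi 0%N).
    by move=> e; apply: image_row0; exact: aphi.
  by exists h; split=> //; rewrite eh msubb mcomp0.
- move=> i h [hh ch _].
  have hV : mhomog (deg P i.+1) (deg P i.+1) (msub (phi i.+1) (mcomp (d P i) h)).
    by apply: mhomog_sub => //; apply: mhomog_comp hh; exact: res_diff_homog.
  have [|g hg eg] := mat_lift (@res_diff_homog _ _ P i.+1) hV.
    move=> e; apply: image_rowS.
    by rewrite mcompBl -cphi -[mcomp (mcomp _ h) _]mcompA -mcompBr.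
  exists g; split=> //; split=> //.
  rewrite -eg mcompBr cphi mcompBr (mcompA (d P i.+1)) res_diff_diff mcomp0l msub0.
  by rewrite -cphi msubb.
exists h; split=> [i||i]; [by case: (gh i)|by case: (gh 0%N)|exact: sh].
Qed.

Section Tor.
Variable I : R -> Prop.
Hypothesis idI : is_ideal I.

Lemma ideal_subspace : subspace I.
Proof.
case: idI => I0 ID IM; split=> // a u v Iu Iv; apply: ID => //.
by rewrite -mul_mpolyC; exact: IM.
Qed.

Lemma tensor_part_map P Q i j (a : mat k n (res_basis P i) (res_basis Q j)) z v :
  mhomog (deg P i) (deg Q j) a -> tensor_part I z v -> tensor_part I z (free_map a v).
Proof.
move=> ha tv f; rewrite ffunE; split.
  apply: (subspace_sum ideal_subspace) => e; rewrite mulrC.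
  by case: idI => _ _; apply; case: (tv e).
apply: (subspace_sum (hod_subspace _ _ _)) => e.
by have := hodM (proj2 (tv e)) (ha e f); rewrite addrA subrK.
Qed.

Lemma tensor_part_subspace P i z : subspace (@tensor_part k n P I i z).
Proof.
split=> [e|c u v tu tv e]; rewrite !ffunE.
  by split; [exact: subspace0 ideal_subspace|exact: subspace0 (hod_subspace _ _ _)].
have [Iu hu] := tu e; have [Iv hv] := tv e; split.
  exact: (proj2 ideal_subspace).
exact: (proj2 (hod_subspace _ _ _)).
Qed.

Lemma tor_cycle_subspace P i z : subspace (@tor_cycle k n P I i z).
Proof.
split=> [|c u v [tu cu] [tv cv]].
  by split; [exact: subspace0 (tensor_part_subspace _ _ _)|case: i => //= i; exact: linear0].
split; first exact: (proj2 (tensor_part_subspace _ _ _)).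
case: i u v tu cu tv cv => //= i u v _ cu _ cv.
by rewrite linearP /= cu cv scaler0 addr0.
Qed.

Lemma tor_boundary_subspace P i z : subspace (@tor_boundary k n P I i z).
Proof.
split; first by exists 0; [exact: subspace0 (tensor_part_subspace _ _ _)|rewrite linear0].
move=> c _ _ [u tu ->] [v tv ->]; exists (c *: u + v); last by rewrite linearP.
exact: (proj2 (tensor_part_subspace _ _ _)).
Qed.

(** The composite of the two comparison maps minus the identity is a chain endomorphism of P with
    zero augmentation, so it is null-homotopic by a homogeneous homotopy, which also acts on I
    tensor P. *)
Lemma tor_boundary_homotopic P Q (f : forall i, mat k n (res_basis P i) (res_basis Q i))
    (g : forall i, mat k n (res_basis Q i) (res_basis P i)) i z v :
  (forall i, mhomog (deg P i) (deg Q i) (f i)) ->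
  (forall e, augment (f 0%N) e = res_aug e) ->
  (forall i, mcomp (d P i) (f i) = mcomp (f i.+1) (d Q i)) ->
  (forall i, mhomog (deg Q i) (deg P i) (g i)) ->
  (forall e, augment (g 0%N) e = res_aug e) ->
  (forall i, mcomp (d Q i) (g i) = mcomp (g i.+1) (d P i)) ->
  @tor_cycle k n P I i z v ->
  @tor_boundary k n P I i z (v - free_map (g i) (free_map (f i) v)).
Proof.
move=> hf af cf hg ag cg [tv cv].
pose phi i : mat k n (res_basis P i) (res_basis P i) := msub (mcomp (f i) (g i)) (@mid k n _).
have [|||h [hh h0 hS]] := @null_homotopy P phi.
- by move=> i'; apply: mhomog_sub; [exact: mhomog_comp (hf i') (hg i')|exact: mhomog_id].
- move=> e; rewrite /augment /phi /msub.
  under eq_bigr => x _ do rewrite mcoeffB mulrBl.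
  rewrite sumrB; apply/eqP; rewrite subr_eq0; apply/eqP.
  transitivity (res_aug e).
    rewrite -/(augment _ e) augment_comp -af.
    by apply: eq_bigr => x _; rewrite ag.
  rewrite (bigD1 e) //= /mid eqxx mcoeff1 eqxx mul1r big1 ?addr0 // => x xe.
  by rewrite eq_sym (negPf xe) mcoeff0 mul0r.
- move=> i'; rewrite /phi mcompBr mcompBl mcomp1 mcomp1l mcompA cf -mcompA cg.
  by rewrite mcompA.
have -> : v - free_map (g i) (free_map (f i) v) = - free_map (phi i) v.
  by rewrite /phi free_map_sub free_map_comp free_map_id opprB.
apply: (subspaceN (tor_boundary_subspace _ _ _)).
exists (free_map (h i) v); first exact: tensor_part_map (hh i) tv.
case: i v tv cv => [|i] v tv cv; first by rewrite h0 free_map_comp.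
rewrite -free_map_comp -hS free_map_sub free_map_comp.
by rewrite (cv : free_map (d P i) v = 0) linear0 subr0.
Qed.

Lemma tor_comparison P Q i z m :
  quotient_dim (@tor_cycle k n P I i z) (@tor_boundary k n P I i z) m ->
  quotient_dim (@tor_cycle k n Q I i z) (@tor_boundary k n Q I i z) m.
Proof.
have [f [hf af cf]] := chain_map_exists P Q.
have [g [hg ag cg]] := chain_map_exists Q P.
have cycf P' Q' (f' : forall i, mat k n (res_basis P' i) (res_basis Q' i)) v :
    (forall i, mhomog (deg P' i) (deg Q' i) (f' i)) ->
    (forall i, mcomp (d P' i) (f' i) = mcomp (f' i.+1) (d Q' i)) ->
    @tor_cycle k n P' I i z v -> @tor_cycle k n Q' I i z (free_map (f' i) v).
  move=> hf' cf' [tv cv]; split; first exact: tensor_part_map (hf' i) tv.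
  case: i v tv cv => //= i' v _ cv.
  by rewrite -free_map_comp -cf' free_map_comp (cv : free_map (d P' i') v = 0) linear0.
have bndf P' Q' (f' : forall i, mat k n (res_basis P' i) (res_basis Q' i)) v :
    (forall i, mhomog (deg P' i) (deg Q' i) (f' i)) ->
    (forall i, mcomp (d P' i) (f' i) = mcomp (f' i.+1) (d Q' i)) ->
    @tor_boundary k n P' I i z v -> @tor_boundary k n Q' I i z (free_map (f' i) v).
  move=> hf' cf' [w tw ->]; exists (free_map (f' i.+1) w).
    exact: tensor_part_map (hf' i.+1) tw.
  by rewrite -!free_map_comp cf'.
apply: (quotient_dim_iso (F := free_map (f i))).
- exact: tor_cycle_subspace.
- exact: tor_cycle_subspace.
- exact: tor_boundary_subspace.
- by move=> v; exact: cycf.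
- by move=> v; exact: bndf.
- move=> v cv bv; apply: (subspace_cong (tor_boundary_subspace _ _ _)).
    exact: tor_boundary_homotopic hf af cf hg ag cg cv.
  exact: bndf bv.
- move=> v cv; exists (free_map (g i) v); first exact: cycf cv.
  exact: tor_boundary_homotopic hg ag cg hf af cf cv.
Qed.

End Tor.
End Comparison.

(** * The Cox ring of the scroll *)

Section PolynomialFunctions.
Variable k : closedFieldType.

Lemma prod4E (F : 'I_4 -> k) : \prod_i F i = F vs * (F vt * (F vu * F vv)).
Proof.
rewrite (bigD1 vs) //= (bigD1 vt) //= (bigD1 vu) //= (bigD1 vv) //= big1 ?mulr1 //.
by move=> i; rewrite -!andbA; move: i; apply: ord4P; rewrite ?eqxx ?andbF.
Qed.

(** If q vanishes everywhere, q + 1 has no root and so is constant; hence q is constant too, and it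
    vanishes at 0. *)
Lemma poly_fun_eq0 (q : {poly k}) : (forall z, q.[z] = 0) -> q = 0.
Proof.
move=> q0; have : size (q + 1) == 1.
  apply/negPn/negP => /closed_rootP[z]; rewrite rootE hornerD hornerC q0 add0r.
  by rewrite oner_eq0.
move=> /size_poly1P[c _ qE]; have := q0 0; have -> : q = (c - 1)%:P.
  by rewrite polyCB -qE addrK.
by rewrite hornerC => ->.
Qed.

Lemma radix_inj N a x b y : (a < N)%N -> (b < N)%N ->
  (a + N * x = b + N * y)%N -> a = b /\ x = y.
Proof.
move=> aN bN e; have := congr1 (modn^~ N) e.
rewrite /= ![(N * _)%N]mulnC ![(_ + _ * N)%N]addnC !modnMDl !modn_small // => ab; split=> //.
by move: e; rewrite ab => /addnI/eqP; rewrite eqn_pmul2l ?(leq_trans _ aN) // => /eqP.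
Qed.

(* Kronecker substitution reduces to one variable. *)
Lemma mpoly_fun_eq0 (p : {mpoly k[4]}) : (forall v, p.@[v] = 0) -> p = 0.
Proof.
move=> p0; pose N := msize p.
pose kr (m : 'X_{1..4}) := (m vs + N * (m vt + N * (m vu + N * m vv)))%N.
pose q : {poly k} := \sum_(m <- msupp p) p@_m *: 'X^(kr m).
have q0 : q = 0.
  apply: poly_fun_eq0 => z.
  pose v (i : 'I_4) := z ^+ (N ^ i).
  rewrite -(p0 v) /q horner_sum mevalE; apply: eq_bigr => m _.
  rewrite hornerZ hornerXn prod4E /v /kr /= -!exprM -!exprD; congr (_ * _ ^+ _).
  by rewrite !expnS expn0; lia.
have lt_N m i : m \in msupp p -> (m i < N)%N.
  move=> /msize_mdeg_lt; apply: leq_ltn_trans; rewrite mdegE (bigD1 i) //=.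
  exact: leq_addr.
apply/mpolyP => m; rewrite mcoeff0; apply/eqP/negPn/negP; rewrite -mcoeff_msupp => pm.
have := congr1 (fun q : {poly k} => q`_(kr m)) q0; rewrite coef0 coef_sum.
rewrite (bigD1_seq m) ?msupp_uniq //= coefZ coefXn eqxx mulr1 big_seq_cond big1 ?addr0.
  by move/eqP; apply/negP; rewrite -mcoeff_msupp.
move=> m' /andP[pm' mm']; rewrite coefZ coefXn; case: eqP => [e|]; last by rewrite mulr0.
have [e1 {}e] := radix_inj (lt_N _ _ pm) (lt_N _ _ pm') e.
have [e2 {}e] := radix_inj (lt_N _ _ pm) (lt_N _ _ pm') e.
have [e3 e4] := radix_inj (lt_N _ _ pm) (lt_N _ _ pm') e.
by case/eqP: mm'; apply/mnmP; apply: ord4P.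
Qed.

End PolynomialFunctions.

Section ToricMap.
Variable k : fieldType.
Local Notation R := {mpoly k[2 + 4]}.
Local Notation C := {mpoly k[4]}.

Definition phi (p : R) : C := p \mPo [tuple 'X_[wt x] | x < 2 + 4].

Lemma phi_is_linear : linear phi.
Proof. by move=> a p q; rewrite /phi linearP. Qed.

HB.instance Definition _ := GRing.isLinear.Build k R C _ phi phi_is_linear.

Definition Wt (m : 'X_{1..2 + 4}) : 'X_{1..4} := (\sum_x wt x *+ m x)%MM.

Lemma phiM p q : phi (p * q) = phi p * phi q.
Proof. exact: rmorphM. Qed.

Lemma phiXn p d : phi (p ^+ d) = phi p ^+ d.
Proof. exact: rmorphXn. Qed.

Lemma phiX m : phi 'X_[m] = 'X_[Wt m].
Proof.
rewrite /phi comp_mpolyX /Wt -mprodXnE.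
by apply: eq_bigr => x _; rewrite tnth_mktuple mpolyXn.
Qed.

Lemma WtU x : Wt U_(x) = wt x.
Proof.
apply/mnmP => i; rewrite mnm_sumE (bigD1 x) //= mulmnE mnm1E eqxx muln1 big1 ?addn0 //.
by move=> y yx; rewrite mulmnE mnm1E eq_sym (negPf yx) muln0.
Qed.

Lemma WtD m m' : Wt (m + m')%MM = (Wt m + Wt m')%MM.
Proof.
apply/mnmP => i; rewrite mnmDE !mnm_sumE -big_split; apply: eq_bigr => x _.
by rewrite !mulmnE mnmDE mulnDr.
Qed.

Lemma Wt_ind (P : 'X_{1..2 + 4} -> Prop) :
  P 0%MM -> (forall x m, P m -> P (m + U_(x))%MM) -> forall m, P m.
Proof.
move=> P0 PS m; move: {2}(mdeg m) (erefl (mdeg m)) => d; elim: d m => [|d IH] m.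
  by move/eqP; rewrite mdeg_eq0 => /eqP ->.
move=> dm; have [x mx] : exists x, m x != 0%N.
  apply/existsP; rewrite -[[exists _, _]]negbK negb_exists; apply/negP => /forallP h.
  move: dm; rewrite mdegE big1 // => x _; apply/eqP; have := h x; by rewrite negbK.
have xm : (U_(x) <= m)%MM by rewrite lep1mP.
rewrite -(submK xm); apply/PS/IH; move: dm; rewrite -{1}(submK xm) mdegD mdeg1; lia.
Qed.

Lemma Wt0 : Wt 0%MM = 0%MM.
Proof. by apply/mnmP => i; rewrite mnm_sumE big1 ?mnm0E // => x _; rewrite mulmnE mnm0E muln0. Qed.

Lemma twist_Wt m : twist 0 (Wt m).
Proof.
elim/Wt_ind: m => [|x m IH]; first by rewrite Wt0 /twist !mnm0E.
by rewrite WtD WtU twist_wt.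
Qed.

Lemma fibre_deg_Wt m : fibre_deg (Wt m) = mdeg m.
Proof.
elim/Wt_ind: m => [|x m IH]; first by rewrite Wt0 mdeg0 /fibre_deg !mnm0E.
by rewrite WtD WtU fibre_degD fibre_deg_wt IH mdegD mdeg1.
Qed.

Lemma phiE p : phi p = \sum_(m <- msupp p) p@_m *: 'X_[Wt m].
Proof.
rewrite {1}(mpolyE p) linear_sum; apply: eq_bigr => m _.
by rewrite linearZ /= phiX.
Qed.

Lemma mcoeff_phi_neq0 p m : (phi p)@_m != 0 -> exists2 m', p@_m' != 0 & m = Wt m'.
Proof.
rewrite phiE raddf_sum /= => h; have /hasP[m' pm' /eqP mm'] : has (fun m' => m == Wt m') (msupp p).
  apply: contraNT h => /hasPn h; rewrite big_seq big1 // => m' /h mm'.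
  by rewrite mcoeffZ mcoeffX eq_sym (negPf mm') mulr0.
by exists m'; rewrite -?mcoeff_msupp.
Qed.

(** In the Cox ring s and t have class F, u has class H - F, and v has class H - 3F. Thus [fib]
    reads the coefficient of H in the class and [tau] that of F. *)
Definition tau (m : 'X_{1..4}) : int := (m vs + m vt)%:Z - (m vu + 3 * m vv)%:Z.
Definition fib (m : 'X_{1..4}) : int := (fibre_deg m)%:Z.

Lemma tauD m m' : tau (m + m')%MM = tau m + tau m'.
Proof. by rewrite /tau !mnmDE; lia. Qed.

Lemma fibD m m' : fib (m + m')%MM = fib m + fib m'.
Proof. by rewrite /fib fibre_degD PoszD. Qed.

Lemma twist_tau b m : twist b m = (tau m == - b).
Proof. by rewrite /twist /tau; lia. Qed.

Lemma tau_phi p : whomog tau 0 (phi p).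
Proof. by move=> m /mcoeff_phi_neq0[m' _ ->]; apply/eqP; have := twist_Wt m'; rewrite twist_tau. Qed.

Lemma fib_phi d p : p \is d.-homog for mdeg -> whomog fib d (phi p).
Proof.
move=> /dhomogP hp m /mcoeff_phi_neq0[m']; rewrite -mcoeff_msupp => /hp dm ->.
by rewrite /fib fibre_deg_Wt dm.
Qed.

(** The greedy choice of a coordinate dividing a monomial of class d H. If u occurs, so does s or t.
    Otherwise the exponents of s and t add up to three times that of v, and y_l is taken with l the
    smaller of 3 and the exponent of t. *)
Definition first_coord (m : 'X_{1..4}) : 'I_(2 + 4) :=
  if (0 < m vu)%N then (if (0 < m vs)%N then x0 else x1)
  else if (2 < m vt)%N then y3 else if m vt == 2%N then y2
  else if m vt == 1%N then y1 else y0.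

Fixpoint lift_mono (d : nat) (m : 'X_{1..4}) : 'X_{1..2 + 4} :=
  if d is d'.+1 then (lift_mono d' (m - wt (first_coord m)) + U_(first_coord m))%MM
  else 0%MM.

Lemma first_coord_le m : twist 0 m -> (0 < fibre_deg m)%N -> (wt (first_coord m) <= m)%MM.
Proof.
rewrite /twist /fibre_deg /first_coord => tm dm.
by do ![case: ifP => ?]; rewrite wtE mono_le; lia.
Qed.

Lemma Wt_lift_mono m : twist 0 m -> Wt (lift_mono (fibre_deg m) m) = m.
Proof.
move: {1 3}(fibre_deg m) (erefl (fibre_deg m)) => d; elim: d m => [|d IH] m /= dm tm.
  rewrite Wt0; apply/mnmP; apply: ord4P; move: dm tm;
    by rewrite mnm0E /twist /fibre_deg; lia.
have le_m := first_coord_le tm; rewrite -dm in le_m; have {}le_m := le_m isT.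
rewrite WtD WtU IH ?submK //.
  by move: dm; rewrite -{1}(submK le_m) fibre_degD fibre_deg_wt; lia.
by rewrite -(twist_wt _ _ (first_coord m)) submK.
Qed.

Lemma mdeg_lift_mono d m : mdeg (lift_mono d m) = d.
Proof. by elim: d m => [|d IH] m /=; rewrite ?mdeg0 // mdegD mdeg1 IH addn1. Qed.

(** A section of [phi] over the forms of classes d H. It is linear and keeps degrees, hence serves
    as the splitting that [split_exact] requires. *)
Definition sec (c : C) : R :=
  \sum_(m <- msupp c) c@_m *: (if twist 0 m then 'X_[lift_mono (fibre_deg m) m] else 0).

Lemma sec_is_linear : linear sec.
Proof.
pose g m : R := if twist 0 m then 'X_[lift_mono (fibre_deg m) m] else 0.
have secE c (s : seq 'X_{1..4}) : uniq s -> {subset msupp c <= s} ->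
    sec c = \sum_(m <- s) c@_m *: g m.
  move=> us cs; rewrite [RHS](bigID (fun m => m \in msupp c)) /= [X in _ + X]big1 ?addr0.
    rewrite -big_filter; apply: perm_big; apply: uniq_perm; rewrite ?msupp_uniq ?filter_uniq //.
    by move=> m; rewrite mem_filter; case: (boolP (m \in msupp c)) => //= /cs ->.
  by move=> m cm; rewrite memN_msupp_eq0 // scale0r.
move=> a p q; pose s := undup (msupp p ++ msupp q).
have sP m : (m \in s) = (m \in msupp p) || (m \in msupp q) by rewrite mem_undup mem_cat.
rewrite !(secE _ s) ?undup_uniq //.
- rewrite scaler_sumr -big_split; apply: eq_bigr => m _.
  by rewrite mcoeffD mcoeffZ scalerDl scalerA.
- by move=> m qm; rewrite sP qm orbT.
- by move=> m pm; rewrite sP pm.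
move=> m; rewrite sP mcoeff_msupp mcoeffD mcoeffZ; apply: contraR.
rewrite negb_or => /andP[pm qm]; rewrite (memN_msupp_eq0 pm) (memN_msupp_eq0 qm).
by rewrite mulr0 addr0.
Qed.

HB.instance Definition _ := GRing.isLinear.Build k C R _ sec sec_is_linear.

Lemma phi_sec c : whomog tau 0 c -> phi (sec c) = c.
Proof.
move=> hc; rewrite [RHS](mpolyE c) linear_sum big_seq [RHS]big_seq.
apply: eq_bigr => m; rewrite mcoeff_msupp => /hc tm; rewrite linearZ /=.
by rewrite twist_tau tm phiX Wt_lift_mono // twist_tau tm.
Qed.

Lemma sec_deg c (r : int) : whomog fib r c -> homogeneous_of_degree r (sec c).
Proof.
move=> hc; rewrite /sec big_seq.
elim/big_ind: _ => [|p q hp hq|m].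
- exact: subspace0 (hod_subspace _ _ _).
- exact: (subspaceD (hod_subspace _ _ _)).
rewrite mcoeff_msupp => /hc dm; apply: (subspaceZ (hod_subspace _ _ _)).
case: ifP => _; last exact: subspace0 (hod_subspace _ _ _).
apply/hodE => m'; rewrite mcoeffX; case: (eqVneq _ m') => [<- _|]; rewrite ?eqxx //.
by rewrite mdeg_lift_mono -dm.
Qed.

End ToricMap.

(** * The equation of a divisor *)

Section Divisors.
Variable k : closedFieldType.
Local Notation R := {mpoly k[2 + 4]}.
Local Notation C := {mpoly k[4]}.
Local Notation scroll := (@scroll_ideal k 1 3).
Implicit Types (F G c : C) (p q : R) (D : R -> Prop).

Definition point (s t u v : k) (i : 'I_4) : k := nth 0 [:: s; t; u; v] i.

Lemma meval_scroll s t u v p : p.@[@scroll_point k 1 3 s t u v] = (phi p).@[point s t u v].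
Proof.
rewrite /phi comp_mpoly_meval; apply: meval_eq => x; rewrite tnth_mktuple mevalX.
rewrite prod4E /point /scroll_point /wt /=.
by case: (split x) => y; rewrite !monoE !expr0 !expr1 ?mulr1 ?mul1r !mulrA ?mulr1.
Qed.

Lemma meval_point F (v : 'I_4 -> k) : F.@[v] = F.@[point (v vs) (v vt) (v vu) (v vv)].
Proof. by apply: meval_eq; apply: ord4P. Qed.

Lemma scrollE p : scroll p <-> phi p = 0.
Proof.
split=> [h|h s t _ u v]; last by rewrite meval_scroll h meval0.
(* The hypothesis gives no information at points with s = t = 0; the factor s makes the product
   vanish there as well. *)
have : phi p * ('X_vs : C) = 0.
  apply: mpoly_fun_eq0 => v; rewrite meval_point mevalM mevalXU.
  have [v0|v0] := eqVneq (v vs) 0; first by rewrite v0 mulr0.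
  rewrite -meval_scroll h ?mul0r //.
  by rewrite xpair_eqE negb_and v0.
move/eqP; rewrite mulf_eq0 => /orP[/eqP //|].
by rewrite -msupp_eq0 msuppX.
Qed.

Definition multiples F p : Prop := exists c, phi p = F * c.

Lemma mpolyX_neq0 n (m : 'X_{1..n}) : 'X_[m] != 0 :> {mpoly k[n]}.
Proof. by rewrite -msupp_eq0 msuppX. Qed.

Lemma multiples_ideal F : is_ideal (multiples F).
Proof.
split=> [|p q [c pc] [d qd]|p q [c qc]].
- by exists 0; rewrite linear0 mulr0.
- by exists (c + d); rewrite linearD /= pc qd mulrDr.
- by exists (phi p * c); rewrite phiM qc mulrCA.
Qed.

Lemma scroll_multiples F p : scroll p -> multiples F p.
Proof. by move/scrollE => p0; exists 0; rewrite p0 mulr0. Qed.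

(** This avoids unique factorisation: the two equations give w' d = w d', and comparing coefficients
    shows that w, being coprime to w', divides d. *)
Lemma coprime_monomials (w w' : 'X_{1..4}) F c d d' :
  (forall i, (w i == 0%N) || (w' i == 0%N)) -> F != 0 ->
  'X_[w] * c = F * d -> 'X_[w'] * c = F * d' -> exists e, c = F * e.
Proof.
move=> ww F0 e1 e2.
have e3 : 'X_[w'] * d = 'X_[w] * d'.
  by apply: (mulfI F0); rewrite mulrCA -e1 [RHS]mulrCA -e2 mulrCA.
have dE : d = 'X_[w] * divX w d.
  apply/mpolyP => m; rewrite mulrC -/(mulX _ _) mcoeff_mulX mcoeff_divX.
  case: ifP => wm; first by rewrite submK.
  have := congr1 (mcoeff (m + w')) e3.
  rewrite [_ * d]mulrC [_ * d']mulrC -!/(mulX _ _) mcoeff_mulXD mcoeff_mulX ifF //.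
  apply: contraFF wm => /mnm_lepP h; apply/mnm_lepP => i.
  by have := h i; rewrite mnmDE; case/orP: (ww i) => /eqP ->; rewrite ?addn0.
exists (divX w d); apply: (mulfI (mpolyX_neq0 w)).
by rewrite e1 {1}dE mulrCA.
Qed.

Lemma multiples_saturated F p : F != 0 -> saturation (multiples F) p -> multiples F p.
Proof.
move=> F0 [N hN].
have h x : exists d, 'X_[wt x *+ N] * phi p = F * d.
  have [|d dE] := hN (U_(x) *+ N)%MM; first by rewrite mdegMn mdeg1 mul1n.
  by exists d; rewrite -dE phiM -!mpolyXn phiXn phiX WtU.
(* The weights s u of x0 and t^3 v of y3 are coprime, so powers of these two coordinates suffice. *)
have [d1 e1] := h x0; have [d2 e2] := h y3.
apply: (coprime_monomials _ F0 e1 e2).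
by apply: ord4P; rewrite !mulmnE wt_x0 wt_y3 !monoE ?mul0n ?eqxx ?orbT.
Qed.

Lemma ideal_gen_sub (T J : R -> Prop) : is_ideal J -> (forall q, T q -> J q) ->
  forall p, ideal_gen T p -> J p.
Proof. by move=> iJ TJ p; apply. Qed.

Lemma ideal_genP (T : R -> Prop) p : T p -> ideal_gen T p.
Proof. by move=> Tp J _; apply. Qed.

Lemma ideal_gen_ideal (T : R -> Prop) : is_ideal (ideal_gen T).
Proof.
split=> [J [J0 _ _] _ //|p q hp hq J iJ TJ|p q hq J iJ TJ]; case: (iJ) => _ JD JM.
  by apply: JD; [exact: hp|exact: hq].
by apply: JM; exact: hq.
Qed.

Lemma saturation_sub (J J' : R -> Prop) : (forall p, J p -> J' p) ->
  forall p, saturation J p -> saturation J' p.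
Proof. by move=> JJ p [N hN]; exists N => m /hN /JJ. Qed.

Lemma sub_saturation (J : R -> Prop) p : is_ideal J -> J p -> saturation J p.
Proof. by move=> [_ _ JM] Jp; exists 0%N => m _; exact: JM. Qed.

Lemma divisor_cutE g : phi g != 0 -> ideal_eq (@divisor_cut k 1 3 g) (multiples (phi g)).
Proof.
move=> g0 p; split.
  move=> sp; apply: (multiples_saturated g0); move: p sp; apply: saturation_sub.
  apply: ideal_gen_sub; first exact: multiples_ideal.
  move=> q [Sq|->]; first exact: scroll_multiples.
  by exists 1; rewrite mulr1.
case=> c pc; apply: sub_saturation; first exact: ideal_gen_ideal.
have tc : whomog tau 0 c.
  rewrite -[0](subr0 0); apply: (whomog_cancel tauD g0 (@tau_phi k g)).
  by rewrite mulrC -pc; exact: tau_phi.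
have [_ iD iM] := ideal_gen_ideal (fun p => scroll p \/ p = g).
rewrite -(subrK (sec c * g) p); apply: iD; last by apply: iM; apply: ideal_genP; right.
apply: ideal_genP; left; apply/scrollE.
by rewrite linearB /= phiM phi_sec // pc mulrC subrr.
Qed.

(** F and F' need not lie in the image of [phi], so a multiple F F' c cannot be lifted factor by
    factor. After multiplication by a coordinate x its weight splits as w w', where F w and F' w' c
    have classes that are multiples of H. Hence saturation exponent 1 is enough. *)
Lemma divisor_addE D D' F F' b b' :
  ideal_eq D (multiples F) -> ideal_eq D' (multiples F') -> F != 0 -> F' != 0 ->
  whomog tau b F -> whomog tau b' F' ->
  (forall x, exists w w', wt x = (w + w')%MM /\ tau w = - b) ->
  ideal_eq (@divisor_add k 1 3 D D') (multiples (F * F')).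
Proof.
move=> DE DE' F0 F'0 hF hF' ww p; have FF0 : F * F' != 0 by rewrite mulf_neq0.
split.
  move=> sp; apply: (multiples_saturated FF0); move: p sp; apply: saturation_sub.
  apply: ideal_gen_sub; first exact: multiples_ideal.
  move=> q [Sq|[q1 [q2 [/DE[c1 e1] /DE'[c2 e2] ->]]]]; first exact: scroll_multiples.
  by exists (c1 * c2); rewrite phiM e1 e2 mulrACA.
case=> c pc; have hc : whomog tau (- (b + b')) c.
  rewrite -sub0r; apply: (whomog_cancel tauD FF0 (whomogM tauD hF hF')).
  by rewrite mulrC -pc; exact: tau_phi.
have [_ iD iM] := ideal_gen_ideal (fun p => scroll p \/
     exists q q', [/\ D q, D' q' & p = q * q']).
exists 1%N => m /eqP/mdeg1P[x /eqP ->]; have [w [w' [xE tw]]] := ww x.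
have tw' : tau w' = b.
  have := @tau_phi k 'X_x (wt x); rewrite phiX WtU mcoeffX eqxx oner_eq0.
  by move=> /(_ isT); rewrite xE tauD tw => /eqP; rewrite addrC subr_eq0 => /eqP.
have t1 : whomog tau 0 (F * 'X_[w]).
  by rewrite -(subrr b) -tw; apply: whomogM tauD _ _ _ _ hF (@whomogX _ _ _ _).
have t2 : whomog tau 0 (F' * ('X_[w'] * c)).
  have e0 : b' + (b - (b + b')) = 0 by lia.
  rewrite -e0; apply: (whomogM tauD hF'); apply: (whomogM tauD) => //.
  by rewrite -tw'; exact: whomogX.
pose q1 := sec (F * 'X_[w]); pose q2 := sec (F' * ('X_[w'] * c)).
rewrite -(subrK (q1 * q2) ('X_[_] * p)); apply: iD; apply: ideal_genP; [left|right].
  apply/scrollE; rewrite linearB /= !phiM !phi_sec // phiX WtU xE mpolyXD pc.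
  apply/eqP; rewrite subr_eq0; apply/eqP; ring.
exists q1, q2; split=> //; [apply/DE|apply/DE'].
  by exists 'X_[w]; rewrite phi_sec.
by exists ('X_[w'] * c); rewrite phi_sec.
Qed.

Lemma divisor_mulnE D F b : ideal_eq D (multiples F) -> F != 0 -> whomog tau b F ->
  (forall x, exists w w', wt x = (w + w')%MM /\ tau w = - b) ->
  forall d, ideal_eq (@divisor_muln k 1 3 d D) (multiples (F ^+ d)).
Proof.
move=> DE F0 hF ww; elim=> [|d IH].
  by move=> p; split=> // _; exists (phi p); rewrite expr0 mul1r.
have hFd := whomogX_exp tauD d hF.
by rewrite exprS; apply: (divisor_addE DE IH F0 (expf_neq0 d F0) hF hFd ww).
Qed.

Lemma split_wt0 x : exists w w', wt x = (w + w')%MM /\ tau w = - 0.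
Proof. by exists 0%MM, (wt x); rewrite add0m oppr0 /tau !mnm0E. Qed.

Lemma split_wt1 x : exists w w', wt x = (w + w')%MM /\ tau w = - 1.
Proof.
move: x; apply: ord6P; rewrite !wtE.
- exists (mono 0 0 1 0), (mono 1 0 0 0); split=> //; by apply/mnmP; apply: ord4P; rewrite mnmDE.
- exists (mono 0 0 1 0), (mono 0 1 0 0); split=> //; by apply/mnmP; apply: ord4P; rewrite mnmDE.
- exists (mono 2 0 0 1), (mono 1 0 0 0); split=> //; by apply/mnmP; apply: ord4P; rewrite mnmDE.
- exists (mono 2 0 0 1), (mono 0 1 0 0); split=> //; by apply/mnmP; apply: ord4P; rewrite mnmDE.
- exists (mono 1 1 0 1), (mono 0 1 0 0); split=> //; by apply/mnmP; apply: ord4P; rewrite mnmDE.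
- exists (mono 0 2 0 1), (mono 0 1 0 0); split=> //; by apply/mnmP; apply: ord4P; rewrite mnmDE.
Qed.

Section RulingLine.
Variables s0 t0 : k.
Hypothesis st0 : (s0, t0) != (0, 0).

Definition line_form : C := t0 *: 'X_vs - s0 *: 'X_vt.

Lemma line_form_neq0 : line_form != 0.
Proof.
apply: contraNneq st0 => l0; rewrite xpair_eqE; apply/andP; split; apply/eqP.
  have := congr1 (mcoeff U_(vt)) l0; rewrite mcoeffB !mcoeffZ !mcoeffXU mcoeff0 eqxx mulr1.
  by rewrite mulr0 sub0r => /eqP; rewrite oppr_eq0 => /eqP.
have := congr1 (mcoeff U_(vs)) l0; rewrite mcoeffB !mcoeffZ !mcoeffXU mcoeff0 eqxx mulr1.
by rewrite mulr0 subr0.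
Qed.

Let tauU i : tau U_(i) = (i < 2)%N%:Z - (if i == vu then 1 else if i == vv then 3 else 0).
Proof. by move: i; apply: ord4P; rewrite /tau !mnm1E. Qed.

Lemma tau_line_form : whomog tau 1 line_form.
Proof.
have tX i z : tau U_(i) = z -> whomog tau z ('X_i : C) by move=> <-; exact: whomogX.
by apply: whomogB; apply: whomogZ; apply: tX; rewrite tauU.
Qed.

Lemma fib_line_form : whomog fib 0 line_form.
Proof.
have fX i z : fib U_(i) = z -> whomog fib z ('X_i : C) by move=> <-; exact: whomogX.
by apply: whomogB; apply: whomogZ; apply: fX; rewrite /fib /fibre_deg !mnm1E.
Qed.

(** Substituting s0 Z and t0 Z for s and t, with Z = al s + be t, changes a polynomial only by a
    multiple of [line_form]. If p vanishes on the line, the substituted polynomial is zero as a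
    function. *)
Lemma ruling_lineE : ideal_eq (@ruling_line k 1 3 s0 t0) (multiples line_form).
Proof.
have [[al be] /= abE] : exists ab : k * k, ab.1 * s0 + ab.2 * t0 = 1.
  have [s00|s00] := eqVneq s0 0.
    exists (0, t0^-1); rewrite mul0r add0r mulVf //.
    by apply: contraNneq st0 => ->; rewrite s00.
  by exists (s0^-1, 0); rewrite mul0r addr0 mulVf.
pose Z : C := al *: 'X_vs + be *: 'X_vt.
pose h := [tuple s0 *: Z; t0 *: Z; 'X_vu; 'X_vv].
move=> p; split=> [hp|[c pc] u v]; last first.
  rewrite meval_scroll pc mevalM mevalB !mevalZ !mevalXU /point /=.
  by rewrite [t0 * _]mulrC subrr mul0r.
have cong (q : C) : exists c, q - (q \mPo h) = line_form * c.
  have congM (q1 q2 : C) : (exists c, q1 - (q1 \mPo h) = line_form * c) ->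
      (exists c, q2 - (q2 \mPo h) = line_form * c) ->
      exists c, q1 * q2 - ((q1 * q2) \mPo h) = line_form * c.
    move=> [c1 e1] [c2 e2]; exists (c1 * q2 + (q1 \mPo h) * c2).
    by rewrite rmorphM mulrDr mulrA -e1 mulrCA -e2; ring.
  have cong1 : exists c, 1 - ((1 : C) \mPo h) = line_form * c.
    by exists 0; rewrite rmorph1 subrr mulr0.
  have congX i : exists c, 'X_i - (('X_i : C) \mPo h) = line_form * c.
    move: i; apply: ord4P; rewrite comp_mpolyXU /=.
    - exists be%:MP; rewrite /line_form /Z -!mul_mpolyC.
      have := congr1 (@mpolyC 4 k) abE; rewrite mpolyCD !mpolyCM mpolyC1 => e.
      rewrite -{1}['X_vs]mul1r -e; ring.
    - exists (- al)%:MP; rewrite /line_form /Z -!mul_mpolyC mpolyCN.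
      have := congr1 (@mpolyC 4 k) abE; rewrite mpolyCD !mpolyCM mpolyC1 => e.
      rewrite -{1}['X_vt]mul1r -e; ring.
    - by exists 0; rewrite subrr mulr0.
    - by exists 0; rewrite subrr mulr0.
  elim/mpolyind: q => [|a m q _ _ [c qc]].
    by exists 0; rewrite linear0 subrr mulr0.
  have [d md] : exists d, 'X_[m] - (('X_[m] : C) \mPo h) = line_form * d.
    rewrite mpolyXE_id; elim/big_ind: _ => // i _.
    elim: (m i) => [|e IH]; first by rewrite expr0.
    by rewrite exprS; exact: congM.
  exists (a *: d + c); rewrite linearD linearZ /= mulrDr -scalerAr -md -qc scalerBr.
  ring.
have [c cE] := cong (phi p); exists c; rewrite -cE.
rewrite [X in _ - X](_ : _ = 0) ?subr0 //; apply: mpoly_fun_eq0 => v.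
rewrite comp_mpoly_meval; pose z := al * v vs + be * v vt.
transitivity ((phi p).@[point (s0 * z) (t0 * z) (v vu) (v vv)]).
  apply: meval_eq; apply: ord4P; rewrite /point /= !(tnth_nth 0) /=;
    by rewrite ?mevalZ ?mevalD ?mevalZ ?mevalXU.
(* Rescaling (s, t) by z is absorbed by the fibre coordinates: u has weight 1 and v weight 3 on S(1,
   3). *)
rewrite -meval_scroll -[RHS](hp (z * v vu) (z ^+ 3 * v vv)).
apply: meval_eq => x; rewrite /scroll_point; case: (split x) => -[i lt_i] /=.
  by case: i lt_i => [|[|i]] //= _; rewrite ?expr0 ?expr1; ring.
by case: i lt_i => [|[|[|[|i]]]] //= _; rewrite ?subn0 ?subnn ?expr0; ring.
Qed.

End RulingLine.

(** The coordinates have pairwise distinct weights, so no cancellation occurs: S spans P^5. *)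
Lemma phi_linear_neq0 (l : R) : l != 0 -> l \is 1.-homog for mdeg -> phi l != 0.
Proof.
move=> l0 hl; have := mlead_supp l0; set m0 := mlead l => lm0.
have deg1 m : m \in msupp l -> exists x, m = U_(x)%MM.
  by move/dhomogP: hl => hl /hl/eqP/mdeg1P[x /eqP]; exists x.
have [x mx] := deg1 _ lm0.
rewrite mx in lm0.
apply: contraTneq (lm0) => p0; rewrite mcoeff_msupp negbK; apply/eqP.
have := congr1 (mcoeff (wt x)) p0; rewrite mcoeff0 phiE raddf_sum /=.
rewrite (bigD1_seq U_(x)%MM lm0 (msupp_uniq l)) /= mcoeffZ mcoeffX WtU eqxx mulr1.
rewrite big_seq_cond big1 ?addr0 // => m /andP[/deg1[y ->] yx].
rewrite mcoeffZ mcoeffX WtU (_ : _ == _ = false) ?mulr0 //.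
by apply: contraNF yx => /eqP/wt_inj ->.
Qed.

(* The divisor I satisfies I + div g = a H + b F + div g', so its equation is
   the quotient of the equation of a H + b F + div g' by that of div g. *)
Lemma divisor_equation (a b : nat) (I : R -> Prop) :
  @effective_divisor k 1 3 I -> @in_divisor_class k 1 3 a b I ->
  exists f : C, [/\ f != 0, whomog tau b f, whomog fib a f
                  & forall p, I p <-> multiples f p].
Proof.
case=> [[[iI _] satI] SI _] [l [s0 [t0 [l0 hl st0]]]] [d [g [g' [hg hg' Sg Sg' eqI]]]].
have [I0 ID IM] := iI.
have g0 : phi g != 0 by apply/eqP => /scrollE.
have g'0 : phi g' != 0 by apply/eqP => /scrollE.
have pl0 := phi_linear_neq0 l0 hl.
pose L := phi l ^+ a * line_form s0 t0 ^+ b.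
have tL : whomog tau b L.
  have hb := whomogX_exp tauD b (@tau_line_form s0 t0).
  have ha := whomogX_exp tauD a (@tau_phi k l).
  by have := whomogM tauD ha hb; rewrite mul0rn natz add0r.
have fL : whomog fib a L.
  have hb := whomogX_exp fibD b (@fib_line_form s0 t0).
  have ha := whomogX_exp fibD a (fib_phi hl).
  by have := whomogM fibD ha hb; rewrite mul0rn natz addr0.
have L0 : L != 0 by rewrite mulf_neq0 // expf_neq0 // line_form_neq0.
have DE : ideal_eq (@divisor_add k 1 3 (@divisor_muln k 1 3 a (@divisor_cut k 1 3 l))
    (@divisor_muln k 1 3 b (@ruling_line k 1 3 s0 t0))) (multiples L).
  apply: (@divisor_addE _ _ _ _ 0 b).
  - exact: (divisor_mulnE (divisor_cutE pl0) pl0 (@tau_phi k l) split_wt0).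
  - exact: (divisor_mulnE (ruling_lineE st0) (line_form_neq0 st0) (@tau_line_form s0 t0) split_wt1).
  - by rewrite expf_neq0.
  - by rewrite expf_neq0 // line_form_neq0.
  - by have := whomogX_exp tauD a (@tau_phi k l); rewrite mul0rn.
  - by have := whomogX_exp tauD b (@tau_line_form s0 t0); rewrite natz.
  - exact: split_wt0.
have eqL : ideal_eq (@divisor_add k 1 3 I (@divisor_cut k 1 3 g)) (multiples (L * phi g')).
  move=> p; rewrite eqI; split=> [|[c pc]].
    move=> sp; apply: (multiples_saturated (mulf_neq0 L0 g'0)); move: p sp; apply: saturation_sub.
    apply: ideal_gen_sub; first exact: multiples_ideal.
    move=> q [Sq|[q1 [q2 [/DE[c1 e1] /(divisor_cutE g'0)[c2 e2] ->]]]]; first exact: scroll_multiples.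
    by exists (c1 * c2); rewrite phiM e1 e2 mulrACA.
  (* The summands are swapped because [divisor_addE] splits weights according to the class of the
     first equation, which for the form g' is trivial in [tau]. *)
  have : @divisor_add k 1 3 (@divisor_cut k 1 3 g') (multiples L) p.
    apply/(divisor_addE (divisor_cutE g'0) (fun q => iff_refl _) g'0 L0 (@tau_phi k g') tL split_wt0).
    by exists c; rewrite [phi g' * L]mulrC.
  apply: saturation_sub; apply: ideal_gen_sub; first exact: ideal_gen_ideal.
  move=> q [Sq|[q1 [q2 [h1 h2 ->]]]]; apply: ideal_genP; first by left.
  by right; exists q2, q1; split=> //; [exact/DE|rewrite mulrC].
have addg p : @divisor_add k 1 3 I (@divisor_cut k 1 3 g) p -> multiples (phi g) p.
  move=> sp; apply: (multiples_saturated g0); move: p sp; apply: saturation_sub.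
  apply: ideal_gen_sub; first exact: multiples_ideal.
  move=> q [Sq|[q1 [q2 [_ /(divisor_cutE g0)[c2 e2] ->]]]]; first exact: scroll_multiples.
  by exists (phi q1 * c2); rewrite phiM e2 mulrCA.
have [f fE] : exists f, L * phi g' = phi g * f.
  have mono_dvd w : tau w = - b%:Z -> exists c, 'X_[w] * (L * phi g') = phi g * c.
    move=> tw; have hw : whomog tau 0 ('X_[w] * (L * phi g')).
      rewrite -(addNr b%:Z) -tw; apply: whomogM tauD _ _ _ _ _ _; first exact: whomogX.
      by rewrite -[b%:Z]addr0; apply: whomogM tauD _ _ _ _ tL (@tau_phi k g').
    have : multiples (L * phi g') (sec ('X_[w] * (L * phi g'))).
      by exists 'X_[w]; rewrite phi_sec // mulrC.
    by move/eqL/addg => [c]; rewrite phi_sec // => ->; exists c.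
  (* Both u^b and s^(2b) v^b cancel the b F in the class of L, and they are coprime. So the
     divisibility by [phi g] descends to L times [phi g']. *)
  have [|c1 e1] := mono_dvd (mono 0 0 b 0); first by rewrite /tau !monoE; lia.
  have [|c2 e2] := mono_dvd (mono (2 * b) 0 0 b); first by rewrite /tau !monoE; lia.
  by apply: (coprime_monomials _ g0 e1 e2); apply: ord4P; rewrite !monoE ?eqxx ?orbT.
have f0 : f != 0.
  by apply: contraNneq (mulf_neq0 L0 g'0) => f0; rewrite fE f0 mulr0.
exists f; split=> //.
- rewrite -[b%:Z]subr0; apply: (whomog_cancel tauD g0 (@tau_phi k g)).
  rewrite mulrC -fE -[b%:Z]addr0; exact: (whomogM tauD tL (@tau_phi k g')).
- rewrite -[a%:Z](addrK d%:Z); apply: (whomog_cancel fibD g0 (fib_phi hg)).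
  rewrite mulrC -fE; exact: (whomogM fibD fL (fib_phi hg')).
have cut_ideal := ideal_gen_ideal (fun p => scroll p \/
     exists q q', [/\ I q, @divisor_cut k 1 3 g q' & p = q * q']).
have gg : @divisor_cut k 1 3 g g by apply/(divisor_cutE g0); exists 1; rewrite mulr1.
move=> p; split=> [Ip|[c pc]].
  have : multiples (L * phi g') (p * g).
    apply/eqL; apply: (sub_saturation cut_ideal); apply: ideal_genP; right.
    by exists p, g.
  by move=> [c]; rewrite phiM fE -mulrA [phi p * _]mulrC => /(mulfI g0) e; exists c.
have : multiples (L * phi g') (p * g).
  by exists c; rewrite phiM pc fE mulrC mulrA.
move/eqL => [N hN]; apply: satI; exists N => m /hN.
rewrite mulrA => mpg.
(* The ideal generated by I(S) and the products of I with the ideal of div g is contained in J.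
   Cancelling [phi g] then puts m p into I up to I(S), and the saturation of I removes m. *)
pose J r := exists2 e, I e & phi r = phi g * phi e.
have : J ('X_[m] * p * g).
  apply: (ideal_gen_sub (J := J) _ _ mpg).
    split=> [|q1 q2 [e1 I1 E1] [e2 I2 E2]|q1 q2 [e2 I2 E2]].
    - by exists 0 => //; rewrite !linear0 mulr0.
    - by exists (e1 + e2); [exact: ID|rewrite !linearD /= E1 E2 mulrDr].
    - by exists (q1 * e2); [exact: IM|rewrite !phiM E2 mulrCA].
  move=> q [/scrollE q0|[q1 [q2 [I1 /(divisor_cutE g0)[c2 e2] ->]]]].
    by exists 0 => //; rewrite q0 linear0 mulr0.
  have tc2 : whomog tau 0 c2.
    rewrite -[0](subr0 0); apply: (whomog_cancel tauD g0 (@tau_phi k g)).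
    by rewrite mulrC -e2; exact: tau_phi.
  exists (sec c2 * q1); first exact: IM.
  by rewrite !phiM e2 phi_sec // mulrCA [_ * c2]mulrC.
move=> [e Ie]; rewrite phiM mulrC => /(mulfI g0) eE.
rewrite -(subrK e (_ * p)); apply: ID => //; apply/SI/scrollE.
by rewrite linearB /= eE subrr.
Qed.

End Divisors.

(** * Ideals as graded modules *)

Section IdealModule.
Variables (k : fieldType) (n : nat) (I : {mpoly k[n]} -> Prop).
Hypothesis idI : is_ideal I.
Local Notation R := {mpoly k[n]}.

Let gdegI (r : int) (p : R) := I p /\ homogeneous_of_degree r p.
Let actI (x : 'I_n) : {linear R -> R} := mulX U_(x).

Let gdegI_subspace r : subspace (gdegI r).
Proof.
have sI := ideal_subspace idI; have sh := hod_subspace k n r.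
split; first by split; [exact: subspace0 sI|exact: subspace0 sh].
by move=> a u v [Iu hu] [Iv hv]; split; [exact: (proj2 sI)|exact: (proj2 sh)].
Qed.

Let actI_deg x r u : gdegI r u -> gdegI (r + 1) (actI x u).
Proof.
move=> [Iu hu]; split; first by rewrite /= /mulX mulrC; case: idI => _ _; exact.
apply: hodM hu _; apply/hodE => m; rewrite mcoeffX.
by case: (eqVneq _ m) => [<- _|]; rewrite ?mdeg1 ?eqxx.
Qed.

Let actIC x y r u : gdegI r u -> actI x (actI y u) = actI y (actI x u).
Proof. by move=> _; rewrite /= /mulX mulrAC. Qed.

Definition ideal_module : gmod k n := Gmod gdegI_subspace actI_deg actIC.

Let koszul_res i (v : {ffun {set 'I_n} -> R}) : {ffun Koszul.basis n i -> R} :=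
  Koszul.res i v.

Let koszul_res_is_linear i : linear (koszul_res i).
Proof. by move=> a u v; apply/ffunP => B; rewrite !ffunE. Qed.

HB.instance Definition _ i := GRing.isLinear.Build k {ffun {set 'I_n} -> R}
  {ffun Koszul.basis n i -> R} _ (koszul_res i) (koszul_res_is_linear i).

Let koszul_bdE (v : {ffun {set 'I_n} -> R}) B :
  Koszul.bd v B = (bd (v : {ffun {set 'I_n} -> ideal_module})) B.
Proof.
rewrite ffunE; apply: eq_bigr => x _.
rewrite /ksign /Koszul.sign /= /mulX -signr_odd -[in RHS]signr_odd.
by case: (odd _); rewrite ?expr1 ?expr0 ?mul1r ?scale1r ?scaleN1r ?mulN1r ?mulNr mulrC.
Qed.

Let supp_chain (i : nat) r (v : {ffun {set 'I_n} -> ideal_module}) :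
  chain i r v -> Koszul.supported i v.
Proof. by move=> Kv B cB; case: (Kv B) => _; exact. Qed.

Let ext i (v : {ffun Koszul.basis n i -> R}) : {ffun {set 'I_n} -> ideal_module} :=
  [ffun B => Koszul.ext v B].

Let res_ext i v : koszul_res i (ext v) = v.
Proof. by apply/ffunP => B; rewrite !ffunE Koszul.ext_val. Qed.

Let koszul_diff_res (i : nat) r (v : {ffun {set 'I_n} -> ideal_module}) :
  chain i.+1 r v -> free_map (@Koszul.diff k n i) (koszul_res i.+1 v) = koszul_res i (bd v).
Proof.
move=> Kv; apply/ffunP => B; rewrite Koszul.free_mapE [RHS]ffunE -koszul_bdE.
by apply: Koszul.eq_bd; apply: Koszul.ext_res; exact: supp_chain Kv.
Qed.

Let tensor_res (i : nat) r (v : {ffun {set 'I_n} -> ideal_module}) :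
  chain i r v -> @tensor_part k n (koszul_resolution k n) I i (i%:Z + r) (koszul_res i v).
Proof.
by move=> Kv B; rewrite ffunE /= addrAC subrr add0r; case: (Kv (val B)).
Qed.

Let chain_ext (i : nat) r v :
  @tensor_part k n (koszul_resolution k n) I i (i%:Z + r) v -> chain i r (ext v).
Proof.
move=> tv B; rewrite ffunE; split; last by move=> cB; exact: Koszul.supp_ext.
have [cB|cB] := boolP (#|B| == i); last first.
  by rewrite Koszul.supp_ext //; exact: subspace0 (gdegI_subspace r).
have := tv (Sub B cB : Koszul.basis n i); rewrite /= addrAC subrr add0r.
by rewrite -Koszul.ext_val SubK.
Qed.

Let res_inj (i : nat) r (u v : {ffun {set 'I_n} -> ideal_module}) :
  chain i r u -> chain i r v -> koszul_res i u = koszul_res i v -> u = v.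
Proof.
move=> Ku Kv e; apply/ffunP => B.
rewrite -(Koszul.ext_res (supp_chain Ku)) -(Koszul.ext_res (supp_chain Kv)).
by rewrite -!/(koszul_res _ _) e.
Qed.

(** By [tor_comparison] the Koszul resolution suffices. Its free modules have the sets of size i as
    bases, so restricting chains to those sets identifies the two complexes. *)
Lemma betti_number_hdim (i : nat) j m :
  hdim ideal_module i j m -> betti_number I i j m.
Proof.
move=> h P; apply: (tor_comparison idI (P := koszul_resolution k n)).
have cyc_bd (v : {ffun {set 'I_n} -> ideal_module}) : chain i j v -> @res_cycle k n (koszul_resolution k n) i (koszul_res i v)
    <-> bd (v : {ffun {set 'I_n} -> ideal_module}) = 0.
  case: i h v => [|i] h v Kv.
    split=> // _; apply/ffunP => B; rewrite -koszul_bdE ffunE /Koszul.bd big1 // => x xB.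
    by rewrite (supp_chain Kv) ?mulr0 // cardsU1 xB.
  split=> v0; last by rewrite /= (koszul_diff_res Kv) v0 linear0.
  apply: (res_inj (i := i) (r := j + 1)).
  - by have := chain_bd Kv; rewrite -addn1 PoszD addrK.
  - exact: subspace0 (chain_subspace _ _ _).
  - by rewrite -(koszul_diff_res Kv) v0 linear0.
have zE : i.+1%:Z + (j - 1) = i%:Z + j by lia.
have iE : i.+1%:Z = i%:Z + 1 by lia.
have tensorS w : @tensor_part k n (koszul_resolution k n) I i.+1 (i%:Z + j) w ->
    chain (i%:Z + 1) (j - 1) (ext w).
  move=> tw; rewrite -iE; apply: chain_ext.
  by rewrite zE.
apply: (quotient_dim_iso (F := koszul_res i) _ _ _ _ _ _ _ h).
- exact: cyc_subspace.
- exact: tor_cycle_subspace.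
- exact: tor_boundary_subspace.
- by move=> v [Kv v0]; split; [exact: tensor_res|apply/cyc_bd].
- move=> _ [w Kw ->]; exists (koszul_res i.+1 w).
    have /tensor_res : chain i.+1%:Z (j - 1) w by rewrite iE.
    by rewrite zE.
  by rewrite [RHS](@koszul_diff_res i (j - 1)) // iE.
- move=> v [Kv _] [w tw e]; exists (ext w); first exact: tensorS.
  have Kw := tensorS _ tw; have Kb := chain_bd Kw; rewrite addrK subrK in Kb.
  apply: (res_inj Kv Kb); rewrite [LHS]e -(koszul_diff_res (r := j - 1)) ?res_ext //.
  by rewrite iE.
move=> v [tv cv]; exists (ext v); last first.
  by rewrite /= res_ext subrr; exact: subspace0 (tor_boundary_subspace _ _ _ _).
have Kv := chain_ext tv; split=> //; apply/(cyc_bd _ Kv); by rewrite res_ext.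
Qed.

End IdealModule.

Section PolynomialRing.
Variables (k : fieldType) (n : nat).

(* the monomials of the quotient by the first d variables *)
Definition killed (d : nat) (m : 'X_{1..n}) : bool := [forall x : 'I_n, (x < d)%N ==> (m x == 0%N)].

Lemma killedP d (m : 'X_{1..n}) : reflect (forall x : 'I_n, (x < d)%N -> m x = 0%N) (killed d m).
Proof.
apply: (iffP forallP) => h x; first by move=> xd; apply/eqP; apply: (implyP (h x)).
by apply/implyP => xd; apply/eqP/h.
Qed.

Lemma convex_killed d : convex (fun x : 'I_n => U_(x)%MM) (killed d).
Proof.
move=> x y m _ /killedP h; apply/killedP => z zd; have := h z zd.
by rewrite !mnmDE; lia.
Qed.

Local Notation dgD := (@mdegD n).
Local Notation dg1 := (@mdeg1 n).

(** Start from k, the quotient by all variables, and put the variables back one at a time as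
    nonzerodivisors. At d = 0 this computes Tor of the ring itself. *)
Lemma row_killed d : (d <= n)%N -> linear_row k dgD dg1 (@convex_killed d) 0 1 d.
Proof.
move=> dn; rewrite -(subKn dn); move: (n - d)%N (leq_subr d n) => e.
elim: e => [|e IH] en.
  rewrite subn0; suff : linear_row k dgD dg1 (@convex_killed n) (mdeg (0%MM : 'X_{1..n})) 1 n.
    by rewrite mdeg0.
  apply: linear_row_single => m.
  apply/killedP/eqP => [h|-> x _]; last by rewrite mnm0E.
  by apply/mnmP => x; rewrite mnm0E h.
have lt_n : (n - e.+1 < n)%N by lia.
have eS : (n - e = (n - e.+1).+1)%N by lia.
apply: (linear_row_regular (Ordinal lt_n) (@convex_killed (n - e))).
- move=> m; apply/killedP/killedP => h x xd; have := h x xd; rewrite mnmDE mnm1E;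
    by case: eqP => [e0|]; rewrite ?addn0 //; move: xd; rewrite -e0 /= ltnn.
- move=> m; rewrite lep1mP negbK; apply/killedP/andP => [h|[/killedP h /eqP h0] x].
    by split; [apply/killedP => x xd; apply: h|apply/eqP/h => /=]; lia.
  rewrite eS ltnS leq_eqVlt => /orP[/eqP xe|]; last exact: h.
  by rewrite (_ : x = Ordinal lt_n) //; apply: val_inj.
by rewrite -eS; apply: IH; lia.
Qed.

Definition ring_module : gmod k n := monomial_module k dgD dg1 (@convex_killed 0).

Lemma hdim_ring (i : nat) j : (i != 0%N) || (j != 0) -> hdim ring_module i j 0.
Proof.
move=> ij; have := row_killed (leq0n n) i j.
by case: i ij => [|i] /=; [move/negPf ->|rewrite bin0n if_same].
Qed.

End PolynomialRing.

(** * The Betti table of a divisor *)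

Section ScrollIdeal.
Variable k : closedFieldType.
Local Notation R := {mpoly k[2 + 4]}.
Local Notation C := {mpoly k[4]}.
Local Notation scroll := (@scroll_ideal k 1 3).
Local Notation module c := (monomial_module k fibre_degD fibre_deg_wt c).
Local Notation E b := (module (convex_twist (b := b))).

Lemma scroll_is_ideal : is_ideal scroll.
Proof.
split=> [|p q /scrollE p0 /scrollE q0|p q /scrollE q0]; apply/scrollE.
- exact: linear0.
- by rewrite linearD /= p0 q0 addr0.
- by rewrite phiM q0 mulr0.
Qed.

Definition scroll_remainder (p : R) : R := p - sec (phi p).

Lemma scroll_remainder_is_linear : linear scroll_remainder.
Proof.
move=> a p q; rewrite /scroll_remainder [phi _]linearP [sec _]linearP scalerBr opprD.
by rewrite addrACA.
Qed.

HB.instance Definition _ :=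
  GRing.isLinear.Build k R R _ scroll_remainder scroll_remainder_is_linear.

Lemma fib_phi_hod (r : int) (p : R) : homogeneous_of_degree r p -> whomog fib r (phi p).
Proof.
by move=> /hodE hp m /mcoeff_phi_neq0[m' /hp <- ->]; rewrite /fib fibre_deg_Wt.
Qed.

Lemma scroll_remainder_spec r (p : R) : homogeneous_of_degree r p ->
  scroll (scroll_remainder p) /\ homogeneous_of_degree r (scroll_remainder p).
Proof.
move=> hp; split.
  by apply/scrollE; rewrite linearB /= phi_sec ?subrr //; exact: tau_phi.
by apply: (subspaceB (hod_subspace _ _ _)) => //; apply/sec_deg/fib_phi_hod.
Qed.

Lemma phi_mulX x (p : R) : phi (mulX U_(x) p) = mulX (wt x) (phi p).
Proof. by rewrite /mulX phiM phiX WtU. Qed.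

Lemma scroll_split_exact :
  split_exact (A := ideal_module scroll_is_ideal) (B := ring_module k (2 + 4)) (C := E 0)
    idfun (phi (k := k)) (sec (k := k)) scroll_remainder.
Proof.
have degR r u : gdeg (g := ring_module k (2 + 4)) r u <-> homogeneous_of_degree r u.
  rewrite hodE; split=> h m um; first by case: (h m um).
  by split; [apply/killedP|exact: h].
have degE r u : gdeg (g := E 0) r u <-> whomog tau 0 u /\ whomog fib r u.
  split=> [h|[h1 h2] m um].
    by split=> m /h[]; rewrite twist_tau oppr0 // => /eqP.
  by rewrite twist_tau oppr0 (h1 m um) eqxx; split=> //; exact: h2.
split=> [r u [_ hu]|r u /degR hu|r u /degE[tu fu]|r u /degR hu|x r u _|x r u _|r u _|r u [/scrollE u0 _]|r u /degE[tu _]|r u _].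
- exact/degR.
- by apply/degE; split; [exact: tau_phi|exact: fib_phi_hod].
- exact/degR/sec_deg.
- exact: scroll_remainder_spec.
- by apply/esym/restr_id => m _; apply/killedP.
- rewrite /= [restr (killed _) _]restr_id; last by move=> m _; apply/killedP.
  rewrite phi_mulX restr_id // => m; rewrite -phi_mulX => /tau_phi.
  by rewrite twist_tau oppr0 => ->.
- by [].
- by [].
- exact: phi_sec.
- by [].
Qed.

Lemma hdim_scroll (i : nat) j :
  hdim (ideal_module scroll_is_ideal) i j (table_row 2 [:: 6; 8; 3; 0; 0]%N i j).
Proof.
have -> : table_row 2 [:: 6; 8; 3; 0; 0]%N i j = base_table 1 i.+1 (j - 1).
  rewrite /= -[1]/(1%:Z) !table_row_shift /table_row /=.
  by case: (i) => [|[|[|[|[|i']]]]] //=; rewrite ?nth_nil ?if_same //.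
(* At i = j = 0 dimension shifting is blocked by the generator of the polynomial ring. That place is
   zero because I(S) contains no nonzero constant. *)
have [/andP[/eqP i0 /eqP j0]|ij] := boolP ((i == 0%N) && (j == 0)).
  subst i j; apply: quotient_dim0 => v [Kv _].
  suff -> : v = 0 by exact: subspace0 (bnd_subspace _ _ _).
  apply/ffunP => X; rewrite ffunE; have [[/scrollE Sv hv] _] := Kv X.
  apply/mpolyP => m; rewrite mcoeff0; apply/eqP/negPn/negP => vm.
  move/hodE: hv => hv; have m0 m' : (v X)@_m' != 0 -> m' = 0%MM.
    by move/hv => [] /eqP; rewrite mdeg_eq0 => /eqP.
  have vE : v X = ((v X)@_0%MM)%:MP.
    apply/mpolyP => m'; rewrite mcoeffC; case: (eqVneq m' 0%MM) => [->|m'0]; rewrite ?mulr1 // mulr0.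
    by apply/eqP/negPn/negP => /m0/eqP; rewrite (negPf m'0).
  have := Sv; rewrite vE /phi comp_mpolyC => /eqP; rewrite mpolyC_eq0 -(m0 m vm).
  by rewrite (negPf vm).
apply: (hdim_syzygy scroll_split_exact).
- by rewrite -[_ + 1]/((i + 1)%N%:Z) addn1; exact: hdim_twist0.
- by rewrite -[_ + 1]/((i + 1)%N%:Z) addn1; apply: hdim_ring.
- by apply: hdim_ring; rewrite -negb_and.
Qed.

Section Divisor.
Variables (I : R -> Prop) (f : C) (a : nat) (b : int).
Hypotheses (idI : is_ideal I) (f0 : f != 0) (tf : whomog tau b f) (ff : whomog fib a f).
Hypothesis IE : forall p, I p <-> multiples f p.

Let gdegE (r : int) (c : C) := [/\ exists c', c = f * c', whomog tau 0 c & whomog fib r c].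
Let actE (x : 'I_(2 + 4)) : {linear C -> C} := mulX (wt x).

Let gdegE_subspace r : subspace (gdegE r).
Proof.
split; first by split; [exists 0; rewrite mulr0|exact: whomog0|exact: whomog0].
move=> e u v [[u' ->] tu fu] [[v' ->] tv fv]; split.
- by exists (e *: u' + v'); rewrite mulrDr scalerAr.
- by apply: whomogD => //; exact: whomogZ.
- by apply: whomogD => //; exact: whomogZ.
Qed.

Let actE_deg x r u : gdegE r u -> gdegE (r + 1) (actE x u).
Proof.
move=> [[u' uE] tu fu]; split.
- by exists (u' * 'X_[wt x]); rewrite /= /mulX uE mulrA.
- rewrite -[0]addr0; apply: (whomogM tauD tu).
  have -> : 0 = tau (wt x) by have := wt_degree x; rewrite /tau; lia.
  exact: whomogX.
- apply: (whomogM fibD fu); have -> : 1 = fib (wt x) by rewrite /fib fibre_deg_wt.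
  exact: whomogX.
Qed.

Let actEC x y r u : gdegE r u -> actE x (actE y u) = actE y (actE x u).
Proof. by move=> _; rewrite /= /mulX mulrAC. Qed.

(* the multiples of f of degrees d H, which are the image of I in the Cox ring *)
Let multiples_module : gmod k (2 + 4) := Gmod gdegE_subspace actE_deg actEC.

Lemma divisor_split_exact :
  split_exact (A := ideal_module scroll_is_ideal) (B := ideal_module idI)
    (C := multiples_module) idfun (phi (k := k)) (sec (k := k)) scroll_remainder.
Proof.
split=> [r u [Su hu]|r u [/IE[c uc] hu]|r u [[c uc] tu fu]|r u [_ hu]|x r u _|x r u _|r u _|r u [/scrollE u0 _]|r u [_ tu _]|r u _].
- split=> //; apply/IE; exact: scroll_multiples.
- by split; [exists c|exact: tau_phi|exact: fib_phi_hod].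
- by split; [apply/IE; exists c; rewrite phi_sec|exact: sec_deg].
- exact: scroll_remainder_spec.
- by [].
- exact: phi_mulX.
- by [].
- by [].
- exact: phi_sec.
- by [].
Qed.

Let mulf : C -> C := fun c => f * c.

Let mulf_is_linear : linear mulf.
Proof. by move=> e u v; rewrite /mulf mulrDr scalerAr. Qed.

HB.instance Definition _ := GRing.isLinear.Build k C C _ mulf mulf_is_linear.

(** Multiplication by f is an isomorphism from E_b(-a): cancelling f from a homogeneous multiple
    leaves a form of the right class. *)
Lemma hdim_multiples (i : int) (j : int) m :
  hdim (E b) i (j - a%:Z) m -> hdim multiples_module i j m.
Proof.
move=> /(@hdim_gshift _ _ a).
have degE r u : gdeg (g := gshift a (E b)) r u <-> whomog tau (- b) u /\ whomog fib (r - a%:Z) u.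
  split=> [h|[h1 h2] m' um].
    by split=> m' /h[]; rewrite twist_tau // => /eqP.
  by rewrite twist_tau (h1 m' um) eqxx; split=> //; exact: h2.
apply: (hdim_transport (A := gshift a (E b)) (B := multiples_module) (F := mulf)) => [r u /degE[tu fu]|x r u /degE[tu _]|u /eqP|r w [[c ->] tw fw]].
- split; first by exists u.
    by rewrite -(subrr b); exact: (whomogM tauD tf tu).
  by rewrite -(subrK a%:Z r) addrC; exact: (whomogM fibD ff fu).
- rewrite /= restr_id; first by rewrite /mulf /mulX mulrA.
  move=> m'; have tx : whomog tau 0 ('X_[wt x] : C).
    have -> : 0 = tau (wt x) by have := wt_degree x; rewrite /tau; lia.
    exact: whomogX.
  by move/(whomogM tauD tu tx); rewrite twist_tau addr0 => ->.
- by rewrite mulf_eq0 (negPf f0) => /eqP.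
exists c => //; apply/degE; split.
  by rewrite -sub0r; apply: (whomog_cancel tauD f0 tf); rewrite mulrC.
by apply: (whomog_cancel fibD f0 ff); rewrite mulrC.
Qed.

(** I(S) lives in row 2 only, so a nonzero connecting map would have to start in row 1 of E_b(-a),
    which is row 1 - a of E_b. *)
Lemma hdim_divisor (T : nat -> int -> nat) :
  (forall (i : nat) j, hdim (E b) i j (T i j)) -> (forall i, T i (1 - a%:Z) = 0%N) ->
  forall (i : nat) j,
    hdim (ideal_module idI) i j (table_row 2 [:: 6; 8; 3; 0; 0] i j + T i (j - a%:Z)%R)%N.
Proof.
move=> hT T1 i j.
have hC (i' : nat) j' : hdim multiples_module i' j' (T i' (j' - a%:Z)).
  exact: hdim_multiples.
apply: (hdim_additive divisor_split_exact (hdim_scroll i j) (hC i j)).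
  have [j2|j2] := eqVneq j 2%:Z; last first.
    by right; have := hdim_scroll i j; rewrite table_row_neq.
  left; have := hC i.+1 (j - 1); rewrite -[i.+1]addn1 PoszD.
  by rewrite (_ : j - 1 - a%:Z = 1 - a%:Z) ?T1 // j2.
have [j1|j1] := eqVneq j 1.
  by left; have := hC i j; rewrite j1 T1.
right; case: (i) => [|i']; first exact: hdim_neg.
have := hdim_scroll i' (j + 1); rewrite table_row_neq; last by apply/eqP; lia.
by rewrite -[i'.+1]addn1 PoszD addrK.
Qed.

End Divisor.
End ScrollIdeal.

Lemma base_table_low c i (j : int) : (j < 0) || (c == 2%N) && (j <= 0) ->
  base_table c i j = 0%N.
Proof. by case: c => [|[|c]] jc; rewrite /= !table_row_neq //; apply/eqP; lia. Qed.

Lemma betti_divisor (k : closedFieldType) (a b c m : nat) (I : {mpoly k[2 + 4]} -> Prop) :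
  (a = 0%N /\ (4 <= b)%N) \/ ((1 <= a)%N /\ (2 <= b)%N) ->
  @effective_divisor k 1 3 I -> @in_divisor_class k 1 3 a b I ->
  (c <= 2)%N -> (b + 1 = c + 3 * m)%N ->
  forall (i : nat) (j : int), betti_number I i j
    (table_row 2 [:: 6; 8; 3; 0; 0] i j + twist_table c m i (j - a%:Z)%R)%N.
Proof.
move=> ab effI classI c2 bE i j.
have [f [f0 tf ff IE]] := divisor_equation effI classI.
have [[[idI _] _] _ _] := effI.
apply: (betti_number_hdim (idI := idI)).
apply: (hdim_divisor idI f0 tf ff IE) => {i j} [i j|i].
  by rewrite (_ : b%:Z = (c + 3 * m)%:Z - 1); [exact: hdim_twist|lia].
(* The conditions on a and b put row 1 - a strictly above the first nonzero row of E_b. The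
   borderline case a = 0, b = 4 has c = 2 and m = 1, and its first row is 2. *)
rewrite /twist_table base_table_low; last by apply/orP; lia.
rewrite add0n big_nat_cond big1 // => l /andP[lm _]; apply: table_row_neq.
by apply/eqP; lia.
Qed.

Lemma twist_table_shift c m i (j : int) (a : nat) :
  twist_table c m i (j - a%:Z) =
  (base_table c i (j - (a + m)%:Z)%R
   + \sum_(0 <= l < m) table_row (a + (c + m + 1 + 2 * l)) row_Q i j)%N.
Proof.
rewrite /twist_table PoszD opprD addrA; congr (_ + _)%N.
by apply: eq_bigr => l _; rewrite table_row_shift addnC.
Qed.

Lemma twist_table_default c m i j : (5 <= i)%N -> twist_table c m i j = 0%N.
Proof.
move=> i5; rewrite /twist_table big1 => [|l _]; last exact: table_row_default.
by case: c => [|[|c]]; rewrite /= !table_row_default.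
Qed.

Lemma table_rowD l s1 s2 s i (j : int) :
  (forall i, nth 0 s1 i + nth 0 s2 i = nth 0 s i)%N ->
  (table_row l s1 i j + table_row l s2 i j)%N = table_row l s i j.
Proof. by move=> s12; rewrite /table_row; case: ifP. Qed.

Theorem theorem1p3 (k : closedFieldType) (a b : nat)
    (I : {mpoly k[2 + 4]} -> Prop) :
  (a = 0%N /\ (4 <= b)%N) \/ ((1 <= a)%N /\ (2 <= b)%N) ->
  @effective_divisor k 1 3 I ->
  @in_divisor_class k 1 3 a b I ->
  [/\ forall delta : nat, b = (3 * delta - 1)%N ->
        forall (i : nat) (j : int),
        betti_number I i j
          (table_row 2 [:: 6; 8; 3; 0; 0] i j
           + table_row (a + delta) [:: 2; 4; 0; 0; 0] i j
           + table_row (a + delta + 1) [:: 1; 4; 10; 6; 1] i j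
           + \sum_(0 <= l < delta - 1)
               table_row (a + b - 2 * l) [:: 1; 4; 6; 4; 1] i j)%N,
      forall delta : nat, b = (3 * delta)%N ->
        forall (i : nat) (j : int),
        betti_number I i j
          (table_row 2 [:: 6; 8; 3; 0; 0] i j
           + table_row (a + delta) [:: 1; 0; 0; 0; 0] i j
           + table_row (a + delta + 1) [:: 0; 6; 8; 3; 0] i j
           + table_row (a + delta + 2) [:: 1; 4; 6; 4; 1] i j
           + \sum_(0 <= l < delta - 1)
               table_row (a + b - 2 * l) [:: 1; 4; 6; 4; 1] i j)%N,
      forall delta : nat, b = (3 * delta + 1)%N ->
        forall (i : nat) (j : int),
        betti_number I i j
          (table_row 2 [:: 6; 8; 3; 0; 0] i j
           + table_row (a + delta + 1) [:: 4; 12; 12; 4; 0] i j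
           + \sum_(0 <= l < delta)
               table_row (a + b - 2 * l) [:: 1; 4; 6; 4; 1] i j)%N
    & forall (i : nat) (j : int), (5 <= i)%N -> betti_number I i j 0].
Proof.
move=> ab effI classI; have betti := betti_divisor ab effI classI.
split=> [d bd i j|d bd i j|d bd i j|i j i5].
- have bE : (b + 1 = 0 + 3 * d)%N by lia.
  have h := betti 0%N d isT bE i j; refine (eq_ind _ (betti_number I i j) h _ _); clear h.
  have [d' dE] : exists d', d = d'.+1 by exists d.-1; lia.
  rewrite twist_table_shift /= !table_row_shift !add0n dE big_nat_recl // subn1 /=.
  rewrite -!addnA; congr (_ + (_ + _))%N; rewrite addnA; congr (_ + _)%N.
    (* The term l = 0 of the sum falls into row a + d + 1, together with the second row of E_(-1);
       this is the origin of (1, 4, 10, 6, 1). *)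
    rewrite -(@table_rowD _ [:: 0; 0; 4; 2; 0]%N row_Q [:: 1; 4; 10; 6; 1]%N); last first.
      by case=> [|[|[|[|[|i']]]]] //=; rewrite nth_nil.
    by congr (table_row _ _ _ _ + table_row _ _ _ _)%N; lia.
  (* [twist_table] counts the remaining rows upwards from the lowest one, the statement downwards
     from a + b. *)
  rewrite [RHS]big_nat_rev /=.
  by apply: eq_big_nat => l /andP[_ ld]; congr table_row; lia.
- have bE : (b + 1 = 1 + 3 * d)%N by lia.
  have h := betti 1%N d isT bE i j; refine (eq_ind _ (betti_number I i j) h _ _); clear h.
  have [d' dE] : exists d', d = d'.+1 by exists d.-1; lia.
  rewrite twist_table_shift /= !table_row_shift add0n dE big_nat_recl // subn1 /=.
  rewrite -!addnA; congr (_ + (_ + (_ + (_ + _))))%N.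
  - by congr table_row; lia.
  - by congr table_row; lia.
  rewrite [RHS]big_nat_rev /=.
  by apply: eq_big_nat => l /andP[_ ld]; congr table_row; lia.
- have bE : (b + 1 = 2 + 3 * d)%N by lia.
  have h := betti 2%N d isT bE i j; refine (eq_ind _ (betti_number I i j) h _ _); clear h.
  rewrite twist_table_shift /= !table_row_shift.
  rewrite -!addnA; congr (_ + (_ + _))%N; first by congr table_row; lia.
  rewrite [RHS]big_nat_rev /=.
  by apply: eq_big_nat => l /andP[_ ld]; congr table_row; lia.
(* Division of b + 1 by 3 covers the three residue classes at once. *)
have := betti ((b + 1) %% 3)%N ((b + 1) %/ 3)%N _ _ i j.
rewrite table_row_default // twist_table_default //; apply.
  by rewrite -ltnS ltn_pmod.
by rewrite {1}(divn_eq (b + 1) 3) addnC mulnC.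
Qed.
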